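(* The set $U=\mathbf{R}^3\setminus\{0\}$ does not have a harmonic hull: among the connected open subsets $W\subseteq\mathbf{C}^3$ containing $U$ to which every harmonic function on $U$ extends holomorphically, there is no maximal one, i.e. none that contains all the others.
   Context: $\mathbf{R}^3$ is regarded as the real part of $\mathbf{C}^3$. A harmonic function on an open set $U\subseteq\mathbf{R}^3$ is a (complex-valued) solution $u$ of $\sum_{i=1}^3\partial^2u/\partial x_i^2=0$ on $U$. The harmonic hull of a connected open set $U\subseteq\mathbf{R}^n$ is, if it exists, the maximal connected open subset $W$ of $\mathbf{C}^n$ containing $U$ (one containing all other such sets) such that every harmonic function on $U$ extends to a holomorphic function on $W$. *)

(* Defs.v *)
From Stdlib Require Import Reals.
From Coquelicot Require Import Coquelicot.

Open Scope R_scope.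

Definition R3 : Type := (R * R * R)%type.
Definition C3 : Type := (C * C * C)%type.

Definition R3_to_C3 (x : R3) : C3 :=
  let '(x1, x2, x3) := x in (RtoC x1, RtoC x2, RtoC x3).

(* [D] is an arbitrary subset: the traces of [A] and [B] on [D] are its
   relatively open subsets. *)
Definition connected {T : UniformSpace} (D : T -> Prop) : Prop :=
  forall A B : T -> Prop, open A -> open B ->
    (forall x, D x -> A x \/ B x) ->
    (exists x, D x /\ A x) ->
    (exists x, D x /\ B x) ->
    exists x, D x /\ A x /\ B x.

Inductive axis : Set := axis1 | axis2 | axis3.

(* The point [x] moved by [t] along the given coordinate axis. *)
Definition move (i : axis) (x : R3) (t : R) : R3 :=
  let '(x1, x2, x3) := x in
  match i with
  | axis1 => (x1 + t, x2, x3)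
  | axis2 => (x1, x2 + t, x3)
  | axis3 => (x1, x2, x3 + t)
  end.

(* The real partial derivative of the complex-valued [f] along axis [i] exists
   at [x] and equals [l]. *)
Definition is_partial (i : axis) (f : R3 -> C) (x : R3) (l : C) : Prop :=
  is_derive (K := R_AbsRing) (V := C_R_NormedModule)
    (fun t : R => f (move i x t)) 0 l.

(* Classical solutions of class C^2: [d i] and [dd i j] are the first and second
   partial derivatives on [U]; the values of [u], [d], [dd] off the open set [U]
   play no role. *)
Definition harmonic_on (U : R3 -> Prop) (u : R3 -> C) : Prop :=
  exists (d : axis -> R3 -> C) (dd : axis -> axis -> R3 -> C),
    forall x : R3, U x ->
      continuous u x /\
      (forall i, is_partial i u x (d i x) /\ continuous (d i) x) /\
      (forall i j, is_partial j (d i) x (dd i j x) /\ continuous (dd i j) x) /\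
      (dd axis1 axis1 x + dd axis2 axis2 x + dd axis3 axis3 x)%C = RtoC 0.

(* Complex (Frechet) differentiability at every point of the open set [W]. *)
Definition holomorphic_on (W : C3 -> Prop) (F : C3 -> C) : Prop :=
  forall z : C3, W z ->
    ex_filterdiff (K := C_AbsRing)
      (U := prod_NormedModule C_AbsRing
              (prod_NormedModule C_AbsRing C_NormedModule C_NormedModule)
              C_NormedModule)
      (V := C_NormedModule) F (locally z).

Definition harmonic_extension_domain (U : R3 -> Prop) (W : C3 -> Prop) : Prop :=
  open W /\ connected W /\
  (forall x : R3, U x -> W (R3_to_C3 x)) /\
  (forall u : R3 -> C, harmonic_on U u ->
     exists F : C3 -> C, holomorphic_on W F /\
       forall x : R3, U x -> F (R3_to_C3 x) = u x).

Definition is_harmonic_hull (U : R3 -> Prop) (W : C3 -> Prop) : Prop :=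
  harmonic_extension_domain U W /\
  forall W' : C3 -> Prop, harmonic_extension_domain U W' ->
    forall z : C3, W' z -> W z.

(* Main.v *)
Require Import Defs.
From Stdlib Require Import Reals Lra Lia Classical ClassicalEpsilon.
From Coquelicot Require Import Coquelicot.

(* Write q(z) = z1^2 + z2^2 + z3^2. For each of the two signs s, let W_s be the
   set of z such that q(z) avoids the closed ray from 0 through - s i; on W_s the
   square root of q has a holomorphic branch that equals |x| at real x.

   Every harmonic u on R^3 \ {0} extends to W_s. By Green's identity, for real
   x <> 0, u(x) is up to a nonzero constant the flux of G grad u - u grad G,
   with G(y) = 1/|y - x|, through the boundary of a large cube minus the flux
   through the boundary of a small cube around 0. Replacing |y - x| by the branch
   of sqrt(q(y - z)) makes both fluxes holomorphic in z in W_s, and the field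
   stays divergence free in y, so that the sizes of the two cubes do not matter.
   That divergence free fields have zero flux through boxes is proved by
   Goursat's bisection; the same theorem for planar fields gives Cauchy's theorem
   on rectangles for functions that are merely complex differentiable.

   A harmonic hull W would contain both W_1 and W_{-1}, hence all points
   (zeta, 0, 0) with zeta <> 0. The extension F of 1/|x| to W would then make
   h(w) = e^w F(e^w, 0, 0) an entire function equal to 1 on R and to -1 on
   R + i pi, contradicting uniqueness of analytic continuation. *)

Open Scope R_scope.

(** Two cubes are forced by the slit: for a fixed complex z the number q(y - z) may hit it at some
    intermediate real y, and then no field is defined on the whole region in between. For y near 0,
    however, q(y - z) is close to q(z), which is off the slit, and for large y its real part |y - Re
    z|^2 - |Im z|^2 is positive. For real z = x the kernel is defined at every y other than x, so
    the two fluxes can be compared: their difference shrinks to the flux through a small cube around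
    x, which tends to u(x) times the full solid angle 4 pi, six times that of one face.

    The slits are the two halves of the imaginary axis because both avoid the positive reals, where
    q maps the nonzero real points, and they meet only at 0, so that the two slit planes together
    cover C minus 0.

    Boxes rather than spheres make the argument elementary: they can be halved for Goursat's
    bisection, cut by a plane between two singularities, and their faces need only iterated
    integrals over rectangles. *)

Notation C_R_complete := C_R_CompleteNormedModule.
Notation R2_US := (prod_UniformSpace R_UniformSpace R_UniformSpace).
Notation R3_US := (prod_UniformSpace R2_US R_UniformSpace).
Notation C3_US := (prod_UniformSpace (prod_UniformSpace C_UniformSpace C_UniformSpace) C_UniformSpace).
Notation Ccontinuous := (continuous (U := C_UniformSpace)).
Notation CCcontinuous := (continuous (T := C_UniformSpace) (U := C_UniformSpace)).
Notation Rcontinuous := (continuous (T := R_UniformSpace) (U := C_UniformSpace)).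

(** * Continuity and integration of complex-valued functions *)

Ltac Cring := match goal with |- ?a = ?b => change (@eq C a b); ring end.

Ltac Ctriangle := eapply Rle_trans; [apply Cmod_triangle|].
Ltac triple_ring := apply f_equal2; [apply f_equal2|]; ring.

Lemma C_R_norm (z : C) : norm (V := C_R_NormedModule) z = Cmod z.
Proof.
  unfold norm; simpl; unfold prod_norm, Cmod; simpl.
  f_equal. unfold norm; simpl; unfold abs; simpl.
  rewrite !Rmult_1_r, <- !Rabs_mult, !Rabs_pos_eq; auto; apply Rle_0_sqr.
Qed.

Lemma ball_R (x e y : R) : ball x e y <-> Rabs (y - x) < e.
Proof. reflexivity. Qed.

Lemma Rabs_fst_Cmod (z : C) : Rabs (fst z) <= Cmod z.
Proof. eapply Rle_trans; [apply Rmax_l|apply Rmax_Cmod]. Qed.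

Lemma Rabs_snd_Cmod (z : C) : Rabs (snd z) <= Cmod z.
Proof. eapply Rle_trans; [apply Rmax_r|apply Rmax_Cmod]. Qed.

Lemma Cmod_le_add (z : C) : Cmod z <= Rabs (fst z) + Rabs (snd z).
Proof.
  unfold Cmod. apply Rsqr_incr_0_var.
  2: generalize (Rabs_pos (fst z)), (Rabs_pos (snd z)); lra.
  rewrite Rsqr_sqrt by (apply Rplus_le_le_0_compat; apply pow2_ge_0).
  unfold Rsqr. rewrite <- (pow2_abs (fst z)), <- (pow2_abs (snd z)).
  generalize (Rabs_pos (fst z)), (Rabs_pos (snd z)); intros; nra.
Qed.

(** Balls of the uniform structure on [C] are squares; the factor 2 is a crude substitute for the
    square root of 2. *)
Lemma ball_C_Cmod (x y : C) (e : R) : ball (M := C_UniformSpace) x e y -> Cmod (y - x) < 2 * e.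
Proof.
  intros [H1 H2]. eapply Rle_lt_trans; [apply Cmod_le_add|].
  rewrite ball_R in H1, H2. simpl.
  replace (2 * e) with (e + e) by ring. now apply Rplus_lt_compat.
Qed.

Lemma Cmod_ball_C (x y : C) (e : R) : Cmod (y - x) < e -> ball (M := C_UniformSpace) x e y.
Proof.
  intros H. split; rewrite ball_R.
  - eapply Rle_lt_trans; [apply (Rabs_fst_Cmod (y - x)%C)|exact H].
  - eapply Rle_lt_trans; [apply (Rabs_snd_Cmod (y - x)%C)|exact H].
Qed.

Lemma continuous_C_iff {T : UniformSpace} (f : T -> C) (p : T) :
  Ccontinuous f p <->
  forall eps, 0 < eps -> locally p (fun q => Cmod (f q - f p) < eps).
Proof.
  split.
  - intros H eps He.
    assert (He2 : 0 < eps / 2) by lra.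
    specialize (proj1 (filterlim_locally f (f p)) H (mkposreal _ He2)).
    apply filter_imp. intros q Hq. apply ball_C_Cmod in Hq. simpl in Hq. lra.
  - intros H. apply filterlim_locally. intros eps.
    generalize (H eps (cond_pos eps)). apply filter_imp.
    intros q. apply Cmod_ball_C.
Qed.

Section ContC.
Context {T : UniformSpace}.
Implicit Types f g : T -> C.

Lemma continuous_C_pair (f : T -> C) p :
  continuous (fun x => fst (f x)) p -> continuous (fun x => snd (f x)) p ->
  Ccontinuous f p.
Proof.
  intros H1 H2.
  apply (continuous_ext (fun x => (fst (f x), snd (f x)))).
  - intros x; now destruct (f x).
  - apply continuous_C_iff. intros eps He.
    assert (He2 : 0 < eps / 2) by lra.
    generalize (filter_and _ _
      (proj1 (filterlim_locally _ _) H1 (mkposreal _ He2))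
      (proj1 (filterlim_locally _ _) H2 (mkposreal _ He2))).
    apply filter_imp. intros x [A B]. rewrite ball_R in A, B. simpl in A, B.
    eapply Rle_lt_trans; [apply Cmod_le_add|]. simpl.
    replace eps with (eps / 2 + eps / 2) by field. now apply Rplus_lt_compat.
Qed.

Lemma continuous_C_fst f p : Ccontinuous f p -> continuous (fun x => fst (f x)) p.
Proof. intros H. apply (continuous_comp f fst); [exact H|]. destruct (f p). apply continuous_fst. Qed.

Lemma continuous_C_snd f p : Ccontinuous f p -> continuous (fun x => snd (f x)) p.
Proof. intros H. apply (continuous_comp f snd); [exact H|]. destruct (f p). apply continuous_snd. Qed.

Lemma continuous_Cplus f g p :
  Ccontinuous f p -> Ccontinuous g p ->
  Ccontinuous (fun x => f x + g x)%C p.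
Proof.
  intros H1 H2. apply continuous_C_pair; simpl.
  - apply (continuous_plus (fun x => fst (f x)) (fun x => fst (g x)));
      now apply continuous_C_fst.
  - apply (continuous_plus (fun x => snd (f x)) (fun x => snd (g x)));
      now apply continuous_C_snd.
Qed.

Lemma continuous_Copp f p :
  Ccontinuous f p ->
  Ccontinuous (fun x => - f x)%C p.
Proof.
  intros H1. apply continuous_C_pair; simpl.
  - apply (continuous_opp (fun x => fst (f x))); now apply continuous_C_fst.
  - apply (continuous_opp (fun x => snd (f x))); now apply continuous_C_snd.
Qed.

Lemma continuous_Cminus f g p :
  Ccontinuous f p -> Ccontinuous g p ->
  Ccontinuous (fun x => f x - g x)%C p.
Proof. intros H1 H2. apply continuous_Cplus; auto using continuous_Copp. Qed.

Lemma continuous_Cmult f g p :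
  Ccontinuous f p -> Ccontinuous g p ->
  Ccontinuous (fun x => f x * g x)%C p.
Proof.
  intros H1 H2. apply continuous_C_pair; simpl.
  - apply (continuous_minus (fun x => fst (f x) * fst (g x)) (fun x => snd (f x) * snd (g x)));
      [apply (continuous_mult (fun x => fst (f x)) (fun x => fst (g x)))
      |apply (continuous_mult (fun x => snd (f x)) (fun x => snd (g x)))];
      auto using continuous_C_fst, continuous_C_snd.
  - apply (continuous_plus (fun x => fst (f x) * snd (g x)) (fun x => snd (f x) * fst (g x)));
      [apply (continuous_mult (fun x => fst (f x)) (fun x => snd (g x)))
      |apply (continuous_mult (fun x => snd (f x)) (fun x => fst (g x)))];
      auto using continuous_C_fst, continuous_C_snd.
Qed.

Lemma continuous_RtoC (f : T -> R) p :
  continuous f p -> Ccontinuous (fun x => RtoC (f x)) p.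
Proof. intros H. apply continuous_C_pair; simpl; [exact H|apply continuous_const]. Qed.

End ContC.

(* Lebesgue-number form of the compactness of a rectangle. *)
Lemma rectangle_compact (Q : R -> R -> R -> Prop) (a b c d : R) :
  (forall r r' x y, 0 < r' <= r -> Q r x y -> Q r' x y) ->
  (forall x y, a <= x <= b -> c <= y <= d ->
     exists r, 0 < r /\
       forall x' y', Rabs (x' - x) < r -> Rabs (y' - y) < r -> Q r x' y') ->
  exists r, 0 < r /\ forall x y, a <= x <= b -> c <= y <= d -> Q r x y.
Proof.
  intros Hmono Hloc.
  (* The gauge has to be defined on the whole plane; off the rectangle it takes the default radius
     1. *)
  assert (Hd : forall x y, exists r : posreal, a <= x <= b -> c <= y <= d ->
     forall x' y', Rabs (x' - x) < r -> Rabs (y' - y) < r -> Q r x' y').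
  { intros x y. destruct (classic (a <= x <= b /\ c <= y <= d)) as [[Hx Hy]|H].
    - destruct (Hloc x y Hx Hy) as [r [Hr H]]. exists (mkposreal r Hr). intros _ _. exact H.
    - exists (mkposreal 1 Rlt_0_1). intros; exfalso; tauto. }
  set (delta := fun x y => proj1_sig (constructive_indefinite_description _ (Hd x y))).
  destruct (compactness_value_2d a b c d delta) as [r Hr].
  exists r. split; [apply cond_pos|]. intros x y Hx Hy.
  (* [compactness_value_2d] gives its covering statement under a double negation. *)
  apply NNPP. intros Hn. apply (Hr x y Hx Hy). intros [u [v [Hu [Hv [H1 [H2 H3]]]]]].
  apply Hn. apply (Hmono (delta u v)). { split; [apply cond_pos|exact H3]. }
  exact (proj2_sig (constructive_indefinite_description _ (Hd u v)) Hu Hv x y H1 H2).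
Qed.

(** * Integrals of complex-valued functions of a real variable *)

Notation CRInt := (RInt (V := C_R_complete)).
Notation is_CRInt := (is_RInt (V := C_R_NormedModule)).
Notation ex_CRInt := (ex_RInt (V := C_R_NormedModule)).

Lemma ex_CRInt_continuous (f : R -> C) a b :
  (forall x, Rmin a b <= x <= Rmax a b -> Ccontinuous f x) -> ex_CRInt f a b.
Proof. intros H. apply (ex_RInt_continuous (V := C_R_complete)). exact H. Qed.

Lemma CRInt_correct f a b : ex_CRInt f a b -> is_CRInt f a b (CRInt f a b).
Proof. apply (RInt_correct (V := C_R_complete)). Qed.

Lemma is_CRInt_unique f a b l : is_CRInt f a b l -> CRInt f a b = l.
Proof. apply (is_RInt_unique (V := C_R_complete)). Qed.

(** The integral is real-linear by construction; a complex factor is treated through the real and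
    imaginary parts of the product. *)
Lemma is_CRInt_Cmult (k : C) f a b l :
  is_CRInt f a b l -> is_CRInt (fun x => k * f x)%C a b (k * l)%C.
Proof.
  intros H.
  pose proof (is_RInt_fct_extend_fst f a b l H) as H1.
  pose proof (is_RInt_fct_extend_snd f a b l H) as H2.
  apply is_RInt_fct_extend_pair; simpl.
  - apply (is_RInt_minus (fun x => fst k * fst (f x)) (fun x => snd k * snd (f x)));
      [apply (is_RInt_scal (fun x => fst (f x)))|apply (is_RInt_scal (fun x => snd (f x)))]; assumption.
  - apply (is_RInt_plus (fun x => fst k * snd (f x)) (fun x => snd k * fst (f x)));
      [apply (is_RInt_scal (fun x => snd (f x)))|apply (is_RInt_scal (fun x => fst (f x)))]; assumption.
Qed.

Lemma CRInt_Cmult (k : C) f a b :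
  ex_CRInt f a b -> CRInt (fun x => k * f x)%C a b = (k * CRInt f a b)%C.
Proof. intros H. apply is_CRInt_unique, is_CRInt_Cmult, CRInt_correct, H. Qed.

Lemma CRInt_plus f g a b :
  ex_CRInt f a b -> ex_CRInt g a b -> CRInt (fun x => f x + g x)%C a b = (CRInt f a b + CRInt g a b)%C.
Proof. apply (RInt_plus (V := C_R_complete)). Qed.

Lemma CRInt_const (k : C) a b : CRInt (fun _ => k) a b = (RtoC (b - a) * k)%C.
Proof.
  rewrite (RInt_const (V := C_R_complete)).
  apply injective_projections; simpl; unfold scal; simpl; unfold mult; simpl; ring.
Qed.

Lemma CRInt_ext f g a b :
  a <= b -> (forall x, a <= x <= b -> f x = g x) -> CRInt f a b = CRInt g a b.
Proof.
  intros Hab H. apply (RInt_ext (V := C_R_complete)).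
  rewrite Rmin_left, Rmax_right by lra. intros x Hx; apply H; lra.
Qed.

Lemma CRInt_norm f a b M :
  a <= b -> ex_CRInt f a b -> (forall x, a <= x <= b -> Cmod (f x) <= M) ->
  Cmod (CRInt f a b) <= (b - a) * M.
Proof.
  intros Hab Hex H. rewrite <- C_R_norm.
  apply (norm_RInt_le_const f a b); auto.
  - intros x Hx; rewrite C_R_norm; auto.
  - apply CRInt_correct, Hex.
Qed.

(** * Iterated integrals over rectangles *)

Definition clamp (a b x : R) : R := Rmax a (Rmin b x).

Lemma clamp_in a b x : a <= b -> a <= clamp a b x <= b.
Proof. intros H; unfold clamp. generalize (Rmax_l a (Rmin b x)), (Rmin_l b x).
  intros; split; auto. apply Rmax_lub; auto. Qed.

Lemma clamp_id a b x : a <= x <= b -> clamp a b x = x.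
Proof. intros H; unfold clamp. rewrite Rmin_right, Rmax_right; lra. Qed.

Lemma clamp_lip a b x y : Rabs (clamp a b x - clamp a b y) <= Rabs (x - y).
Proof.
  unfold clamp, Rmax, Rmin, Rabs.
  repeat (destruct (Rle_dec _ _)); repeat (destruct (Rcase_abs _)); lra.
Qed.

Definition continuous2 (f : R -> R -> C) (x y : R) : Prop :=
  continuous (T := R2_US) (U := C_UniformSpace)
    (fun p => f (fst p) (snd p)) (x, y).

Definition continuous2_on (f : R -> R -> C) (a b c d : R) : Prop :=
  forall x y, a <= x <= b -> c <= y <= d -> continuous2 f x y.

Definition I2 (f : R -> R -> C) (a b c d : R) : C :=
  CRInt (fun x => CRInt (fun y => f x y) c d) a b.

Lemma continuous2_iff f x y :
  continuous2 f x y <-> forall eps, 0 < eps -> exists r, 0 < r /\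
    forall x' y', Rabs (x' - x) < r -> Rabs (y' - y) < r -> Cmod (f x' y' - f x y) < eps.
Proof.
  unfold continuous2. rewrite continuous_C_iff. split; intros H eps He.
  - destruct (H eps He) as [r Hr]. exists r. split; [apply cond_pos|].
    intros x' y' Hx Hy. apply (Hr (x', y')). split; assumption.
  - destruct (H eps He) as [r [Hr H']]. exists (mkposreal r Hr).
    intros [x' y'] [Hx Hy]. apply H'; assumption.
Qed.

Lemma continuous2_intro f x y :
  continuous (T := R2_US) (U := C_UniformSpace)
    (fun p => f (fst p) (snd p)) (x, y) -> continuous2 f x y.
Proof. trivial. Qed.

Lemma continuous2_snd f x y : continuous2 f x y -> Ccontinuous (f x) y.
Proof.
  rewrite continuous2_iff. intros H. apply continuous_C_iff. intros eps He.
  destruct (H eps He) as [r [Hr H']]. exists (mkposreal r Hr). intros y' Hy'.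
  apply H'; [rewrite Rminus_diag, Rabs_R0; exact Hr|exact Hy'].
Qed.

(** For fixed [x], compactness of [c, d] makes the continuity of [f] at the points (x, y) uniform in
    [y], and the integrals then differ by at most (d - c) times the oscillation. *)
Lemma continuous_CRInt_param (f : R -> R -> C) c d x :
  c <= d -> (forall u v, continuous2 f u v) ->
  Ccontinuous (fun x => CRInt (f x) c d) x.
Proof.
  intros Hcd Hf. apply continuous_C_iff. intros eps He.
  (* The [+ 1] keeps the denominator positive when [c = d]. *)
  set (e := eps / (2 * (d - c + 1))).
  assert (Hdc : 0 < 2 * (d - c + 1)) by lra.
  assert (He' : 0 < e) by (unfold e; apply Rdiv_lt_0_compat; lra).
  (* Only [y] varies, so the other side of the rectangle is the degenerate interval [0, 0]. *)
  destruct (rectangle_compact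
    (fun r _ y => forall x', Rabs (x' - x) < r -> Cmod (f x' y - f x y) < e) 0 0 c d)
    as [r [Hr H]].
  { intros r r' _ y Hrr H x' Hx'. apply H. lra. }
  { intros u v _ _.
    assert (He2 : 0 < e / 2) by lra.
    destruct (proj1 (continuous2_iff f x v) (Hf x v) (e / 2) He2) as [r [Hr H]].
    exists r. split; [exact Hr|]. intros _ y' _ Hy' x' Hx'.
    replace (f x' y' - f x y')%C with ((f x' y' - f x v) - (f x y' - f x v))%C by ring.
    eapply Rle_lt_trans; [apply Cmod_triangle|]. rewrite Cmod_opp.
    assert (Cmod (f x' y' - f x v) < e / 2) by auto.
    assert (Cmod (f x y' - f x v) < e / 2).
    { apply H; auto. rewrite Rminus_diag, Rabs_R0; exact Hr. }
    lra. }
  exists (mkposreal r Hr). intros x' Hx'.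
  assert (Hex : forall u, ex_CRInt (f u) c d).
  { intros u. apply ex_CRInt_continuous. intros v _. apply continuous2_snd, Hf. }
  assert (Hex' : ex_CRInt (fun y => - (1) * f x y)%C c d).
  { eexists. apply is_CRInt_Cmult, CRInt_correct, Hex. }
  replace (CRInt (f x') c d - CRInt (f x) c d)%C
    with (CRInt (fun y => f x' y + - (1) * f x y)%C c d).
  2: { rewrite CRInt_plus, CRInt_Cmult; auto. Cring. }
  eapply Rle_lt_trans.
  { apply (CRInt_norm _ _ _ e Hcd).
    - destruct (Hex x') as [l1 H1], Hex' as [l2 H2]. eexists. apply (is_RInt_plus _ _ _ _ _ _ H1 H2).
    - intros y Hy. apply Rlt_le. replace (f x' y + - (1) * f x y)%C with (f x' y - f x y)%C by ring.
      apply (H 0 y); try lra. exact Hx'. }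
  unfold e. apply Rlt_le_trans with ((2 * (d - c + 1)) * (eps / (2 * (d - c + 1)))).
  - apply Rmult_lt_compat_r; [exact He'|lra].
  - right; field; lra.
Qed.

Lemma continuous2_minus f g x y :
  continuous2 f x y -> continuous2 g x y -> continuous2 (fun s t => f s t - g s t)%C x y.
Proof.
  apply (continuous_Cminus (T := R2_US)
    (fun p => f (fst p) (snd p)) (fun p => g (fst p) (snd p))).
Qed.

Lemma continuous2_mult f g x y :
  continuous2 f x y -> continuous2 g x y -> continuous2 (fun s t => f s t * g s t)%C x y.
Proof.
  apply (continuous_Cmult (T := R2_US)
    (fun p => f (fst p) (snd p)) (fun p => g (fst p) (snd p))).
Qed.

Section I2.
Variables a b c d : R.
Hypotheses (Hab : a <= b) (Hcd : c <= d).

(** Retracting the plane onto the rectangle turns continuity on the rectangle into continuity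
    everywhere, the form in which [continuous_CRInt_param] asks for it. *)
Let ext (f : R -> R -> C) x y := f (clamp a b x) (clamp c d y).

Lemma ext_continuous f : continuous2_on f a b c d -> forall x y, continuous2 (ext f) x y.
Proof.
  intros Hf x y. apply continuous2_iff. intros eps He.
  destruct (proj1 (continuous2_iff f _ _)
    (Hf _ _ (clamp_in a b x Hab) (clamp_in c d y Hcd)) eps He) as [r [Hr H]].
  exists r; split; [exact Hr|]. intros x' y' Hx Hy.
  apply H; eapply Rle_lt_trans; try apply clamp_lip; assumption.
Qed.

Lemma ex_inner f x : continuous2_on f a b c d -> a <= x <= b -> ex_CRInt (fun y => f x y) c d.
Proof.
  intros Hf Hx. apply ex_CRInt_continuous. rewrite Rmin_left, Rmax_right by lra.
  intros y Hy. apply (continuous2_snd f), Hf; assumption.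
Qed.

Lemma ex_outer f : continuous2_on f a b c d -> ex_CRInt (fun x => CRInt (fun y => f x y) c d) a b.
Proof.
  intros Hf.
  apply (ex_RInt_ext (V := C_R_NormedModule) (fun x => CRInt (ext f x) c d)).
  - rewrite Rmin_left, Rmax_right by lra. intros x Hx.
    apply CRInt_ext; [exact Hcd|]. intros y Hy. unfold ext. now rewrite !clamp_id by lra.
  - apply ex_CRInt_continuous. intros x _. apply continuous_CRInt_param; [exact Hcd|].
    now apply ext_continuous.
Qed.

Lemma continuous2_on_plus f g :
  continuous2_on f a b c d -> continuous2_on g a b c d ->
  continuous2_on (fun x y => f x y + g x y)%C a b c d.
Proof. intros Hf Hg x y Hx Hy. apply (continuous_Cplus (T := R2_US)); [now apply Hf|now apply Hg]. Qed.

Lemma continuous2_on_Cmult k f :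
  continuous2_on f a b c d -> continuous2_on (fun x y => k * f x y)%C a b c d.
Proof. intros Hf x y Hx Hy. apply (continuous_Cmult (T := R2_US) (fun _ => k)); [apply continuous_const|now apply Hf]. Qed.

Lemma I2_ext f g :
  (forall x y, a <= x <= b -> c <= y <= d -> f x y = g x y) -> I2 f a b c d = I2 g a b c d.
Proof. intros H. apply CRInt_ext; auto. intros x Hx. apply CRInt_ext; auto. Qed.

Lemma I2_plus f g :
  continuous2_on f a b c d -> continuous2_on g a b c d ->
  I2 (fun x y => f x y + g x y)%C a b c d = (I2 f a b c d + I2 g a b c d)%C.
Proof.
  intros Hf Hg. unfold I2. rewrite <- CRInt_plus by now apply ex_outer.
  apply CRInt_ext; auto. intros x Hx. apply CRInt_plus; now apply ex_inner.
Qed.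

Lemma I2_Cmult k f :
  continuous2_on f a b c d ->
  I2 (fun x y => k * f x y)%C a b c d = (k * I2 f a b c d)%C.
Proof.
  intros Hf. unfold I2. rewrite <- CRInt_Cmult by now apply ex_outer.
  apply CRInt_ext; auto. intros x Hx. apply CRInt_Cmult; now apply ex_inner.
Qed.

Lemma I2_minus f g :
  continuous2_on f a b c d -> continuous2_on g a b c d ->
  I2 (fun x y => f x y - g x y)%C a b c d = (I2 f a b c d - I2 g a b c d)%C.
Proof.
  intros Hf Hg.
  transitivity (I2 (fun x y => f x y + (- (1)) * g x y)%C a b c d).
  { apply I2_ext. intros; ring. }
  rewrite I2_plus, I2_Cmult; auto using continuous2_on_Cmult. Cring.
Qed.

Lemma I2_const (k : C) : I2 (fun _ _ => k) a b c d = (RtoC ((b - a) * (d - c)) * k)%C.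
Proof. unfold I2. rewrite CRInt_const, CRInt_const, RtoC_mult. Cring. Qed.

Lemma I2_norm f M :
  continuous2_on f a b c d ->
  (forall x y, a <= x <= b -> c <= y <= d -> Cmod (f x y) <= M) ->
  Cmod (I2 f a b c d) <= (b - a) * (d - c) * M.
Proof.
  intros Hf H. unfold I2. rewrite Rmult_assoc. apply CRInt_norm; auto using ex_outer.
  intros x Hx. apply CRInt_norm; auto using ex_inner.
Qed.

Lemma I2_norm_const f k M :
  continuous2_on f a b c d ->
  (forall x y, a <= x <= b -> c <= y <= d -> Cmod (f x y - k) <= M) ->
  Cmod (I2 f a b c d - RtoC ((b - a) * (d - c)) * k) <= (b - a) * (d - c) * M.
Proof.
  intros Hf H. rewrite <- I2_const.
  assert (Hk : continuous2_on (fun _ _ => k) a b c d) by (intros x y _ _; apply continuous_const).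
  rewrite <- I2_minus; auto. apply I2_norm; auto.
  intros x y Hx Hy.
  apply (continuous_Cminus (T := R2_US)
    (fun p => f (fst p) (snd p)) (fun _ => k)); [now apply Hf|apply continuous_const].
Qed.

Lemma I2_chasles_1 f m :
  a <= m <= b -> continuous2_on f a b c d ->
  I2 f a b c d = (I2 f a m c d + I2 f m b c d)%C.
Proof.
  intros Hm Hf. unfold I2. symmetry.
  apply (RInt_Chasles (V := C_R_complete) (fun x => CRInt (fun y => f x y) c d)).
  - apply (ex_RInt_Chasles_1 (V := C_R_complete) _ a m b Hm). now apply ex_outer.
  - apply (ex_RInt_Chasles_2 (V := C_R_complete) _ a m b Hm). now apply ex_outer.
Qed.

End I2.

Lemma I2_chasles_2 f a b c d m :
  a <= b -> c <= m <= d -> continuous2_on f a b c d ->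
  I2 f a b c d = (I2 f a b c m + I2 f a b m d)%C.
Proof.
  intros Hab Hm Hf.
  unfold I2. rewrite <- CRInt_plus.
  - apply CRInt_ext; auto. intros x Hx. symmetry.
    apply (RInt_Chasles (V := C_R_complete) (fun y => f x y)).
    + apply (ex_RInt_Chasles_1 (V := C_R_complete) _ c m d Hm). apply (ex_inner a b c d); auto; lra.
    + apply (ex_RInt_Chasles_2 (V := C_R_complete) _ c m d Hm). apply (ex_inner a b c d); auto; lra.
  - apply ex_outer; try lra. intros x y Hx Hy; apply Hf; lra.
  - apply ex_outer; try lra. intros x y Hx Hy; apply Hf; lra.
Qed.

Lemma continuous2_affine f p q r s t :
  0 < r -> continuous2 f (r * s + p) (r * t + q) ->
  continuous2 (fun s t => f (r * s + p) (r * t + q)) s t.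
Proof.
  rewrite !continuous2_iff. intros Hr Hf eps He. destruct (Hf eps He) as [e [He' H]].
  exists (e / r). split; [apply Rdiv_lt_0_compat; lra|].
  assert (K : forall x y v, Rabs (x - y) < e / r -> Rabs (r * x + v - (r * y + v)) < e).
  { intros x y v Hxy. replace (r * x + v - (r * y + v)) with (r * (x - y)) by ring.
    rewrite Rabs_mult, (Rabs_pos_eq r) by lra. apply (Rmult_lt_compat_l r) in Hxy; [|lra].
    replace (r * (e / r)) with e in Hxy by (field; lra). exact Hxy. }
  intros s' t' Hs' Ht'. apply H; now apply K.
Qed.

(** Brings a face of a shrinking cube back to a fixed square, where the kernel depends on the size
    only through a power of [r]. *)
Lemma I2_scale f (p q r : R) :
  0 < r ->
  continuous2_on f (p - r) (p + r) (q - r) (q + r) ->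
  I2 f (p - r) (p + r) (q - r) (q + r) =
  (RtoC (r * r) * I2 (fun s t => f (r * s + p)%R (r * t + q)%R) (-1) 1 (-1) 1)%C.
Proof.
  intros Hr Hf. unfold I2.
  assert (Hsc : forall (k : R) (z : C), scal (V := C_R_ModuleSpace) k z = (RtoC k * z)%C).
  { intros k z. apply injective_projections; simpl; unfold scal; simpl; unfold mult; simpl; ring. }
  replace (p - r) with (r * -1 + p) in * by ring. replace (p + r) with (r * 1 + p) in * by ring.
  replace (q - r) with (r * -1 + q) in * by ring. replace (q + r) with (r * 1 + q) in * by ring.
  assert (E : forall x, r * -1 + p <= x <= r * 1 + p ->
     CRInt (fun y => f x y) (r * -1 + q) (r * 1 + q) = (RtoC r * CRInt (fun t => f x (r * t + q)%R) (-1) 1)%C).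
  { intros x Hx.
    rewrite <- (RInt_comp_lin (V := C_R_complete) (fun y => f x y)).
    - rewrite (RInt_scal (V := C_R_complete) (fun t => f x (r * t + q))). apply Hsc.
      apply ex_CRInt_continuous. rewrite Rmin_left, Rmax_right by lra. intros t Ht.
      apply (continuous_comp (fun t => r * t + q) (fun y => f x y)).
      + apply (continuous_plus (fun t => r * t) (fun _ => q)); [|apply continuous_const].
        apply (continuous_mult (fun _ => r) (fun t => t)); [apply continuous_const|apply continuous_id].
      + apply (continuous2_snd f), Hf; nra.
    - apply (ex_inner (r * -1 + p) (r * 1 + p)); auto; lra. }
  erewrite CRInt_ext; [|lra|exact E].
  assert (Hf2 : continuous2_on (fun s t => f (r * s + p) (r * t + q)) (-1) 1 (-1) 1).
  { intros s t Hs Ht. apply (continuous2_affine f p q r s t Hr), Hf; nra. }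
  rewrite <- (RInt_comp_lin (V := C_R_complete) (fun x => (RtoC r * CRInt (fun t => f x (r * t + q)%R) (-1) 1)%C)).
  - rewrite (RInt_scal (V := C_R_complete)).
    + rewrite Hsc. rewrite CRInt_Cmult by (apply (ex_outer (-1) 1 (-1) 1); auto; lra).
      rewrite RtoC_mult. Cring.
    + eexists. apply is_CRInt_Cmult, CRInt_correct. apply (ex_outer (-1) 1 (-1) 1); auto; lra.
  - apply (ex_RInt_ext (V := C_R_NormedModule) (fun x => CRInt (fun y => f x y) (r * -1 + q) (r * 1 + q))).
    + rewrite Rmin_left, Rmax_right by lra. intros x Hx. apply E. lra.
    + apply ex_outer; auto; lra.
Qed.

Global Opaque I2 continuous2.

(** * Fluxes through boxes *)

Definition continuous3 (f : R3 -> C) (x y z : R) : Prop :=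
  continuous (T := R3_US) (U := C_UniformSpace) f (x, y, z).

Lemma continuous3_iff f x y z :
  continuous3 f x y z <-> forall eps, 0 < eps -> exists r, 0 < r /\
    forall x' y' z', Rabs (x' - x) < r -> Rabs (y' - y) < r -> Rabs (z' - z) < r ->
      Cmod (f (x', y', z') - f (x, y, z)) < eps.
Proof.
  unfold continuous3. rewrite continuous_C_iff. split; intros H eps He.
  - destruct (H eps He) as [r Hr]. exists r. split; [apply cond_pos|].
    intros x' y' z' Hx Hy Hz. apply (Hr (x', y', z')). repeat split; assumption.
  - destruct (H eps He) as [r [Hr H']]. exists (mkposreal r Hr).
    intros [[x' y'] z'] [[Hx Hy] Hz]. apply H'; assumption.
Qed.

Lemma continuous3_intro (f : R3 -> C) x y z :
  continuous (T := R3_US) (U := C_UniformSpace) f (x, y, z) -> continuous3 f x y z.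
Proof. trivial. Qed.

Lemma continuous3_elim (f : R3 -> C) x y z :
  continuous3 f x y z ->
  continuous (T := R3_US) (U := C_UniformSpace) f (x, y, z).
Proof. trivial. Qed.

Lemma continuous3_const k x y z : continuous3 (fun _ => k) x y z.
Proof. apply continuous_const. Qed.

Lemma continuous3_opp f x y z : continuous3 f x y z -> continuous3 (fun p => - f p)%C x y z.
Proof. apply (continuous_Copp f). Qed.

Lemma continuous3_minus f g x y z :
  continuous3 f x y z -> continuous3 g x y z -> continuous3 (fun p => f p - g p)%C x y z.
Proof. apply (continuous_Cminus f g). Qed.

Lemma continuous3_mult f g x y z :
  continuous3 f x y z -> continuous3 g x y z -> continuous3 (fun p => f p * g p)%C x y z.
Proof. apply (continuous_Cmult f g). Qed.

Lemma continuous3_face1 f x y z : continuous3 f x y z -> continuous2 (fun s t => f (x, s, t)) y z.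
Proof.
  rewrite continuous3_iff, continuous2_iff. intros H eps He. destruct (H eps He) as [r [Hr H']].
  exists r; split; [exact Hr|]. intros; apply H'; auto. rewrite Rminus_diag, Rabs_R0; exact Hr.
Qed.

Lemma continuous3_face2 f x y z : continuous3 f x y z -> continuous2 (fun s t => f (s, y, t)) x z.
Proof.
  rewrite continuous3_iff, continuous2_iff. intros H eps He. destruct (H eps He) as [r [Hr H']].
  exists r; split; [exact Hr|]. intros; apply H'; auto. rewrite Rminus_diag, Rabs_R0; exact Hr.
Qed.

Lemma continuous3_face3 f x y z : continuous3 f x y z -> continuous2 (fun s t => f (s, t, z)) x y.
Proof.
  rewrite continuous3_iff, continuous2_iff. intros H eps He. destruct (H eps He) as [r [Hr H']].
  exists r; split; [exact Hr|]. intros; apply H'; auto. rewrite Rminus_diag, Rabs_R0; exact Hr.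
Qed.

Global Opaque continuous3.

Section Flux.
Variables V1 V2 V3 : R3 -> C.

Definition flux (a1 b1 a2 b2 a3 b3 : R) : C :=
  (I2 (fun y z => V1 (b1, y, z)) a2 b2 a3 b3 - I2 (fun y z => V1 (a1, y, z)) a2 b2 a3 b3
   + (I2 (fun x z => V2 (x, b2, z)) a1 b1 a3 b3 - I2 (fun x z => V2 (x, a2, z)) a1 b1 a3 b3)
   + (I2 (fun x y => V3 (x, y, b3)) a1 b1 a2 b2 - I2 (fun x y => V3 (x, y, a3)) a1 b1 a2 b2))%C.

(* Either differentiability at the point or continuity there of the three
   partial derivatives [dV_i/dx_i] yields this. *)
Definition divergence_free (x y z : R) : Prop :=
  exists L1 L2 L3 : C, (L1 + L2 + L3)%C = 0 /\
  forall eps, 0 < eps -> exists delta, 0 < delta /\ forall r, 0 < r < delta ->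
    forall x' y' z' t, Rabs (x' - x) <= r -> Rabs (y' - y) <= r -> Rabs (z' - z) <= r ->
      (Rabs (t - x) <= r ->
       Cmod (V1 (t, y', z') - V1 (x', y', z') - RtoC (t - x') * L1) <= eps * r) /\
      (Rabs (t - y) <= r ->
       Cmod (V2 (x', t, z') - V2 (x', y', z') - RtoC (t - y') * L2) <= eps * r) /\
      (Rabs (t - z) <= r ->
       Cmod (V3 (x', y', t) - V3 (x', y', z') - RtoC (t - z') * L3) <= eps * r).

Definition regular (x y z : R) : Prop :=
  continuous3 V1 x y z /\ continuous3 V2 x y z /\ continuous3 V3 x y z /\ divergence_free x y z.

(** The integral over the cutting face occurs twice with opposite signs and cancels as a number.
    Continuity is therefore asked only on the four faces that are themselves cut in two. *)
Lemma flux_split_1 a1 m b1 a2 b2 a3 b3 :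
  a1 <= m <= b1 -> a2 <= b2 -> a3 <= b3 ->
  (forall x z, a1 <= x <= b1 -> a3 <= z <= b3 -> continuous3 V2 x a2 z /\ continuous3 V2 x b2 z) ->
  (forall x y, a1 <= x <= b1 -> a2 <= y <= b2 -> continuous3 V3 x y a3 /\ continuous3 V3 x y b3) ->
  flux a1 b1 a2 b2 a3 b3 = (flux a1 m a2 b2 a3 b3 + flux m b1 a2 b2 a3 b3)%C.
Proof.
  intros Hm H2 H3 C2 C3. unfold flux.
  rewrite (I2_chasles_1 a1 b1 a3 b3 ltac:(lra) H3 (fun x z => V2 (x, b2, z)) m Hm)
    by (intros ? ? ? ?; apply (continuous3_face2 V2); apply C2; auto).
  rewrite (I2_chasles_1 a1 b1 a3 b3 ltac:(lra) H3 (fun x z => V2 (x, a2, z)) m Hm)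
    by (intros ? ? ? ?; apply (continuous3_face2 V2); apply C2; auto).
  rewrite (I2_chasles_1 a1 b1 a2 b2 ltac:(lra) H2 (fun x y => V3 (x, y, b3)) m Hm)
    by (intros ? ? ? ?; apply (continuous3_face3 V3); apply C3; auto).
  rewrite (I2_chasles_1 a1 b1 a2 b2 ltac:(lra) H2 (fun x y => V3 (x, y, a3)) m Hm)
    by (intros ? ? ? ?; apply (continuous3_face3 V3); apply C3; auto).
  ring.
Qed.

Lemma flux_split_2 a1 b1 a2 m b2 a3 b3 :
  a1 <= b1 -> a2 <= m <= b2 -> a3 <= b3 ->
  (forall y z, a2 <= y <= b2 -> a3 <= z <= b3 -> continuous3 V1 a1 y z /\ continuous3 V1 b1 y z) ->
  (forall x y, a1 <= x <= b1 -> a2 <= y <= b2 -> continuous3 V3 x y a3 /\ continuous3 V3 x y b3) ->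
  flux a1 b1 a2 b2 a3 b3 = (flux a1 b1 a2 m a3 b3 + flux a1 b1 m b2 a3 b3)%C.
Proof.
  intros H1 Hm H3 C1 C3. unfold flux.
  rewrite (I2_chasles_1 a2 b2 a3 b3 ltac:(lra) H3 (fun y z => V1 (b1, y, z)) m Hm)
    by (intros ? ? ? ?; apply (continuous3_face1 V1); apply C1; auto).
  rewrite (I2_chasles_1 a2 b2 a3 b3 ltac:(lra) H3 (fun y z => V1 (a1, y, z)) m Hm)
    by (intros ? ? ? ?; apply (continuous3_face1 V1); apply C1; auto).
  rewrite (I2_chasles_2 (fun x y => V3 (x, y, b3)) a1 b1 a2 b2 m H1 Hm)
    by (intros ? ? ? ?; apply (continuous3_face3 V3); apply C3; auto).
  rewrite (I2_chasles_2 (fun x y => V3 (x, y, a3)) a1 b1 a2 b2 m H1 Hm)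
    by (intros ? ? ? ?; apply (continuous3_face3 V3); apply C3; auto).
  ring.
Qed.

Lemma flux_split_3 a1 b1 a2 b2 a3 m b3 :
  a1 <= b1 -> a2 <= b2 -> a3 <= m <= b3 ->
  (forall y z, a2 <= y <= b2 -> a3 <= z <= b3 -> continuous3 V1 a1 y z /\ continuous3 V1 b1 y z) ->
  (forall x z, a1 <= x <= b1 -> a3 <= z <= b3 -> continuous3 V2 x a2 z /\ continuous3 V2 x b2 z) ->
  flux a1 b1 a2 b2 a3 b3 = (flux a1 b1 a2 b2 a3 m + flux a1 b1 a2 b2 m b3)%C.
Proof.
  intros H1 H2 Hm C1 C2. unfold flux.
  rewrite (I2_chasles_2 (fun y z => V1 (b1, y, z)) a2 b2 a3 b3 m H2 Hm)
    by (intros ? ? ? ?; apply (continuous3_face1 V1); apply C1; auto).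
  rewrite (I2_chasles_2 (fun y z => V1 (a1, y, z)) a2 b2 a3 b3 m H2 Hm)
    by (intros ? ? ? ?; apply (continuous3_face1 V1); apply C1; auto).
  rewrite (I2_chasles_2 (fun x z => V2 (x, b2, z)) a1 b1 a3 b3 m H1 Hm)
    by (intros ? ? ? ?; apply (continuous3_face2 V2); apply C2; auto).
  rewrite (I2_chasles_2 (fun x z => V2 (x, a2, z)) a1 b1 a3 b3 m H1 Hm)
    by (intros ? ? ? ?; apply (continuous3_face2 V2); apply C2; auto).
  ring.
Qed.

(** Across opposite faces the i-th component changes by the side length times [Li], up to [eps * r].
    Multiplied by the areas of the faces, the linear parts add up to the volume times
    [L1 + L2 + L3], which is 0; only the errors remain. The box may be any box through the point,
    not a cube centred there. *)
Lemma flux_small p1 p2 p3 eps :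
  divergence_free p1 p2 p3 -> 0 < eps ->
  exists delta, 0 < delta /\ forall r a1 b1 a2 b2 a3 b3,
    0 < r < delta ->
    a1 <= p1 <= b1 -> a2 <= p2 <= b2 -> a3 <= p3 <= b3 ->
    b1 - a1 <= r -> b2 - a2 <= r -> b3 - a3 <= r ->
    (forall x y z, a1 <= x <= b1 -> a2 <= y <= b2 -> a3 <= z <= b3 ->
       continuous3 V1 x y z /\ continuous3 V2 x y z /\ continuous3 V3 x y z) ->
    Cmod (flux a1 b1 a2 b2 a3 b3) <=
      eps * r * ((b2 - a2) * (b3 - a3) + (b1 - a1) * (b3 - a3) + (b1 - a1) * (b2 - a2)).
Proof.
  intros [L1 [L2 [L3 [HL H]]]] He. destruct (H eps He) as [delta [Hd H']].
  exists delta; split; [exact Hd|].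
  intros r a1 b1 a2 b2 a3 b3 Hr P1 P2 P3 D1 D2 D3 HC.
  specialize (H' r Hr).
  assert (HA : forall a b p x, a <= p <= b -> b - a <= r -> a <= x <= b -> Rabs (x - p) <= r).
  { intros a b p x Hp Hab Hx. apply Rabs_le. lra. }
  assert (E1 : Cmod (I2 (fun y z => V1 (b1, y, z) - V1 (a1, y, z))%C a2 b2 a3 b3
     - RtoC ((b2 - a2) * (b3 - a3)) * (RtoC (b1 - a1) * L1)) <= (b2 - a2) * (b3 - a3) * (eps * r)).
  { apply I2_norm_const; try lra.
    - intros y z Hy Hz. apply (continuous2_minus (fun s t => V1 (b1, s, t)) (fun s t => V1 (a1, s, t)));
        [apply (continuous3_face1 V1)|apply (continuous3_face1 V1)]; apply HC; auto; lra.
    - intros y z Hy Hz. apply (H' a1 y z b1); eauto; eapply HA; eauto; lra. }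
  assert (E2 : Cmod (I2 (fun x z => V2 (x, b2, z) - V2 (x, a2, z))%C a1 b1 a3 b3
     - RtoC ((b1 - a1) * (b3 - a3)) * (RtoC (b2 - a2) * L2)) <= (b1 - a1) * (b3 - a3) * (eps * r)).
  { apply I2_norm_const; try lra.
    - intros y z Hy Hz. apply (continuous2_minus (fun s t => V2 (s, b2, t)) (fun s t => V2 (s, a2, t)));
        [apply (continuous3_face2 V2)|apply (continuous3_face2 V2)]; apply HC; auto; lra.
    - intros y z Hy Hz. apply (H' y a2 z b2); eauto; eapply HA; eauto; lra. }
  assert (E3 : Cmod (I2 (fun x y => V3 (x, y, b3) - V3 (x, y, a3))%C a1 b1 a2 b2
     - RtoC ((b1 - a1) * (b2 - a2)) * (RtoC (b3 - a3) * L3)) <= (b1 - a1) * (b2 - a2) * (eps * r)).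
  { apply I2_norm_const; try lra.
    - intros y z Hy Hz. apply (continuous2_minus (fun s t => V3 (s, t, b3)) (fun s t => V3 (s, t, a3)));
        [apply (continuous3_face3 V3)|apply (continuous3_face3 V3)]; apply HC; auto; lra.
    - intros y z Hy Hz. apply (H' y z a3 b3); eauto; eapply HA; eauto; lra. }
  rewrite I2_minus in E1; try lra;
    try (intros y z Hy Hz; apply continuous3_face1; apply HC; auto; lra).
  rewrite I2_minus in E2; try lra;
    try (intros y z Hy Hz; apply continuous3_face2; apply HC; auto; lra).
  rewrite I2_minus in E3; try lra;
    try (intros y z Hy Hz; apply continuous3_face3; apply HC; auto; lra).
  match type of E1 with Cmod ?X <= _ => match type of E2 with Cmod ?Y <= _ =>
    match type of E3 with Cmod ?Z <= _ =>
    replace (flux a1 b1 a2 b2 a3 b3) with (X + Y + Z)%C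
  end end end.
  2: { unfold flux. rewrite !RtoC_mult.
       match goal with |- ?lhs = ?rhs =>
         transitivity (rhs - RtoC (b1 - a1) * RtoC (b2 - a2) * RtoC (b3 - a3) * (L1 + L2 + L3))%C end.
       - ring.
       - rewrite HL. ring. }
  Ctriangle.
  match goal with |- Cmod (?X + ?Y) + _ <= _ => pose proof (Cmod_triangle X Y) end. lra.
Qed.

Lemma nested_intervals (u d : nat -> R) :
  (forall n, 0 <= d n) -> (forall n, u n <= u (S n)) ->
  (forall n, u (S n) + d (S n) <= u n + d n) ->
  exists p, forall n, u n <= p <= u n + d n.
Proof.
  intros Hd Hu Hv.
  assert (Hu' : forall n k, u n <= u (k + n)%nat).
  { intros n k; induction k; simpl; [lra|]. specialize (Hu (k + n)%nat). lra. }
  assert (Hv' : forall n k, u (k + n)%nat + d (k + n)%nat <= u n + d n).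
  { intros n k; induction k; simpl; [lra|]. specialize (Hv (k + n)%nat). lra. }
  assert (Hb : forall n m, u m <= u n + d n).
  { intros n m. destruct (Nat.le_gt_cases n m) as [Hl|Hl].
    - specialize (Hv' n (m - n)%nat). replace (m - n + n)%nat with m in Hv' by lia.
      specialize (Hd m). lra.
    - specialize (Hu' m (n - m)%nat). replace (n - m + m)%nat with n in Hu' by lia.
      specialize (Hd n). lra. }
  destruct (completeness (fun x => exists n, x = u n)) as [p [Hp1 Hp2]].
  - exists (u O + d O). intros x [n ->]. apply Hb.
  - exists (u O), O; reflexivity.
  - exists p. intros n. split.
    + apply Hp1. now exists n.
    + apply Hp2. intros x [m ->]. apply Hb.
Qed.

Lemma half_pow_small delta : 0 < delta -> exists n, (/ 2) ^ n < delta.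
Proof.
  intros Hd. destruct (pow_lt_1_zero (/ 2)) with (y := delta) as [n Hn]; auto.
  - rewrite Rabs_pos_eq; lra.
  - exists n. specialize (Hn n (Nat.le_refl n)). rewrite Rabs_pos_eq in Hn; auto.
    apply pow_le; lra.
Qed.

Lemma Cmod_half (X Y Z : C) c : X = (Y + Z)%C -> c <= Cmod X -> c / 2 <= Cmod Y \/ c / 2 <= Cmod Z.
Proof.
  intros -> H. pose proof (Cmod_triangle Y Z).
  destruct (Rle_lt_dec (c / 2) (Cmod Y)); [now left|right; lra].
Qed.

(* Goursat's bisection argument in dimension three. *)
Lemma flux_regular a1 b1 a2 b2 a3 b3 :
  a1 <= b1 -> a2 <= b2 -> a3 <= b3 ->
  (forall x y z, a1 <= x <= b1 -> a2 <= y <= b2 -> a3 <= z <= b3 -> regular x y z) ->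
  flux a1 b1 a2 b2 a3 b3 = 0%C.
Proof.
  intros H1 H2 H3 HR. apply Cmod_eq_0. apply Rle_antisym; [|apply Cmod_ge_0].
  apply Rnot_lt_le. intros Hc. set (c := Cmod (flux a1 b1 a2 b2 a3 b3)) in Hc.
  set (s1 := b1 - a1). set (s2 := b2 - a2). set (s3 := b3 - a3).
  assert (S1 : 0 <= s1) by (unfold s1; lra).
  assert (S2 : 0 <= s2) by (unfold s2; lra).
  assert (S3 : 0 <= s3) by (unfold s3; lra).
  set (h := fun n => (/ 2) ^ n).
  assert (Hh : forall n, 0 < h n) by (intros n; apply pow_lt; lra).
  assert (HhS : forall n, h (S n) = h n / 2) by (intros n; unfold h; simpl; field).
  (* Halving in all three directions keeps the shape of the box, so the flux loses at most a factor
     8 per round, and [c * h n ^ 3] remains a lower bound. *)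
  set (P := fun n (p : R3) => let '(x, y, z) := p in
     a1 <= x /\ x + s1 * h n <= b1 /\ a2 <= y /\ y + s2 * h n <= b2 /\ a3 <= z /\ z + s3 * h n <= b3 /\
     c * (h n * h n * h n) <= Cmod (flux x (x + s1 * h n) y (y + s2 * h n) z (z + s3 * h n))).
  (* The implication stands under the existential quantifier so that choice yields a successor
     defined at every point, without carrying a proof of [P n p]. *)
  assert (Hstep : forall n (p : R3), exists q : R3, P n p -> P (S n) q /\
     (let '(x, y, z) := p in let '(x', y', z') := q in
      x <= x' /\ x' + s1 * h (S n) <= x + s1 * h n /\
      y <= y' /\ y' + s2 * h (S n) <= y + s2 * h n /\
      z <= z' /\ z' + s3 * h (S n) <= z + s3 * h n)).
  { intros n [[x y] z]. destruct (classic (P n (x, y, z))) as [HP|HP]; [|exists (x, y, z); tauto].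
    destruct HP as [X1 [X2 [Y1 [Y2 [Z1 [Z2 HF]]]]]].
    specialize (Hh n).
    assert (K1 : 0 <= s1 * h n) by (apply Rmult_le_pos; lra).
    assert (K2 : 0 <= s2 * h n) by (apply Rmult_le_pos; lra).
    assert (K3 : 0 <= s3 * h n) by (apply Rmult_le_pos; lra).
    assert (T1 : exists x', (x' = x \/ x' = x + s1 * h (S n)) /\
      c * (h n * h n * h n) / 2 <= Cmod (flux x' (x' + s1 * h (S n)) y (y + s2 * h n) z (z + s3 * h n))).
    { destruct (Cmod_half _ _ _ _ (flux_split_1 x (x + s1 * h (S n)) (x + s1 * h n) y (y + s2 * h n) z (z + s3 * h n)
        ltac:(rewrite HhS; lra) ltac:(lra) ltac:(lra)
        ltac:(intros; split; apply HR; lra) ltac:(intros; split; apply HR; lra)) HF) as [HH|HH].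
      - exists x. split; [now left|exact HH].
      - exists (x + s1 * h (S n)). split; [now right|].
        replace (x + s1 * h (S n) + s1 * h (S n)) with (x + s1 * h n) by (rewrite HhS; field). exact HH. }
    destruct T1 as [x' [Hx' HF1]].
    assert (B1 : x <= x' /\ x' + s1 * h (S n) <= x + s1 * h n).
    { rewrite HhS in *. destruct Hx' as [-> | ->]; lra. }
    assert (K1' : 0 <= s1 * h (S n)) by (rewrite HhS; lra).
    assert (T2 : exists y', (y' = y \/ y' = y + s2 * h (S n)) /\
      c * (h n * h n * h n) / 2 / 2 <= Cmod (flux x' (x' + s1 * h (S n)) y' (y' + s2 * h (S n)) z (z + s3 * h n))).
    { destruct (Cmod_half _ _ _ _ (flux_split_2 x' (x' + s1 * h (S n)) y (y + s2 * h (S n)) (y + s2 * h n) z (z + s3 * h n)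
        ltac:(lra) ltac:(rewrite HhS; lra) ltac:(lra)
        ltac:(intros; split; apply HR; lra) ltac:(intros; split; apply HR; lra)) HF1) as [HH|HH].
      - exists y. split; [now left|exact HH].
      - exists (y + s2 * h (S n)). split; [now right|].
        replace (y + s2 * h (S n) + s2 * h (S n)) with (y + s2 * h n) by (rewrite HhS; field). exact HH. }
    destruct T2 as [y' [Hy' HF2]].
    assert (B2 : y <= y' /\ y' + s2 * h (S n) <= y + s2 * h n).
    { rewrite HhS in *. destruct Hy' as [-> | ->]; lra. }
    assert (K2' : 0 <= s2 * h (S n)) by (rewrite HhS; lra).
    assert (T3 : exists z', (z' = z \/ z' = z + s3 * h (S n)) /\
      c * (h n * h n * h n) / 2 / 2 / 2 <= Cmod (flux x' (x' + s1 * h (S n)) y' (y' + s2 * h (S n)) z' (z' + s3 * h (S n)))).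
    { destruct (Cmod_half _ _ _ _ (flux_split_3 x' (x' + s1 * h (S n)) y' (y' + s2 * h (S n)) z (z + s3 * h (S n)) (z + s3 * h n)
        ltac:(lra) ltac:(lra) ltac:(rewrite HhS; lra)
        ltac:(intros; split; apply HR; lra) ltac:(intros; split; apply HR; lra)) HF2) as [HH|HH].
      - exists z. split; [now left|exact HH].
      - exists (z + s3 * h (S n)). split; [now right|].
        replace (z + s3 * h (S n) + s3 * h (S n)) with (z + s3 * h n) by (rewrite HhS; field). exact HH. }
    destruct T3 as [z' [Hz' HF3]].
    assert (B3 : z <= z' /\ z' + s3 * h (S n) <= z + s3 * h n).
    { rewrite HhS in *. destruct Hz' as [-> | ->]; lra. }
    exists (x', y', z'). intros _. split; [|tauto].
    unfold P. repeat split; try lra.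
    eapply Rle_trans; [|exact HF3]. rewrite HhS. right; field. }
  set (next := fun n p => proj1_sig (constructive_indefinite_description _ (Hstep n p))).
  set (sq := fun n => nat_rect (fun _ => R3) (a1, a2, a3) next n).
  assert (HP : forall n, P n (sq n)).
  { induction n as [|n IH].
    - simpl. unfold h, s1, s2, s3; simpl. repeat split; try lra.
      replace (a1 + (b1 - a1) * 1) with b1 by ring. replace (a2 + (b2 - a2) * 1) with b2 by ring.
      replace (a3 + (b3 - a3) * 1) with b3 by ring. fold c. lra.
    - simpl. apply (proj2_sig (constructive_indefinite_description _ (Hstep n (sq n))) IH). }
  assert (HN : forall n, let '(x, y, z) := sq n in let '(x', y', z') := sq (S n) in
      x <= x' /\ x' + s1 * h (S n) <= x + s1 * h n /\
      y <= y' /\ y' + s2 * h (S n) <= y + s2 * h n /\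
      z <= z' /\ z' + s3 * h (S n) <= z + s3 * h n).
  { intros n. exact (proj2 (proj2_sig (constructive_indefinite_description _ (Hstep n (sq n))) (HP n))). }
  destruct (nested_intervals (fun n => fst (fst (sq n))) (fun n => s1 * h n)) as [p1 Q1];
    try solve [intros n; specialize (HN n); destruct (sq n) as [[x y] z], (sq (S n)) as [[x' y'] z']; apply HN].
  { intros n; apply Rmult_le_pos; [exact S1|apply Rlt_le, Hh]. }
  destruct (nested_intervals (fun n => snd (fst (sq n))) (fun n => s2 * h n)) as [p2 Q2];
    try solve [intros n; specialize (HN n); destruct (sq n) as [[x y] z], (sq (S n)) as [[x' y'] z']; apply HN].
  { intros n; apply Rmult_le_pos; [exact S2|apply Rlt_le, Hh]. }
  destruct (nested_intervals (fun n => snd (sq n)) (fun n => s3 * h n)) as [p3 Q3];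
    try solve [intros n; specialize (HN n); destruct (sq n) as [[x y] z], (sq (S n)) as [[x' y'] z']; apply HN].
  { intros n; apply Rmult_le_pos; [exact S3|apply Rlt_le, Hh]. }
  (* [K * h n] bounds every side of the n-th box and [A * h n ^ 2] is the area factor in
     [flux_small]. With the [eps] below, the upper bound becomes [c * (A / (A + 1)) * h n ^ 3],
     strictly less than the lower bound. The summands 1 cover degenerate boxes. *)
  set (K := s1 + s2 + s3 + 1).
  set (A := s2 * s3 + s1 * s3 + s1 * s2).
  assert (HA : 0 <= A) by (unfold A; nra).
  assert (HK : 0 < K) by (unfold K; lra).
  assert (HKA : 0 < K * (A + 1)) by (apply Rmult_lt_0_compat; lra).
  set (eps := c / (K * (A + 1))).
  assert (He : 0 < eps) by (apply Rdiv_lt_0_compat; lra).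
  destruct (flux_small p1 p2 p3 eps) as [delta [Hd HS]]; auto.
  { pose proof (HP O) as H0. specialize (Q1 O); specialize (Q2 O); specialize (Q3 O).
    destruct (sq O) as [[x y] z]. simpl in H0, Q1, Q2, Q3. apply HR; lra. }
  destruct (half_pow_small (delta / K)) as [n Hn]; [apply Rdiv_lt_0_compat; lra|].
  fold (h n) in Hn. specialize (HP n). specialize (Q1 n); specialize (Q2 n); specialize (Q3 n).
  destruct (sq n) as [[x y] z]. simpl in Q1, Q2, Q3.
  destruct HP as [X1 [X2 [Y1 [Y2 [Z1 [Z2 HF]]]]]]. specialize (Hh n).
  assert (J1 : s1 * h n <= K * h n) by (apply Rmult_le_compat_r; unfold K; lra).
  assert (J2 : s2 * h n <= K * h n) by (apply Rmult_le_compat_r; unfold K; lra).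
  assert (J3 : s3 * h n <= K * h n) by (apply Rmult_le_compat_r; unfold K; lra).
  assert (HF' : Cmod (flux x (x + s1 * h n) y (y + s2 * h n) z (z + s3 * h n)) <=
     eps * (K * h n) * ((s2 * h n) * (s3 * h n) + (s1 * h n) * (s3 * h n) + (s1 * h n) * (s2 * h n))).
  { eapply Rle_trans; [apply (HS (K * h n))|]; try lra.
    - split; [apply Rmult_lt_0_compat; lra|].
      apply (Rmult_lt_compat_l K) in Hn; [|lra]. replace (K * (delta / K)) with delta in Hn by (field; lra). lra.
    - intros x' y' z' Hx Hy Hz. destruct (HR x' y' z') as [R1 [R2 [R3 _]]]; try lra. tauto. }
  assert (Hc2 : c * (h n * h n * h n) <= c * (A / (A + 1)) * (h n * h n * h n)).
  { eapply Rle_trans; [exact HF|]. eapply Rle_trans; [exact HF'|]. right.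
    replace (s2 * h n * (s3 * h n) + s1 * h n * (s3 * h n) + s1 * h n * (s2 * h n))
      with (A * (h n * h n)) by (unfold A; ring).
    unfold eps. field. lra. }
  assert (Hh3 : 0 < h n * h n * h n) by (repeat apply Rmult_lt_0_compat; lra).
  apply Rmult_le_reg_r in Hc2; [|exact Hh3].
  assert (A / (A + 1) < 1).
  { apply (Rmult_lt_reg_r (A + 1)); [lra|]. replace (A / (A + 1) * (A + 1)) with A by (field; lra). lra. }
  nra.
Qed.

(* The difference of the two boxes is a union of six slabs. *)
Lemma flux_shell a1 a1' b1' b1 a2 a2' b2' b2 a3 a3' b3' b3 :
  a1 <= a1' -> a1' <= b1' -> b1' <= b1 ->
  a2 <= a2' -> a2' <= b2' -> b2' <= b2 ->
  a3 <= a3' -> a3' <= b3' -> b3' <= b3 ->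
  (forall x y z, a1 <= x <= b1 -> a2 <= y <= b2 -> a3 <= z <= b3 ->
     ~ (a1' < x < b1' /\ a2' < y < b2' /\ a3' < z < b3') -> regular x y z) ->
  flux a1 b1 a2 b2 a3 b3 = flux a1' b1' a2' b2' a3' b3'.
Proof.
  intros X1 X2 X3 Y1 Y2 Y3 Z1 Z2 Z3 HR.
  rewrite (flux_split_1 a1 a1' b1), (flux_split_1 a1' b1' b1), (flux_regular a1 a1'), (flux_regular b1' b1),
    (flux_split_2 a1' b1' a2 a2' b2), (flux_split_2 a1' b1' a2' b2' b2),
    (flux_regular a1' b1' a2 a2'), (flux_regular a1' b1' b2' b2),
    (flux_split_3 a1' b1' a2' b2' a3 a3' b3), (flux_split_3 a1' b1' a2' b2' a3' b3' b3),
    (flux_regular a1' b1' a2' b2' a3 a3'), (flux_regular a1' b1' a2' b2' b3' b3);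
    try lra; try (intros; split; apply HR; lra); try (intros; apply HR; lra).
  ring.
Qed.

End Flux.

(** * Entire functions that are constant on the real line *)

Lemma continuous_Cinv {T : UniformSpace} (f : T -> C) p :
  Ccontinuous f p -> f p <> 0%C -> Ccontinuous (fun x => / f x)%C p.
Proof.
  intros Hf H0.
  assert (Hn : fst (f p) ^ 2 + snd (f p) ^ 2 <> 0).
  { intros E. apply H0. apply injective_projections; simpl;
    pose proof (pow2_ge_0 (fst (f p))); pose proof (pow2_ge_0 (snd (f p))); nra. }
  assert (Hc : continuous (fun x => / (fst (f x) ^ 2 + snd (f x) ^ 2)) p).
  { apply (continuous_comp (fun x : T => fst (f x) ^ 2 + snd (f x) ^ 2) Rinv); [|exact (continuous_Rinv _ Hn)].
    apply (continuous_ext (fun x : T => plus (mult (fst (f x)) (fst (f x))) (mult (snd (f x)) (snd (f x))))).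
    { intros x. unfold plus, mult; simpl. ring. }
    apply (continuous_plus (fun x : T => mult (fst (f x)) (fst (f x))) (fun x => mult (snd (f x)) (snd (f x)))).
    - apply (continuous_mult (fun x => fst (f x)) (fun x => fst (f x))); now apply continuous_C_fst.
    - apply (continuous_mult (fun x => snd (f x)) (fun x => snd (f x))); now apply continuous_C_snd. }
  apply continuous_C_pair.
  - apply (continuous_mult (fun x => fst (f x)) (fun x => / (fst (f x) ^ 2 + snd (f x) ^ 2)));
      [now apply continuous_C_fst|exact Hc].
  - apply (continuous_mult (fun x => - snd (f x)) (fun x => / (fst (f x) ^ 2 + snd (f x) ^ 2)));
      [apply (continuous_opp (fun x => snd (f x))); now apply continuous_C_snd|exact Hc].
Qed.

(** * Complex differentiability in one variable *)

Lemma Ccontinuous_iff (f : C -> C) w :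
  CCcontinuous f w <->
  forall eps, 0 < eps -> exists r, 0 < r /\ forall x, Cmod (x - w) < r -> Cmod (f x - f w) < eps.
Proof.
  rewrite continuous_C_iff. split; intros H eps He.
  - destruct (H eps He) as [r Hr]. exists r. split; [apply cond_pos|].
    intros x Hx. apply Hr. now apply Cmod_ball_C.
  - destruct (H eps He) as [r [Hr H']]. assert (Hr2 : 0 < r / 2) by lra.
    exists (mkposreal _ Hr2). intros x Hx. apply H'. apply ball_C_Cmod in Hx. simpl in Hx. lra.
Qed.

(** Caratheodory's form of differentiability: the rules for products, inverses and compositions
    reduce to the continuity of an explicit slope function [phi], whose value at [w] is the
    derivative. *)
Definition Cdiff (f : C -> C) (w : C) : Prop :=
  exists phi : C -> C, CCcontinuous phi w /\
    forall x, (f x - f w = phi x * (x - w))%C.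

Lemma Cdiff_of_eps f w (l : C) :
  (forall eps, 0 < eps -> exists r, 0 < r /\ forall x, Cmod (x - w) < r ->
     Cmod (f x - f w - l * (x - w)) <= eps * Cmod (x - w)) -> Cdiff f w.
Proof.
  intros H.
  exists (fun x => if excluded_middle_informative (x = w) then l else ((f x - f w) / (x - w))%C).
  split.
  - apply Ccontinuous_iff. intros eps He. assert (He2 : 0 < eps / 2) by lra.
    destruct (H _ He2) as [r [Hr H']].
    exists r; split; [exact Hr|]. intros x Hx.
    destruct (excluded_middle_informative (w = w)) as [_|n]; [|now destruct n].
    destruct (excluded_middle_informative (x = w)) as [_|n].
    + replace (l - l)%C with (RtoC 0) by ring. rewrite Cmod_0. exact He.
    + assert (Hn : (x - w <> 0)%C).
      { intros E. apply n. replace x with ((x - w) + w)%C by ring. rewrite E. ring. }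
      replace ((f x - f w) / (x - w) - l)%C with ((f x - f w - l * (x - w)) / (x - w))%C by (field; exact Hn).
      rewrite Cmod_div by exact Hn. specialize (H' x Hx).
      assert (Hp : 0 < Cmod (x - w)) by now apply Cmod_gt_0.
      apply Rle_lt_trans with (eps / 2); [|lra].
      apply (Rmult_le_reg_r (Cmod (x - w))); [exact Hp|].
      replace (Cmod (f x - f w - l * (x - w)) / Cmod (x - w) * Cmod (x - w))
        with (Cmod (f x - f w - l * (x - w))) by (field; lra). exact H'.
  - intros x. destruct (excluded_middle_informative (x = w)) as [->|n]; [ring|].
    field. intros E. apply n. replace x with ((x - w) + w)%C by ring. rewrite E. ring.
Qed.

Lemma Cdiff_eps f w :
  Cdiff f w -> exists l,
  (forall eps, 0 < eps -> exists r, 0 < r /\ forall x, Cmod (x - w) < r ->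
     Cmod (f x - f w - l * (x - w)) <= eps * Cmod (x - w)).
Proof.
  intros [phi [Hc Hp]]. exists (phi w). intros eps He.
  destruct (proj1 (Ccontinuous_iff phi w) Hc eps He) as [r [Hr H]].
  exists r; split; [exact Hr|]. intros x Hx. rewrite Hp.
  replace (phi x * (x - w) - phi w * (x - w))%C with ((phi x - phi w) * (x - w))%C by ring.
  rewrite Cmod_mult. apply Rmult_le_compat_r; [apply Cmod_ge_0|]. apply Rlt_le, H, Hx.
Qed.

Lemma Cdiff_continuous f w : Cdiff f w -> CCcontinuous f w.
Proof.
  intros [phi [Hc Hp]].
  apply (continuous_ext (fun x => phi x * (x - w) + f w)%C).
  - intros x. rewrite <- Hp. Cring.
  - apply (continuous_Cplus (T := C_UniformSpace)); [|apply continuous_const].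
    apply (continuous_Cmult (T := C_UniformSpace)); [exact Hc|].
    apply (continuous_Cminus (T := C_UniformSpace)); [apply continuous_id|apply continuous_const].
Qed.

Lemma Cdiff_local f g w r :
  0 < r -> (forall x, Cmod (x - w) < r -> f x = g x) -> Cdiff f w -> Cdiff g w.
Proof.
  intros Hr Heq Hf. destruct (Cdiff_eps f w Hf) as [l Hl].
  apply (Cdiff_of_eps g w l). intros eps He. destruct (Hl eps He) as [r' [Hr' H]].
  exists (Rmin r r'). split; [now apply Rmin_glb_lt|]. intros x Hx.
  rewrite <- !Heq.
  - apply H. eapply Rlt_le_trans; [exact Hx|apply Rmin_r].
  - replace (w - w)%C with (RtoC 0) by ring. now rewrite Cmod_0.
  - eapply Rlt_le_trans; [exact Hx|apply Rmin_l].
Qed.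

Lemma Cdiff_const k w : Cdiff (fun _ => k) w.
Proof. exists (fun _ => RtoC 0). split; [apply continuous_const|intros; ring]. Qed.

Lemma Cdiff_id w : Cdiff (fun x => x) w.
Proof. exists (fun _ => RtoC 1). split; [apply continuous_const|intros; ring]. Qed.

Lemma Cdiff_plus f g w :
  Cdiff f w -> Cdiff g w -> Cdiff (fun x => f x + g x)%C w.
Proof.
  intros [phi [Hc Hp]] [psi [Hd Hq]]. exists (fun x => phi x + psi x)%C. split.
  - now apply (continuous_Cplus (T := C_UniformSpace)).
  - intros x. replace (f x + g x - (f w + g w))%C with ((f x - f w) + (g x - g w))%C by ring.
    rewrite Hp, Hq. ring.
Qed.

Lemma Cdiff_mult f g w :
  Cdiff f w -> Cdiff g w -> Cdiff (fun x => f x * g x)%C w.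
Proof.
  intros Hf Hg. pose proof (Cdiff_continuous g w Hg) as Hgc.
  destruct Hf as [phi [Hc Hp]], Hg as [psi [Hd Hq]].
  exists (fun x => phi x * g x + f w * psi x)%C. split.
  - apply (continuous_Cplus (T := C_UniformSpace)); apply (continuous_Cmult (T := C_UniformSpace)); auto.
    apply continuous_const.
  - intros x. replace (f x * g x - f w * g w)%C with ((f x - f w) * g x + f w * (g x - g w))%C by ring.
    rewrite Hp, Hq. ring.
Qed.

(** The slope identity is required at every [x], so [f] has to be nonzero everywhere and not merely
    near [w]. Users first change the denominator away from the point by means of [Cdiff_local]. *)
Lemma Cdiff_inv f w :
  Cdiff f w -> (forall x, f x <> 0%C) -> Cdiff (fun x => / f x)%C w.
Proof.
  intros Hf H0. pose proof (Cdiff_continuous f w Hf) as Hfc.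
  destruct Hf as [phi [Hc Hp]].
  exists (fun x => - phi x * / (f x * f w))%C. split.
  - apply (continuous_Cmult (T := C_UniformSpace)).
    + now apply (continuous_Copp (T := C_UniformSpace)).
    + apply (continuous_Cinv (T := C_UniformSpace)).
      * apply (continuous_Cmult (T := C_UniformSpace)); [exact Hfc|apply continuous_const].
      * now apply Cmult_neq_0.
  - intros x. replace (/ f x - / f w)%C with (- (f x - f w) * / (f x * f w))%C by (field; auto).
    rewrite Hp. ring.
Qed.

Lemma Cdiff_comp f g w :
  Cdiff f (g w) -> Cdiff g w -> Cdiff (fun x => f (g x)) w.
Proof.
  intros Hf Hg. pose proof (Cdiff_continuous g w Hg) as Hgc.
  destruct Hf as [phi [Hc Hp]], Hg as [psi [Hd Hq]].
  exists (fun x => phi (g x) * psi x)%C. split.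
  - apply (continuous_Cmult (T := C_UniformSpace)); [|exact Hd].
    now apply (continuous_comp (U := C_UniformSpace) (V := C_UniformSpace) g phi).
  - intros x. rewrite Hp, Hq. ring.
Qed.

Lemma Cdiff_pow f n w : Cdiff f w -> Cdiff (fun x => pow_n (K := C_Ring) (f x) n) w.
Proof.
  intros Hf. induction n as [|n IH]; simpl.
  - apply Cdiff_const.
  - now apply (Cdiff_mult f (fun x => pow_n (K := C_Ring) (f x) n)).
Qed.

(** * The complex exponential *)

Definition Cexp (z : C) : C := (exp (fst z) * cos (snd z), exp (fst z) * sin (snd z)).

Lemma Cexp_plus z w : Cexp (z + w) = (Cexp z * Cexp w)%C.
Proof.
  unfold Cexp. apply injective_projections; simpl;
  rewrite exp_plus; [rewrite cos_plus|rewrite sin_plus]; ring.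
Qed.

Lemma Cmod_Cexp z : Cmod (Cexp z) = exp (fst z).
Proof.
  unfold Cmod, Cexp; simpl fst; simpl snd.
  replace ((exp (fst z) * cos (snd z)) ^ 2 + (exp (fst z) * sin (snd z)) ^ 2)
    with (exp (fst z) * exp (fst z) * (Rsqr (sin (snd z)) + Rsqr (cos (snd z)))) by (unfold Rsqr; ring).
  rewrite sin2_cos2, Rmult_1_r. apply sqrt_square. apply Rlt_le, exp_pos.
Qed.

Lemma Cexp_neq_0 z : Cexp z <> 0%C.
Proof. apply Cmod_gt_0. rewrite Cmod_Cexp. apply exp_pos. Qed.

Lemma derivable_0_bound f l : derivable_pt_lim f 0 l -> forall eps, 0 < eps ->
  exists r, 0 < r /\ forall h, Rabs h < r -> Rabs (f h - f 0 - l * h) <= eps * Rabs h.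
Proof.
  intros H eps He. destruct (H eps He) as [r Hr]. exists r. split; [apply cond_pos|].
  intros h Hh. destruct (Req_dec h 0) as [->|Hn].
  - rewrite Rmult_0_r, !Rminus_diag, Rabs_R0. lra.
  - specialize (Hr h Hn Hh). rewrite Rplus_0_l in Hr.
    replace (f h - f 0 - l * h) with (((f h - f 0) / h - l) * h) by (field; exact Hn).
    rewrite Rabs_mult. apply Rmult_le_compat_r; [apply Rabs_pos|lra].
Qed.

Lemma Cdiff_Cexp_0 : Cdiff Cexp 0.
Proof.
  apply (Cdiff_of_eps _ _ 1%C). intros eps He.
  (* The real part of the remainder will cost [3 * (e * m)] and the imaginary part [5 * (e * m)],
     hence the 8. *)
  set (e := Rmin 1 (eps / 8)).
  assert (He1 : 0 < e) by (apply Rmin_glb_lt; lra).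
  assert (He2 : e <= 1) by apply Rmin_l.
  assert (He3 : e <= eps / 8) by apply Rmin_r.
  destruct (derivable_0_bound exp 1 derivable_pt_lim_exp_0 e He1) as [r1 [R1 H1]].
  destruct (derivable_0_bound sin 1 derivable_pt_lim_sin_0 e He1) as [r2 [R2 H2]].
  destruct (derivable_0_bound cos 0 derivable_pt_lim_cos_0 e He1) as [r3 [R3 H3]].
  set (r := Rmin (Rmin r1 r2) (Rmin r3 e)).
  assert (Hr : r <= r1 /\ r <= r2 /\ r <= r3 /\ r <= e).
  { unfold r, Rmin. repeat destruct (Rle_dec _ _); lra. }
  destruct Hr as [Hr1 [Hr2 [Hr3 Hr4]]].
  exists r. split.
  { unfold r. apply Rmin_glb_lt; apply Rmin_glb_lt; assumption. }
  intros [a b] Hx. replace ((a, b) - 0)%C with ((a, b) : C) in * by (apply injective_projections; simpl; ring).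
  pose proof (Rabs_fst_Cmod (a, b)) as Ha. pose proof (Rabs_snd_Cmod (a, b)) as Hb. simpl in Ha, Hb.
  specialize (H1 a ltac:(lra)). specialize (H2 b ltac:(lra)). specialize (H3 b ltac:(lra)).
  rewrite exp_0 in H1. rewrite sin_0 in H2. rewrite cos_0 in H3.
  set (m := Cmod (a, b)) in *.
  assert (Hm : 0 <= m) by apply Cmod_ge_0.
  eapply Rle_trans; [apply Cmod_le_add|]. unfold Cexp; simpl. rewrite exp_0, cos_0, sin_0.
  replace (exp a * cos b + - (1 * 1) + - (1 * a - 0 * b))
    with (cos b * (exp a - 1 - 1 * a) + (1 + a) * (cos b - 1 - 0 * b)) by ring.
  replace (exp a * sin b + - (1 * 0) + - (1 * b + 0 * a))
    with ((exp a - 1 - 1 * a) * sin b + a * sin b + (sin b - 0 - 1 * b)) by ring.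
  assert (Hc : Rabs (cos b) <= 1) by (apply Rabs_le, COS_bound).
  assert (Hs : Rabs (sin b) <= 2 * m).
  { replace (sin b) with ((sin b - 0 - 1 * b) + b) by ring.
    eapply Rle_trans; [apply Rabs_triang|]. pose proof (Rabs_pos b). nra. }
  assert (Ea : e * Rabs a <= e * m) by (apply Rmult_le_compat_l; lra).
  assert (Eb : e * Rabs b <= e * m) by (apply Rmult_le_compat_l; lra).
  assert (T1 : Rabs (cos b * (exp a - 1 - 1 * a) + (1 + a) * (cos b - 1 - 0 * b)) <= 3 * (e * m)).
  { eapply Rle_trans; [apply Rabs_triang|]. rewrite !Rabs_mult.
    assert (Rabs (1 + a) <= 2).
    { eapply Rle_trans; [apply Rabs_triang|]. rewrite Rabs_R1. lra. }
    pose proof (Rabs_pos (cos b)). pose proof (Rabs_pos (exp a - 1 - 1 * a)).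
    pose proof (Rabs_pos (1 + a)). pose proof (Rabs_pos (cos b - 1 - 0 * b)).
    assert (Rabs (cos b) * Rabs (exp a - 1 - 1 * a) <= 1 * (e * m)) by (apply Rmult_le_compat; lra).
    assert (Rabs (1 + a) * Rabs (cos b - 1 - 0 * b) <= 2 * (e * m)) by (apply Rmult_le_compat; lra).
    lra. }
  assert (T2 : Rabs ((exp a - 1 - 1 * a) * sin b + a * sin b + (sin b - 0 - 1 * b)) <= 5 * (e * m)).
  { eapply Rle_trans; [apply Rabs_triang|].
    eapply Rle_trans; [apply Rplus_le_compat_r, Rabs_triang|]. rewrite !Rabs_mult.
    pose proof (Rabs_pos (sin b)). pose proof (Rabs_pos (exp a - 1 - 1 * a)). pose proof (Rabs_pos a).
    assert (Rabs (exp a - 1 - 1 * a) * Rabs (sin b) <= (e * m) * 1).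
    { apply Rmult_le_compat; try lra. apply Rabs_le, SIN_bound. }
    assert (Rabs a * Rabs (sin b) <= e * (2 * m)) by (apply Rmult_le_compat; lra).
    lra. }
  assert (e * m <= eps / 8 * m) by (apply Rmult_le_compat_r; lra). lra.
Qed.

Lemma Cdiff_Cexp w : Cdiff Cexp w.
Proof.
  apply (Cdiff_local (fun x => Cexp w * Cexp (x + - w))%C Cexp w 1 Rlt_0_1).
  - intros x _. rewrite <- Cexp_plus. f_equal. ring.
  - apply Cdiff_mult; [apply Cdiff_const|].
    apply (Cdiff_comp Cexp (fun x => x + - w)%C).
    + replace (w + - w)%C with (RtoC 0) by ring. apply Cdiff_Cexp_0.
    + apply Cdiff_plus; [apply Cdiff_id|apply Cdiff_const].
Qed.

(** * Cauchy's theorem on rectangles and the mean value bound *)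

Section MeanValue.
Variable Phi : C -> C.
Hypothesis HPhi : forall w, Cdiff Phi w.

(** The field (i Phi, - Phi, 0), constant in the third direction. Its divergence i Phi_x - Phi_y
    vanishes by the Cauchy-Riemann equations, and its flux through a box of height 1 is the contour
    integral of Phi around the base rectangle. *)
Let V1 (p : R3) : C := (Ci * Phi (fst (fst p), snd (fst p)))%C.
Let V2 (p : R3) : C := (- Phi (fst (fst p), snd (fst p)))%C.
Let V3 (p : R3) : C := 0%C.

Lemma planar_continuous x y z : continuous3 (fun p => Phi (fst (fst p), snd (fst p))) x y z.
Proof.
  apply continuous3_iff. intros eps He.
  destruct (proj1 (Ccontinuous_iff Phi (x, y)) (Cdiff_continuous _ _ (HPhi (x, y))) eps He) as [r [Hr H]].
  exists (r / 2). split; [lra|]. intros x' y' z' Hx Hy _. apply H.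
  eapply Rle_lt_trans; [apply Cmod_le_add|]. simpl. unfold Rminus in *. lra.
Qed.

Lemma planar_regular x y z : regular V1 V2 V3 x y z.
Proof.
  repeat split.
  - apply (continuous3_mult (fun _ => Ci)); [apply continuous3_const|apply planar_continuous].
  - apply continuous3_opp, planar_continuous.
  - exact (continuous3_const 0%C x y z).
  - destruct (Cdiff_eps Phi (x, y) (HPhi (x, y))) as [l Hl].
    exists (Ci * l)%C, (- (Ci * l))%C, 0%C. split; [ring|].
    intros eps He. assert (He4 : 0 < eps / 4) by lra. destruct (Hl _ He4) as [d [Hd H]].
    exists (d / 2). split; [lra|]. intros r Hr.
    assert (K : forall s t, Rabs (s - x) <= r -> Rabs (t - y) <= r ->
       Cmod (Phi (s, t) - Phi (x, y) - l * ((s, t) - (x, y))) <= eps / 2 * r).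
    { intros s t Hs Ht.
      assert (Hst : Cmod ((s, t) - (x, y)) <= 2 * r).
      { eapply Rle_trans; [apply Cmod_le_add|]. simpl. unfold Rminus in *. lra. }
      eapply Rle_trans; [apply H; lra|].
      apply Rle_trans with (eps / 4 * (2 * r)); [apply Rmult_le_compat_l; lra|lra]. }
    intros x' y' z' t Hx Hy Hz. split; [|split].
    + intros Ht. unfold V1; simpl.
      match goal with |- Cmod ?X <= _ =>
        replace X with (Ci * ((Phi (t, y') - Phi (x, y) - l * ((t, y') - (x, y)))
          - (Phi (x', y') - Phi (x, y) - l * ((x', y') - (x, y)))))%C end.
      2: { replace ((t, y') - (x, y))%C with (((x', y') - (x, y)) + RtoC (t - x'))%C.
           - ring.
           - apply injective_projections; simpl; ring. }
      rewrite Cmod_mult, Cmod_Ci, Rmult_1_l.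
      Ctriangle. rewrite Cmod_opp.
      pose proof (K t y' Ht Hy). pose proof (K x' y' Hx Hy). lra.
    + intros Ht. unfold V2; simpl.
      match goal with |- Cmod ?X <= _ =>
        replace X with (- ((Phi (x', t) - Phi (x, y) - l * ((x', t) - (x, y)))
          - (Phi (x', y') - Phi (x, y) - l * ((x', y') - (x, y)))))%C end.
      2: { replace ((x', t) - (x, y))%C with (((x', y') - (x, y)) + Ci * RtoC (t - y'))%C.
           - ring.
           - apply injective_projections; simpl; ring. }
      rewrite Cmod_opp.
      Ctriangle. rewrite Cmod_opp.
      pose proof (K x' t Hx Ht). pose proof (K x' y' Hx Hy). lra.
    + intros _. unfold V3.
      replace (0 - 0 - RtoC (t - z') * 0)%C with (RtoC 0) by ring. rewrite Cmod_0.
      apply Rmult_le_pos; lra.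
Qed.

(** In the contour integral over [a, b] x [0, 2 pi] the two horizontal sides cancel by periodicity,
    so the integral over a vertical segment does not depend on its abscissa. For functions of
    [Cexp w] these segments are circles. *)
Lemma periodic_integral a b :
  a <= b -> (forall x, Phi (x, 2 * PI) = Phi (x, 0)) ->
  I2 (fun y _ => Ci * Phi (b, y))%C 0 (2 * PI) 0 1 = I2 (fun y _ => Ci * Phi (a, y))%C 0 (2 * PI) 0 1.
Proof.
  intros Hab Hper. pose proof PI_RGT_0 as HPI.
  pose proof (flux_regular V1 V2 V3 a b 0 (2 * PI) 0 1 Hab ltac:(lra) ltac:(lra)
    (fun x y z _ _ _ => planar_regular x y z)) as E.
  unfold flux in E.
  rewrite (I2_ext a b 0 1 Hab ltac:(lra) (fun x z => V2 (x, 2 * PI, z)) (fun x z => V2 (x, 0, z))) in E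
    by (intros; unfold V2; simpl; now rewrite Hper).
  change (fun y z => V1 (b, y, z)) with (fun y (_ : R) => Ci * Phi (b, y))%C in E.
  change (fun y z => V1 (a, y, z)) with (fun y (_ : R) => Ci * Phi (a, y))%C in E.
  change (fun x y => V3 (x, y, 1)) with (fun x y => V3 (x, y, 0)) in E.
  match type of E with (?X - ?Y + _ + _)%C = _ => replace X with (X - Y + Y)%C by ring;
    match type of E with ?L = _ => replace (X - Y)%C with L by ring end end.
  rewrite E. ring.
Qed.

Lemma planar_face_continuous b : continuous2_on (fun y _ => Ci * Phi (b, y))%C 0 (2 * PI) 0 1.
Proof. intros y z _ _. apply (continuous3_face1 V1). apply planar_regular. Qed.

End MeanValue.

(** The mean of [G] over the circle of radius [exp b] about [P] equals its mean over an arbitrarily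
    small circle, where [G] is close to [G P]. *)
Lemma mean_value_bound (G : C -> C) (P : C) (b M : R) :
  (forall w, Cdiff G w) ->
  (forall y, 0 <= y <= 2 * PI -> Cmod (G (P + Cexp (b, y)))%C <= M) ->
  Cmod (G P) <= M.
Proof.
  intros HG HM. pose proof PI_RGT_0 as HPI.
  set (Phi := fun w => G (P + Cexp w)%C).
  assert (HPhi : forall w, Cdiff Phi w).
  { intros w. apply (Cdiff_comp G (fun w => P + Cexp w)%C); [apply HG|].
    apply Cdiff_plus; [apply Cdiff_const|apply Cdiff_Cexp]. }
  assert (Hper : forall x, Phi (x, 2 * PI) = Phi (x, 0)).
  { intros x. unfold Phi. do 2 f_equal. unfold Cexp; simpl.
    now rewrite sin_2PI, cos_2PI, sin_0, cos_0. }
  apply Rnot_lt_le. intros Hlt.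
  set (eps := Cmod (G P) - M). assert (He : 0 < eps) by (unfold eps; lra).
  destruct (proj1 (Ccontinuous_iff G P) (Cdiff_continuous _ _ (HG P)) eps He) as [r [Hr H]].
  (* Far enough to the left for the circle of radius [exp a] to lie in the disc on which [G] is
     within [eps] of [G P]; [a <= b] is required by the rectangle. *)
  set (a := Rmin b (ln (r / 2))).
  assert (Hexp : exp a < r).
  { apply Rle_lt_trans with (exp (ln (r / 2))).
    - destruct (Rle_lt_or_eq_dec a (ln (r / 2)) (Rmin_r _ _)) as [Hl| ->]; [|lra].
      apply Rlt_le, exp_increasing, Hl.
    - rewrite exp_ln; lra. }
  pose proof (periodic_integral Phi HPhi a b (Rmin_l _ _) Hper) as E.
  assert (E1 : Cmod (I2 (fun y _ => Ci * Phi (b, y))%C 0 (2 * PI) 0 1) <= (2 * PI - 0) * (1 - 0) * M).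
  { apply I2_norm; try lra; [now apply planar_face_continuous|].
    intros y z Hy _. rewrite Cmod_mult, Cmod_Ci, Rmult_1_l. now apply HM. }
  (* Compactness of the circle improves the pointwise strict bound by [eps] to the uniform bound
     [eps - d]. This gap [d] is what contradicts [eps = Cmod (G P) - M] at the end. *)
  destruct (rectangle_compact (fun d y _ => Cmod (Ci * Phi (a, y) - Ci * G P) <= eps - d)
     0 (2 * PI) 0 0) as [d [Hd Hd']].
  { intros d d' y _ Hdd Hy. lra. }
  { intros y z Hy Hz.
    assert (Hlt' : Cmod (Ci * Phi (a, y) - Ci * G P) < eps).
    { replace (Ci * Phi (a, y) - Ci * G P)%C with (Ci * (Phi (a, y) - G P))%C by ring.
      rewrite Cmod_mult, Cmod_Ci, Rmult_1_l. apply H.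
      replace (P + Cexp (a, y) - P)%C with (Cexp (a, y)) by ring. now rewrite Cmod_Cexp. }
    set (g := eps - Cmod (Ci * Phi (a, y) - Ci * G P)).
    assert (Hg : 0 < g / 2) by (unfold g; lra).
    assert (Hc : CCcontinuous (fun w => Ci * Phi w)%C (a, y)).
    { apply (continuous_Cmult (T := C_UniformSpace)); [apply continuous_const|].
      now apply Cdiff_continuous. }
    destruct (proj1 (Ccontinuous_iff _ _) Hc _ Hg) as [d [Hd Hd']].
    exists (Rmin d (g / 2)). split; [now apply Rmin_glb_lt|].
    intros y' _ Hy' _.
    assert (Cmod (Ci * Phi (a, y') - Ci * Phi (a, y)) < g / 2).
    { apply Hd'. eapply Rle_lt_trans; [apply Cmod_le_add|]. simpl.
      rewrite Rplus_opp_r, Rabs_R0, Rplus_0_l. eapply Rlt_le_trans; [exact Hy'|apply Rmin_l]. }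
    replace (Ci * Phi (a, y') - Ci * G P)%C with
      ((Ci * Phi (a, y') - Ci * Phi (a, y)) + (Ci * Phi (a, y) - Ci * G P))%C by ring.
    Ctriangle.
    pose proof (Rmin_r d (g / 2)). unfold g in *. lra. }
  assert (E2 : Cmod (I2 (fun y _ => Ci * Phi (a, y))%C 0 (2 * PI) 0 1
     - RtoC ((2 * PI - 0) * (1 - 0)) * (Ci * G P)) <= (2 * PI - 0) * (1 - 0) * (eps - d)).
  { apply I2_norm_const; try lra; [now apply planar_face_continuous|].
    intros y z Hy _. apply (Hd' y 0); lra. }
  rewrite <- E in E2.
  set (I := I2 _ _ _ _ _) in E1, E2.
  assert (E3 : Cmod (RtoC ((2 * PI - 0) * (1 - 0)) * (Ci * G P)) = (2 * PI - 0) * (1 - 0) * Cmod (G P)).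
  { rewrite !Cmod_mult, Cmod_Ci, Cmod_R, Rabs_pos_eq by lra. ring. }
  assert (E4 : Cmod (RtoC ((2 * PI - 0) * (1 - 0)) * (Ci * G P)) <=
     Cmod I + Cmod (I - RtoC ((2 * PI - 0) * (1 - 0)) * (Ci * G P))).
  { match goal with |- Cmod ?X <= _ => replace X with (I + - (I - X))%C at 1 by ring end.
    Ctriangle. rewrite Cmod_opp. lra. }
  rewrite E3 in E4. unfold eps in *. nra.
Qed.

(** * Uniqueness of analytic continuation *)

Lemma Cmod_pow_n (z : C) n : Cmod (pow_n (K := C_Ring) z n) = Cmod z ^ n.
Proof.
  induction n as [|n IH]; simpl.
  - apply Cmod_1.
  - unfold mult; simpl. now rewrite Cmod_mult, IH.
Qed.

(* Dividing by powers of [w - p0] is harmless for a function vanishing near [p0],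
   and the mean value bound on a large circle then forces it to vanish. *)
Lemma entire_vanishing (k : C -> C) (p0 : C) (r : R) :
  0 < r -> (forall w, Cdiff k w) -> (forall w, Cmod (w - p0) < r -> k w = 0%C) ->
  forall P, k P = 0%C.
Proof.
  intros Hr Hk H0 P. destruct (classic (P = p0)) as [->|HP].
  { apply H0. replace (p0 - p0)%C with (RtoC 0) by ring. now rewrite Cmod_0. }
  set (d := Cmod (P - p0)).
  assert (Hd : 0 < d).
  { apply Cmod_gt_0. intros E. apply HP. replace P with ((P - p0) + p0)%C by ring. rewrite E. ring. }
  (* The circle of radius [3 * d] about [P] stays at distance at least [2 * d] from [p0], whereas
     [P] is at distance [d]; each power of [w - p0] thus gains a factor 1/2. *)
  set (b := ln (3 * d)).
  assert (Hb : exp b = 3 * d) by (apply exp_ln; lra).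
  (* The radius delivered by compactness doubles as the inverse of a bound for [k] on the circle. *)
  destruct (rectangle_compact (fun s y _ => Cmod (k (P + Cexp (b, y))%C) <= / s) 0 (2 * PI) 0 0) as [s [Hs HM]].
  { intros s s' y _ Hss H. eapply Rle_trans; [exact H|]. apply Rinv_le_contravar; lra. }
  { intros y z0 _ _.
    set (f := fun w => k (P + Cexp w)%C).
    assert (Hf : Cdiff f (b, y)).
    { apply (Cdiff_comp k (fun w => P + Cexp w)%C); [apply Hk|].
      apply Cdiff_plus; [apply Cdiff_const|apply Cdiff_Cexp]. }
    destruct (proj1 (Ccontinuous_iff _ _) (Cdiff_continuous _ _ Hf) 1 Rlt_0_1) as [e [He H]].
    set (m := Cmod (f (b, y))). assert (Hm : 0 <= m) by apply Cmod_ge_0.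
    exists (Rmin e (/ (m + 1))). split.
    { apply Rmin_glb_lt; [exact He|apply Rinv_0_lt_compat; lra]. }
    intros y' _ Hy' _.
    assert (Hlt : Cmod (f (b, y') - f (b, y)) < 1).
    { apply H. eapply Rle_lt_trans; [apply Cmod_le_add|]. simpl.
      rewrite Rplus_opp_r, Rabs_R0, Rplus_0_l. eapply Rlt_le_trans; [exact Hy'|apply Rmin_l]. }
    apply Rle_trans with (m + 1).
    - fold (f (b, y')). replace (f (b, y')) with ((f (b, y') - f (b, y)) + f (b, y))%C by ring.
      Ctriangle. fold m. lra.
    - rewrite <- (Rinv_inv (m + 1)) at 1. apply Rinv_le_contravar; [|apply Rmin_r].
      apply Rmin_glb_lt; [exact He|apply Rinv_0_lt_compat; lra]. }
  set (M := / s) in HM. assert (HMp : 0 < M) by now apply Rinv_0_lt_compat.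
  assert (Hn : forall n, Cmod (k P) <= M * (/ 2) ^ n).
  { intros n.
    (* A nowhere vanishing substitute for [w - p0], as [Cdiff_inv] demands; it is altered only
       inside the disc where [k] is 0. The quotient [G] itself is locally 0 there, including at
       [p0]. *)
    set (g := fun w => if Rlt_dec (Cmod (w - p0)) (r / 2) then RtoC (r / 2) else (w - p0)%C).
    set (G := fun w => (k w * / pow_n (K := C_Ring) (w - p0) n)%C).
    assert (HG : forall w, Cdiff G w).
    { intros w. destruct (Rlt_le_dec (Cmod (w - p0)) r) as [Hl|Hl].
      - apply (Cdiff_local (fun _ => 0%C) G w (r - Cmod (w - p0))); [lra| |apply Cdiff_const].
        intros x Hx. unfold G. rewrite H0; [ring|].
        replace (x - p0)%C with ((x - w) + (w - p0))%C by ring.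
        eapply Rle_lt_trans; [apply Cmod_triangle|]. lra.
      - assert (Hgeq : forall x, Cmod (x - w) < r / 2 -> g x = (x - p0)%C).
        { intros x Hx. unfold g. destruct (Rlt_dec (Cmod (x - p0)) (r / 2)) as [Hl'|_]; [|reflexivity].
          exfalso. assert (Cmod (w - p0) < r); [|lra].
          replace (w - p0)%C with (- (x - w) + (x - p0))%C by ring.
          eapply Rle_lt_trans; [apply Cmod_triangle|]. rewrite Cmod_opp. lra. }
        apply (Cdiff_local (fun w => k w * / pow_n (K := C_Ring) (g w) n)%C G w (r / 2)); [lra| |].
        { intros x Hx. unfold G. now rewrite Hgeq. }
        apply Cdiff_mult; [apply Hk|].
        apply Cdiff_inv.
        + apply Cdiff_pow.
          apply (Cdiff_local (fun x => x + - p0)%C g w (r / 2)); [lra| |].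
          * intros x Hx. now rewrite Hgeq.
          * apply Cdiff_plus; [apply Cdiff_id|apply Cdiff_const].
        + intros x. apply Cmod_gt_0. rewrite Cmod_pow_n. apply pow_lt.
          unfold g. destruct (Rlt_dec (Cmod (x - p0)) (r / 2)) as [_|Hl']; [|lra].
          rewrite Cmod_R, Rabs_pos_eq; lra. }
    assert (HGP : Cmod (G P) <= M * / (2 * d) ^ n).
    { apply (mean_value_bound G P b); [exact HG|].
      intros y Hy. unfold G. rewrite Cmod_mult.
      assert (Hge : 2 * d <= Cmod (P + Cexp (b, y) - p0)).
      { assert (Ht : Cmod (Cexp (b, y)) <= Cmod (P + Cexp (b, y) - p0) + d).
        { replace (Cexp (b, y)) with ((P + Cexp (b, y) - p0) + - (P - p0))%C at 1 by ring.
          Ctriangle. rewrite Cmod_opp. unfold d. lra. }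
        rewrite Cmod_Cexp in Ht. simpl in Ht. lra. }
      assert (Hpn : 0 < Cmod (pow_n (K := C_Ring) (P + Cexp (b, y) - p0)%C n)).
      { rewrite Cmod_pow_n. apply pow_lt. lra. }
      apply Rmult_le_compat; try apply Cmod_ge_0.
      - apply (HM y 0); lra.
      - rewrite Cmod_inv by (apply Cmod_gt_0; exact Hpn).
        apply Rinv_le_contravar; [apply pow_lt; lra|].
        rewrite Cmod_pow_n. apply pow_incr. lra. }
    assert (Hpn : 0 < Cmod (pow_n (K := C_Ring) (P - p0)%C n)) by (rewrite Cmod_pow_n; now apply pow_lt).
    unfold G in HGP. rewrite Cmod_mult, Cmod_inv in HGP by (apply Cmod_gt_0; exact Hpn).
    rewrite Cmod_pow_n in HGP. fold d in HGP.
    assert (Hdn : 0 < d ^ n) by now apply pow_lt.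
    assert (H2n : 0 < 2 ^ n) by (apply pow_lt; lra).
    rewrite Rpow_mult_distr in HGP.
    apply (Rmult_le_compat_r (d ^ n)) in HGP; [|lra].
    rewrite pow_inv.
    replace (Cmod (k P) * / d ^ n * d ^ n) with (Cmod (k P)) in HGP by (field; lra).
    replace (M * / (2 ^ n * d ^ n) * d ^ n) with (M * / 2 ^ n) in HGP by (field; lra).
    exact HGP. }
  apply Cmod_eq_0. apply Rle_antisym; [|apply Cmod_ge_0].
  apply Rnot_lt_le. intros Hpos.
  destruct (half_pow_small (Cmod (k P) / M)) as [n Hn']; [now apply Rdiv_lt_0_compat|].
  specialize (Hn n). apply (Rmult_lt_compat_l M) in Hn'; [|exact HMp].
  replace (M * (Cmod (k P) / M)) with (Cmod (k P)) in Hn' by (field; lra). lra.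
Qed.

(* A function constant on the real line can be continued by the same constant
   below the line without losing differentiability. *)
Lemma entire_constant (h : C -> C) (k : C) :
  (forall w, Cdiff h w) -> (forall t : R, h (RtoC t) = k) ->
  forall w, 0 <= snd w -> h w = k.
Proof.
  intros Hh Hk w Hw.
  set (g := fun w => if Rle_dec 0 (snd w) then (h w - k)%C else 0%C).
  enough (E : g w = 0%C).
  { unfold g in E. destruct (Rle_dec 0 (snd w)) as [_|n]; [|lra].
    replace (h w) with ((h w - k) + k)%C by ring. rewrite E. ring. }
  (* The disc of radius 1 about -2i lies below the real axis, where [g] is 0 by definition. *)
  apply (entire_vanishing g (0, -2) 1 Rlt_0_1).
  - intros z. destruct (Rtotal_order (snd z) 0) as [Hz|[Hz|Hz]].
    + apply (Cdiff_local (fun _ => 0%C) g z (- snd z)); [lra| |apply Cdiff_const].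
      intros x Hx. unfold g. destruct (Rle_dec 0 (snd x)) as [Hx'|_]; [|reflexivity].
      exfalso. pose proof (Rabs_snd_Cmod (x - z)) as Ha. simpl in Ha.
      rewrite Rabs_pos_eq in Ha; lra.
    + assert (Hz' : z = RtoC (fst z)) by (apply injective_projections; simpl; auto).
      assert (Hgz : g z = 0%C).
      { unfold g. destruct (Rle_dec 0 (snd z)); [|reflexivity]. rewrite Hz', Hk. ring. }
      assert (Hhz : h z = k) by (rewrite Hz'; apply Hk).
      destruct (Cdiff_eps h z (Hh z)) as [l Hl].
      (* Real increments do not change [h], so its complex derivative vanishes on the real line and
         agrees there with that of the constant below. *)
      assert (Hl0 : l = 0%C).
      { apply Cmod_eq_0. apply Rle_antisym; [|apply Cmod_ge_0]. apply le_epsilon.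
        intros eps He. destruct (Hl eps He) as [r [Hr H]].
        specialize (H (z + RtoC (r / 2))%C).
        replace (z + RtoC (r / 2) - z)%C with (RtoC (r / 2)) in H by ring.
        rewrite Cmod_R, Rabs_pos_eq in H by lra. specialize (H ltac:(lra)).
        rewrite Hhz in H. replace (h (z + RtoC (r / 2))%C) with k in H.
        2: { rewrite Hz', <- RtoC_plus. now rewrite Hk. }
        replace (k - k - l * RtoC (r / 2))%C with (- (l * RtoC (r / 2)))%C in H by ring.
        rewrite Cmod_opp, Cmod_mult, Cmod_R, Rabs_pos_eq in H by lra.
        apply Rmult_le_reg_r in H; lra. }
      subst l. apply (Cdiff_of_eps g z 0%C). intros eps He.
      destruct (Hl eps He) as [r [Hr H]]. exists r; split; [exact Hr|].
      intros x Hx. rewrite Hgz. unfold g. destruct (Rle_dec 0 (snd x)) as [Hx'|_].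
      * specialize (H x Hx). rewrite Hhz in H.
        replace (h x - k - 0 - 0 * (x - z))%C with (h x - k - 0 * (x - z))%C by ring. exact H.
      * replace (0 - 0 - 0 * (x - z))%C with (RtoC 0) by ring. rewrite Cmod_0.
        apply Rmult_le_pos; [lra|apply Cmod_ge_0].
    + apply (Cdiff_local (fun x => h x + - k)%C g z (snd z)); [lra| |].
      * intros x Hx. unfold g. destruct (Rle_dec 0 (snd x)) as [_|n]; [reflexivity|].
        exfalso. pose proof (Rabs_snd_Cmod (x - z)) as Ha. simpl in Ha.
        rewrite Rabs_left in Ha; lra.
      * apply Cdiff_plus; [apply Hh|apply Cdiff_const].
  - intros x Hx. unfold g. destruct (Rle_dec 0 (snd x)) as [Hx'|_]; [|reflexivity].
    exfalso. pose proof (Rabs_snd_Cmod (x - (0, -2))%C) as Ha. simpl in Ha.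
    rewrite Rabs_pos_eq in Ha; lra.
Qed.

Lemma no_holomorphic_inverse_abs (f : C -> C) :
  (forall w : C, w <> 0%C -> Cdiff f w) ->
  (forall t : R, t <> 0 -> f (RtoC t) = RtoC (/ Rabs t)) -> False.
Proof.
  intros Hf Ht.
  set (h := fun w => (Cexp w * f (Cexp w))%C).
  assert (Hh : forall w, Cdiff h w).
  { intros w. apply Cdiff_mult; [apply Cdiff_Cexp|].
    apply Cdiff_comp; [apply Hf, Cexp_neq_0|apply Cdiff_Cexp]. }
  assert (E : h (0, PI) = 1%C).
  { apply (entire_constant h 1%C Hh).
    - intros t. unfold h. replace (Cexp (RtoC t)) with (RtoC (exp t)).
      + pose proof (exp_pos t). rewrite Ht, <- RtoC_mult by lra. f_equal.
        rewrite Rabs_pos_eq by lra. field. lra.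
      + unfold Cexp; simpl. rewrite cos_0, sin_0. apply injective_projections; simpl; ring.
    - simpl. apply Rlt_le, PI_RGT_0. }
  unfold h in E. replace (Cexp (0, PI)) with (RtoC (-1)) in E.
  - rewrite Ht in E by lra. rewrite <- RtoC_mult in E. apply RtoC_inj in E.
    rewrite Rabs_left in E by lra. replace (- -1) with 1 in E by ring. rewrite Rinv_1 in E. lra.
  - unfold Cexp; simpl. rewrite exp_0, cos_PI, sin_PI. apply injective_projections; simpl; ring.
Qed.

(** * The complexified Newtonian kernel *)

Definition add3 (w h : C3) : C3 :=
  let '(w1, w2, w3) := w in let '(h1, h2, h3) := h in (w1 + h1, w2 + h2, w3 + h3)%C.
Definition sub3 (w h : C3) : C3 :=
  let '(w1, w2, w3) := w in let '(h1, h2, h3) := h in (w1 - h1, w2 - h2, w3 - h3)%C.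
Definition norm3 (h : C3) : R := let '(h1, h2, h3) := h in Cmod h1 + Cmod h2 + Cmod h3.
Definition coord (i : axis) (w : C3) : C :=
  let '(w1, w2, w3) := w in match i with axis1 => w1 | axis2 => w2 | axis3 => w3 end.
Definition pairing (g : axis -> C) (h : C3) : C :=
  (g axis1 * coord axis1 h + g axis2 * coord axis2 h + g axis3 * coord axis3 h)%C.
Definition quad (w : C3) : C :=
  (coord axis1 w * coord axis1 w + coord axis2 w * coord axis2 w + coord axis3 w * coord axis3 w)%C.

Lemma norm3_ge_0 h : 0 <= norm3 h.
Proof. destruct h as [[h1 h2] h3]; simpl.
  pose proof (Cmod_ge_0 h1); pose proof (Cmod_ge_0 h2); pose proof (Cmod_ge_0 h3); lra. Qed.

Lemma norm3_triangle w h : norm3 (add3 w h) <= norm3 w + norm3 h.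
Proof. destruct w as [[w1 w2] w3], h as [[h1 h2] h3]; simpl.
  pose proof (Cmod_triangle w1 h1); pose proof (Cmod_triangle w2 h2); pose proof (Cmod_triangle w3 h3); lra. Qed.

Lemma Cmod_coord i h : Cmod (coord i h) <= norm3 h.
Proof. destruct h as [[h1 h2] h3]; simpl.
  pose proof (Cmod_ge_0 h1); pose proof (Cmod_ge_0 h2); pose proof (Cmod_ge_0 h3); destruct i; lra. Qed.

Lemma add3_sub3 w h z : sub3 (add3 w h) z = add3 (sub3 w z) h.
Proof. destruct w as [[w1 w2] w3], h as [[h1 h2] h3], z as [[z1 z2] z3]; simpl. f_equal; [f_equal|]; ring. Qed.

Lemma coord_add3 i w h : coord i (add3 w h) = (coord i w + coord i h)%C.
Proof. destruct w as [[w1 w2] w3], h as [[h1 h2] h3], i; reflexivity. Qed.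

Lemma Cmod_pairing g h B :
  (forall i, Cmod (g i) <= B) -> Cmod (pairing g h) <= B * norm3 h.
Proof.
  intros Hg. unfold pairing. destruct h as [[h1 h2] h3]; simpl.
  Ctriangle.
  eapply Rle_trans; [apply Rplus_le_compat_r, Cmod_triangle|].
  rewrite !Cmod_mult.
  assert (K : forall i z, Cmod (g i) * Cmod z <= B * Cmod z).
  { intros i z. apply Rmult_le_compat_r; [apply Cmod_ge_0|apply Hg]. }
  pose proof (K axis1 h1); pose proof (K axis2 h2); pose proof (K axis3 h3). lra.
Qed.

(** * Continuity and first-order expansions on C^3 *)

Definition continuousC3 (f : C3 -> C) (w : C3) : Prop :=
  continuous (T := C3_US) (U := C_UniformSpace) f w.

Lemma continuousC3_const k w : continuousC3 (fun _ => k) w.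
Proof. apply continuous_const. Qed.

Lemma continuousC3_plus f g w :
  continuousC3 f w -> continuousC3 g w -> continuousC3 (fun x => f x + g x)%C w.
Proof. apply (continuous_Cplus (T := C3_US) f g). Qed.

Lemma continuousC3_opp f w : continuousC3 f w -> continuousC3 (fun x => - f x)%C w.
Proof. apply (continuous_Copp (T := C3_US) f). Qed.

Lemma continuousC3_mult f g w :
  continuousC3 f w -> continuousC3 g w -> continuousC3 (fun x => f x * g x)%C w.
Proof. apply (continuous_Cmult (T := C3_US) f g). Qed.

Lemma continuousC3_inv f w :
  continuousC3 f w -> f w <> 0%C -> continuousC3 (fun x => / f x)%C w.
Proof. apply (continuous_Cinv (T := C3_US) f). Qed.

Lemma continuousC3_comp f (g : C -> C) w :
  continuousC3 f w -> CCcontinuous g (f w) -> continuousC3 (fun x => g (f x)) w.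
Proof. apply (continuous_comp (U := C3_US) (V := C_UniformSpace) (W := C_UniformSpace) f g). Qed.

Lemma continuousC3_ext f g w : (forall x, f x = g x) -> continuousC3 f w -> continuousC3 g w.
Proof. apply (continuous_ext (T := C3_US) (U := C_UniformSpace) f g). Qed.

Lemma continuousC3_iff (f : C3 -> C) w :
  continuousC3 f w <->
  forall eps, 0 < eps -> exists r, 0 < r /\ forall x, norm3 (sub3 x w) < r -> Cmod (f x - f w) < eps.
Proof.
  unfold continuousC3. rewrite continuous_C_iff. split; intros H eps He.
  - destruct (H eps He) as [r Hr]. exists r. split; [apply cond_pos|].
    intros x Hx. apply Hr. destruct w as [[w1 w2] w3], x as [[x1 x2] x3]. simpl in Hx.
    pose proof (Cmod_ge_0 (x1 - w1)); pose proof (Cmod_ge_0 (x2 - w2)); pose proof (Cmod_ge_0 (x3 - w3)).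
    repeat split; simpl; apply Cmod_ball_C; lra.
  - destruct (H eps He) as [r [Hr H']]. assert (Hr2 : 0 < r / 6) by lra.
    exists (mkposreal _ Hr2). intros x Hx. apply H'.
    destruct w as [[w1 w2] w3], x as [[x1 x2] x3]. destruct Hx as [[H1 H2] H3]. simpl in H1, H2, H3.
    apply ball_C_Cmod in H1, H2, H3. simpl. lra.
Qed.

Global Opaque continuousC3.

Lemma continuous_coord i w : continuousC3 (coord i) w.
Proof.
  apply continuousC3_iff. intros eps He. exists eps; split; [exact He|]. intros x Hx.
  eapply Rle_lt_trans; [|exact Hx]. destruct w as [[w1 w2] w3], x as [[x1 x2] x3]; simpl.
  pose proof (Cmod_ge_0 (x1 - w1)); pose proof (Cmod_ge_0 (x2 - w2)); pose proof (Cmod_ge_0 (x3 - w3)).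
  destruct i; lra.
Qed.

Lemma continuous_bounded (f : C3 -> C) w :
  continuousC3 f w ->
  exists r, 0 < r /\ exists B, 0 < B /\ forall x, norm3 (sub3 x w) < r -> Cmod (f x) <= B.
Proof.
  intros H. destruct (proj1 (continuousC3_iff f w) H 1 Rlt_0_1) as [r [Hr H']].
  exists r; split; [exact Hr|]. exists (Cmod (f w) + 1). pose proof (Cmod_ge_0 (f w)).
  split; [lra|]. intros x Hx. replace (f x) with ((f x - f w) + f w)%C by ring.
  Ctriangle. specialize (H' x Hx). lra.
Qed.

(* Uniformly differentiable near [w0] with gradient [g]; the single radius [r]
   also serves as the bound [/ r] of the quadratic remainder. *)
Definition C11 (f : C3 -> C) (g : axis -> C3 -> C) (w0 : C3) : Prop :=
  continuousC3 f w0 /\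
  (forall i, continuousC3 (g i) w0) /\
  exists r, 0 < r /\ forall w h, norm3 (sub3 w w0) < r -> norm3 h < r ->
    Cmod (f (add3 w h) - f w - pairing (fun i => g i w) h) <= / r * (norm3 h * norm3 h).

(** Merges a radius and an independently found remainder constant into the single radius of [C11],
    by shrinking the radius below [/ (Rabs M + 1)]. *)
Lemma C11_intro f g w0 r M :
  continuousC3 f w0 ->
  (forall i, continuousC3 (g i) w0) ->
  0 < r ->
  (forall w h, norm3 (sub3 w w0) < r -> norm3 h < r ->
    Cmod (f (add3 w h) - f w - pairing (fun i => g i w) h) <= M * (norm3 h * norm3 h)) ->
  C11 f g w0.
Proof.
  intros Hf Hg Hr H. split; [exact Hf|split; [exact Hg|]].
  set (M' := Rabs M + 1). assert (HM : 0 < M') by (unfold M'; pose proof (Rabs_pos M); lra).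
  exists (Rmin r (/ M')). split; [apply Rmin_glb_lt; [exact Hr|now apply Rinv_0_lt_compat]|].
  intros w h Hw Hh. eapply Rle_trans; [apply H|].
  - eapply Rlt_le_trans; [exact Hw|apply Rmin_l].
  - eapply Rlt_le_trans; [exact Hh|apply Rmin_l].
  - pose proof (norm3_ge_0 h). apply Rmult_le_compat_r; [now apply Rmult_le_pos|].
    apply Rle_trans with M'; [unfold M'; pose proof (Rle_abs M); lra|].
    rewrite <- (Rinv_inv M') at 1. apply Rinv_le_contravar; [|apply Rmin_r].
    apply Rmin_glb_lt; [exact Hr|now apply Rinv_0_lt_compat].
Qed.

Lemma C11_const k w0 : C11 (fun _ => k) (fun _ _ => 0%C) w0.
Proof.
  apply (C11_intro _ _ _ 1 0).
  - apply continuousC3_const.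
  - intros i; apply continuousC3_const.
  - lra.
  - intros w h _ _. unfold pairing.
    match goal with |- Cmod ?X <= _ => replace X with (RtoC 0) by ring end. rewrite Cmod_0. lra.
Qed.

Definition kronecker (i j : axis) : C :=
  match i, j with axis1, axis1 | axis2, axis2 | axis3, axis3 => RtoC 1 | _, _ => RtoC 0 end.

Lemma C11_coord i w0 : C11 (coord i) (fun j _ => kronecker i j) w0.
Proof.
  apply (C11_intro _ _ _ 1 0).
  - apply continuous_coord.
  - intros j; apply continuousC3_const.
  - lra.
  - intros w h _ _. unfold pairing. rewrite coord_add3.
    match goal with |- Cmod ?X <= _ => replace X with (RtoC 0) by (destruct i; simpl; ring) end.
    rewrite Cmod_0. lra.
Qed.

Lemma C11_ext f f' g g' w0 :
  (forall w, f w = f' w) -> (forall i w, g i w = g' i w) -> C11 f g w0 -> C11 f' g' w0.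
Proof.
  intros E0 E [Hf [Hg [r [Hr H]]]]. split; [|split].
  - now apply (continuousC3_ext f).
  - intros i. apply (continuousC3_ext (g i)); [apply E|apply Hg].
  - exists r; split; [exact Hr|]. intros w h Hw Hh. unfold pairing in *.
    rewrite <- !E0, <- !E. now apply H.
Qed.

Lemma C11_mult f g f' g' w0 :
  C11 f g w0 -> C11 f' g' w0 ->
  C11 (fun w => f w * f' w)%C (fun i w => f w * g' i w + g i w * f' w)%C w0.
Proof.
  intros [Hf [Hg [r [Hr H]]]] [Hf' [Hg' [r' [Hr' H']]]].
  destruct (continuous_bounded f w0 Hf) as [r0 [R0 [B0 [P0 Q0]]]].
  destruct (continuous_bounded f' w0 Hf') as [r1 [R1 [B1 [P1 Q1]]]].
  assert (Hgb : forall g : axis -> C3 -> C, (forall i, continuousC3 (g i) w0) ->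
    exists r, 0 < r /\ exists B, 0 < B /\ forall i x, norm3 (sub3 x w0) < r -> Cmod (g i x) <= B).
  { clear. intros g Hg.
    destruct (continuous_bounded _ w0 (Hg axis1)) as [r1 [R1 [B1 [P1 Q1]]]].
    destruct (continuous_bounded _ w0 (Hg axis2)) as [r2 [R2 [B2 [P2 Q2]]]].
    destruct (continuous_bounded _ w0 (Hg axis3)) as [r3 [R3 [B3 [P3 Q3]]]].
    exists (Rmin r1 (Rmin r2 r3)). split; [repeat apply Rmin_glb_lt; assumption|].
    exists (B1 + B2 + B3). split; [lra|]. intros i x Hx.
    pose proof (Rmin_l r1 (Rmin r2 r3)). pose proof (Rmin_r r1 (Rmin r2 r3)).
    pose proof (Rmin_l r2 r3). pose proof (Rmin_r r2 r3).
    destruct i; [specialize (Q1 x)|specialize (Q2 x)|specialize (Q3 x)]; lra. }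
  destruct (Hgb g Hg) as [r2 [R2 [B2 [P2 Q2]]]].
  destruct (Hgb g' Hg') as [r3 [R3 [B3 [P3 Q3]]]].
  set (rho := Rmin (Rmin (Rmin r r') (Rmin r0 r1)) (Rmin (Rmin r2 r3) 1)).
  assert (Hrho : rho <= r /\ rho <= r' /\ rho <= r0 /\ rho <= r1 /\ rho <= r2 /\ rho <= r3 /\ rho <= 1).
  { unfold rho, Rmin. repeat destruct (Rle_dec _ _); lra. }
  assert (Hrho0 : 0 < rho).
  { unfold rho. repeat apply Rmin_glb_lt; lra. }
  destruct Hrho as [U1 [U2 [U3 [U4 [U5 [U6 U7]]]]]]. clearbody rho.
  apply (C11_intro _ _ _ (rho / 2) (B2 * B3 + / r * B1 + (B0 + B2) * / r')).
  - now apply continuousC3_mult.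
  - intros i. apply continuousC3_plus; now apply continuousC3_mult.
  - lra.
  - intros w h Hw Hh.
    assert (Hwh : norm3 (sub3 (add3 w h) w0) < rho).
    { rewrite add3_sub3. eapply Rle_lt_trans; [apply norm3_triangle|]. lra. }
    specialize (H w h ltac:(lra) ltac:(lra)). specialize (H' w h ltac:(lra) ltac:(lra)).
    set (e := (f (add3 w h) - f w - pairing (fun i => g i w) h)%C) in *.
    set (e' := (f' (add3 w h) - f' w - pairing (fun i => g' i w) h)%C) in *.
    assert (Ha : Cmod (pairing (fun i => g i w) h) <= B2 * norm3 h).
    { apply Cmod_pairing. intros i. apply Q2. lra. }
    assert (Hb : Cmod (pairing (fun i => g' i w) h) <= B3 * norm3 h).
    { apply Cmod_pairing. intros i. apply Q3. lra. }
    set (a := pairing (fun i => g i w) h) in *. set (b := pairing (fun i => g' i w) h) in *.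
    (* With linear parts [a], [b] and remainders [e], [e'] this expansion of the product is exact;
       [a * b] is already of second order. *)
    match goal with |- Cmod ?X <= _ =>
      replace X with (a * b + e * f' (add3 w h) + (f w + a) * e')%C
        by (unfold e, e', a, b, pairing; ring) end.
    pose proof (norm3_ge_0 h) as Hn. set (n := norm3 h) in *.
    specialize (Q0 w ltac:(lra)). specialize (Q1 (add3 w h) ltac:(lra)).
    assert (Hfa : Cmod (f w + a) <= B0 + B2).
    { Ctriangle. nra. }
    Ctriangle.
    eapply Rle_trans; [apply Rplus_le_compat_r, Cmod_triangle|]. rewrite !Cmod_mult.
    assert (X1 : Cmod a * Cmod b <= (B2 * n) * (B3 * n)) by (apply Rmult_le_compat; auto using Cmod_ge_0).
    assert (X2 : Cmod e * Cmod (f' (add3 w h)) <= (/ r * (n * n)) * B1) by (apply Rmult_le_compat; auto using Cmod_ge_0).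
    assert (X3 : Cmod (f w + a) * Cmod e' <= (B0 + B2) * (/ r' * (n * n))) by (apply Rmult_le_compat; auto using Cmod_ge_0).
    lra.
Qed.

(** * The branch of the square root and its reciprocal *)

Section Kernel.
Variable s : R.
Hypothesis Hs : s * s = 1.

(** For [s] equal to 1 or -1 the right-hand side is never negative, and it vanishes exactly on the
    closed ray from 0 through - s i: the slit plane is given by one strict inequality between
    continuous functions. *)
Definition slit (q : C) : Prop := 0 < Cmod q + s * snd q.
Definition half_plane (c : C) : R := fst c + s * snd c.

Lemma Rabs_s : Rabs s = 1.
Proof.
  assert (E : Rabs s * Rabs s = 1) by (rewrite <- Rabs_mult, Hs; apply Rabs_R1).
  pose proof (Rabs_pos s). nra.
Qed.

Lemma half_plane_bound c : Rabs (half_plane c) <= 2 * Cmod c.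
Proof.
  unfold half_plane. eapply Rle_trans; [apply Rabs_triang|]. rewrite Rabs_mult, Rabs_s.
  pose proof (Rabs_fst_Cmod c); pose proof (Rabs_snd_Cmod c). lra.
Qed.

(** The identity behind the branch: [c * c] is off the slit exactly when [half_plane c] is nonzero.
    Hence squaring maps the open half plane where [half_plane] is positive, which contains the
    positive reals, bijectively onto the slit plane. *)
Lemma half_plane_sqr c : half_plane c * half_plane c = Cmod (c * c) + s * snd (c * c)%C.
Proof.
  rewrite Cmod_mult. unfold Cmod. rewrite sqrt_sqrt.
  2: { apply Rplus_le_le_0_compat; apply pow2_ge_0. }
  unfold half_plane. simpl.
  replace ((fst c + s * snd c) * (fst c + s * snd c)) with
    (fst c * fst c + (s * s) * (snd c * snd c) + s * (2 * fst c * snd c)) by ring.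
  rewrite Hs. ring.
Qed.

Lemma Csqrt_exists (q : C) : exists c : C, (c * c)%C = q.
Proof.
  destruct q as [a b].
  set (m := Cmod (a, b)).
  assert (Hm : m * m = a * a + b * b).
  { unfold m, Cmod; simpl. rewrite sqrt_sqrt; [ring|]. nra. }
  assert (Hm0 : 0 <= m) by apply Cmod_ge_0.
  assert (Ha : Rabs a <= m) by apply (Rabs_fst_Cmod (a, b)).
  assert (Ha' : - m <= a <= m).
  { split; [|apply Rle_trans with (Rabs a); [apply Rle_abs|exact Ha]].
    pose proof (Rabs_maj2 a). lra. }
  set (x := sqrt ((m + a) / 2)). set (y := sqrt ((m - a) / 2)).
  assert (Hx : x * x = (m + a) / 2) by (apply sqrt_sqrt; lra).
  assert (Hy : y * y = (m - a) / 2) by (apply sqrt_sqrt; lra).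
  assert (Hxy : x * y = Rabs b / 2).
  { unfold x, y. rewrite <- sqrt_mult by lra.
    replace ((m + a) / 2 * ((m - a) / 2)) with (Rsqr (b / 2)) by (unfold Rsqr; nra).
    rewrite sqrt_Rsqr_abs. unfold Rdiv. rewrite Rabs_mult, (Rabs_pos_eq (/ 2)) by lra. reflexivity. }
  destruct (Rle_dec 0 b) as [Hb|Hb].
  - exists (x, y). rewrite Rabs_pos_eq in Hxy by exact Hb.
    apply injective_projections; simpl; nra.
  - exists (x, - y). rewrite Rabs_left in Hxy by lra.
    apply injective_projections; simpl; nra.
Qed.

Lemma root_exists q : slit q -> exists c : C, (c * c)%C = q /\ 0 < half_plane c.
Proof.
  intros Hq. destruct (Csqrt_exists q) as [c Hc].
  pose proof (half_plane_sqr c) as E. rewrite Hc in E. unfold slit in Hq.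
  destruct (Rlt_le_dec 0 (half_plane c)) as [Hp|Hp].
  - now exists c.
  - exists (- c)%C. split; [rewrite <- Hc; ring|].
    assert (E' : half_plane (- c) = - half_plane c) by (unfold half_plane; simpl; ring).
    rewrite E'. nra.
Qed.

(** Off the slit exactly one of the two square roots has positive [half_plane], so the choice is
    determined; on the slit the value is arbitrary. *)
Definition root (q : C) : C :=
  epsilon (inhabits (RtoC 0)) (fun c => (c * c)%C = q /\ 0 < half_plane c).

Lemma root_spec q : slit q -> (root q * root q)%C = q /\ 0 < half_plane (root q).
Proof. intros Hq. apply (epsilon_spec (inhabits (RtoC 0)) _ (root_exists q Hq)). Qed.

Lemma slit_sqr c : 0 < half_plane c -> slit (c * c).
Proof. intros Hc. unfold slit. rewrite <- half_plane_sqr. nra. Qed.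

Lemma half_plane_plus c c' : half_plane (c + c') = half_plane c + half_plane c'.
Proof. unfold half_plane; simpl; ring. Qed.

Lemma half_plane_neq_0 c : 0 < half_plane c -> c <> 0%C.
Proof. intros H E. rewrite E in H. unfold half_plane in H; simpl in H. lra. Qed.

Lemma root_sqr c : 0 < half_plane c -> root (c * c) = c.
Proof.
  intros Hc. destruct (root_spec (c * c) (slit_sqr c Hc)) as [H1 H2].
  set (c' := root (c * c)) in *.
  assert (E : ((c' - c) * (c' + c) = 0)%C).
  { replace ((c' - c) * (c' + c))%C with (c' * c' - c * c)%C by ring. rewrite H1. ring. }
  assert (Hn : (c' + c <> 0)%C) by (apply half_plane_neq_0; rewrite half_plane_plus; lra).
  replace c' with ((c' - c) * (c' + c) / (c' + c) + c)%C by (field; exact Hn).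
  rewrite E. field; exact Hn.
Qed.

Lemma slit_open q : slit q -> exists r, 0 < r /\ forall q', Cmod (q' - q) < r -> slit q'.
Proof.
  unfold slit. intros Hq. exists ((Cmod q + s * snd q) / 2). split; [lra|]. intros q' Hq'.
  assert (H1 : Cmod q <= Cmod q' + Cmod (q' - q)).
  { replace q with (q' + - (q' - q))%C at 1 by ring. Ctriangle.
    rewrite Cmod_opp. lra. }
  assert (H2 : Rabs (s * (snd q' - snd q)) <= Cmod (q' - q)).
  { rewrite Rabs_mult, Rabs_s, Rmult_1_l. apply (Rabs_snd_Cmod (q' - q)%C). }
  pose proof (Rabs_maj2 (s * (snd q' - snd q))). lra.
Qed.

(** The difference of two roots is the difference of their squares divided by their sum, and the sum
    cannot be small: [half_plane] is additive and positive on both roots. *)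
Lemma root_continuous q : slit q -> CCcontinuous root q.
Proof.
  intros Hq. destruct (root_spec q Hq) as [E Hp]. destruct (slit_open q Hq) as [r [Hr Ho]].
  set (l := half_plane (root q)) in *.
  apply Ccontinuous_iff. intros eps He.
  assert (Hle : 0 < l / 2 * eps) by (apply Rmult_lt_0_compat; lra).
  exists (Rmin r (l / 2 * eps)). split; [now apply Rmin_glb_lt|].
  intros q' Hq'. destruct (root_spec q') as [E' Hp'].
  { apply Ho. eapply Rlt_le_trans; [exact Hq'|apply Rmin_l]. }
  assert (Hsum : l / 2 <= Cmod (root q' + root q)).
  { pose proof (half_plane_bound (root q' + root q)) as Hb. rewrite half_plane_plus in Hb.
    fold l in Hb. rewrite Rabs_pos_eq in Hb; lra. }
  assert (Heq : Cmod (q' - q) = Cmod (root q' - root q) * Cmod (root q' + root q)).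
  { rewrite <- Cmod_mult. f_equal. rewrite <- E at 1. rewrite <- E' at 1. ring. }
  apply (Rmult_lt_reg_r (l / 2)); [lra|].
  apply Rle_lt_trans with (Cmod (q' - q)).
  - rewrite Heq. apply Rmult_le_compat_l; [apply Cmod_ge_0|exact Hsum].
  - rewrite (Rmult_comm eps). eapply Rlt_le_trans; [exact Hq'|apply Rmin_r].
Qed.

Lemma quad_continuous w : continuousC3 quad w.
Proof.
  unfold quad. repeat apply continuousC3_plus;
  apply continuousC3_mult; apply continuous_coord.
Qed.

Definition newton (w : C3) : C := (/ root (quad w))%C.
Definition newton_grad (i : axis) (w : C3) : C := (- (coord i w * (newton w * (newton w * newton w))))%C.
Definition newton_hess (i j : axis) (w : C3) : C :=
  (- (kronecker i j * (newton w * (newton w * newton w))) +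
   3 * (coord i w * (coord j w * (newton w * (newton w * (newton w * (newton w * newton w)))))))%C.

Lemma slit_quad_open w : slit (quad w) -> exists r, 0 < r /\ forall x, norm3 (sub3 x w) < r -> slit (quad x).
Proof.
  intros H. destruct (slit_open _ H) as [r [Hr Ho]].
  destruct (proj1 (continuousC3_iff quad w) (quad_continuous w) r Hr) as [r' [Hr' H']].
  exists r'. split; [exact Hr'|]. intros x Hx. now apply Ho, H'.
Qed.

Lemma newton_continuous w : slit (quad w) -> continuousC3 newton w.
Proof.
  intros H. unfold newton. apply (continuousC3_inv (fun w => root (quad w))).
  - apply (continuousC3_comp quad root);
      [apply quad_continuous|now apply root_continuous].
  - apply half_plane_neq_0. now apply root_spec.
Qed.

Lemma newton_cube_continuous w : slit (quad w) ->
  continuousC3 (fun w => newton w * (newton w * newton w))%C w.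
Proof. intros H. repeat apply continuousC3_mult; now apply newton_continuous. Qed.

Lemma newton_grad_continuous i w : slit (quad w) -> continuousC3 (newton_grad i) w.
Proof.
  intros H. unfold newton_grad. apply continuousC3_opp. apply continuousC3_mult.
  - apply continuous_coord.
  - now apply newton_cube_continuous.
Qed.

Lemma newton_sqr w : slit (quad w) -> (newton w * newton w * quad w)%C = 1%C.
Proof.
  intros H. destruct (root_spec _ H) as [E Hp]. apply half_plane_neq_0 in Hp.
  unfold newton. rewrite <- E at 3. field. exact Hp.
Qed.

Lemma newton_hess_trace w : slit (quad w) -> (newton_hess axis1 axis1 w + newton_hess axis2 axis2 w + newton_hess axis3 axis3 w)%C = 0%C.
Proof.
  intros H. unfold newton_hess; simpl kronecker.
  transitivity ((newton w * (newton w * newton w)) * (- (3) + 3 * (newton w * newton w * quad w)))%C.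
  - unfold quad. ring.
  - rewrite newton_sqr by exact H. ring.
Qed.

(** Let c, c' be the roots at w and w + h, and d = c'^2 - c^2 = 2 wh + hh with hh quadratic in h.
    Then 1/c' - 1/c + d/(2 c^3) = (c' - c)^2 (c' + 2 c) / (2 c^3 c') and c' - c = d / (c + c'). The
    remainder is therefore quadratic, with coefficients that stay bounded because c, c' and c + c'
    keep away from 0, the last one by the half plane condition. *)
Lemma C11_newton w0 : slit (quad w0) -> C11 newton newton_grad w0.
Proof.
  intros H.
  set (l := half_plane (root (quad w0))).
  assert (Hl : 0 < l) by now apply root_spec.
  destruct (slit_quad_open w0 H) as [r1 [R1 H1]].
  destruct (continuous_bounded newton w0 (newton_continuous w0 H)) as [r2 [R2 [B [HB H2]]]].
  assert (Hc : continuousC3 (fun w => root (quad w)) w0).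
  { apply (continuousC3_comp quad root);
      [apply quad_continuous|now apply root_continuous]. }
  assert (Hl4 : 0 < l / 4) by lra.
  destruct (proj1 (continuousC3_iff _ w0) Hc _ Hl4) as [r3 [R3 H3]].
  set (rho := Rmin (Rmin r1 r2) (Rmin r3 1)).
  assert (Hrho : rho <= r1 /\ rho <= r2 /\ rho <= r3 /\ rho <= 1).
  { unfold rho, Rmin. repeat destruct (Rle_dec _ _); lra. }
  assert (Hrho0 : 0 < rho) by (unfold rho; repeat apply Rmin_glb_lt; lra).
  destruct Hrho as [U1 [U2 [U3 U4]]]. clearbody rho.
  (* Chosen to bound [Cmod d] by [A * norm3 h]: the term [2 * wh] uses [norm3 w <= norm3 w0 + 1],
     and the final 1 absorbs [hh] since [norm3 h < 1]. *)
  set (A := 2 * (norm3 w0 + 1) + 1).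
  apply (C11_intro _ _ _ (rho / 2) (A * A * (B * B * (3 * B)) * (2 / l * (2 / l)) / 2 + B * (B * B) / 2)).
  { now apply newton_continuous. }
  { intros i; now apply newton_grad_continuous. }
  { lra. }
  intros w h Hw Hh.
  assert (Hwh : norm3 (sub3 (add3 w h) w0) < rho).
  { rewrite add3_sub3. eapply Rle_lt_trans; [apply norm3_triangle|]. lra. }
  set (w' := add3 w h) in *.
  assert (Hlow : forall x, norm3 (sub3 x w0) < rho -> l / 2 <= half_plane (root (quad x))).
  { intros x Hx. specialize (H3 x ltac:(lra)).
    pose proof (half_plane_bound (root (quad x) - root (quad w0))) as Hb.
    replace (half_plane (root (quad x) - root (quad w0))) with (half_plane (root (quad x)) - l) in Hb
      by (unfold l, half_plane; simpl; ring).
    pose proof (Rabs_maj2 (half_plane (root (quad x)) - l)). lra. }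
  pose proof (Hlow w ltac:(lra)) as L1. pose proof (Hlow w' Hwh) as L2.
  destruct (root_spec (quad w) (H1 w ltac:(lra))) as [E1 P1].
  destruct (root_spec (quad w') (H1 w' ltac:(lra))) as [E2 P2].
  pose proof (H2 w ltac:(lra)) as B1. pose proof (H2 w' ltac:(lra)) as B2.
  unfold newton in B1, B2 |- *.
  set (c := root (quad w)) in *. set (c' := root (quad w')) in *.
  assert (N1 : c <> 0%C) by now apply half_plane_neq_0.
  assert (N2 : c' <> 0%C) by now apply half_plane_neq_0.
  assert (Hsum : l / 2 <= Cmod (c + c')).
  { pose proof (half_plane_bound (c + c')) as Hb. rewrite half_plane_plus in Hb.
    rewrite Rabs_pos_eq in Hb; lra. }
  assert (N3 : (c + c' <> 0)%C) by (apply Cmod_gt_0; lra).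
  set (wh := pairing (fun i => coord i w) h).
  set (hh := pairing (fun i => coord i h) h).
  set (d := (2 * wh + hh)%C).
  assert (Ed : (c' * c' - c * c)%C = d).
  { rewrite E1, E2. unfold d, wh, hh, w', quad, pairing. rewrite !coord_add3. ring. }
  assert (Eg : pairing (fun i => newton_grad i w) h = (- (wh / (c * c * c)))%C).
  { unfold pairing, newton_grad, wh, newton. fold c. unfold pairing. field. exact N1. }
  rewrite Eg.
  match goal with |- Cmod ?X <= _ => replace X with
    (d * d * (/ c * / c * (/ c + 2 * / c')) * (/ (c + c') * / (c + c')) / 2 + - (hh * (/ c * (/ c * / c)) / 2))%C end.
  2: { replace wh with ((c' * c' - c * c - hh) / 2)%C by (rewrite Ed; unfold d; field).
       rewrite <- Ed. field. repeat split; assumption. }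
  assert (Hn : 0 <= norm3 h) by apply norm3_ge_0.
  assert (Hhh : Cmod hh <= norm3 h * norm3 h) by (apply Cmod_pairing; intros i; apply Cmod_coord).
  assert (Hnw : norm3 w <= norm3 w0 + 1).
  { replace w with (add3 w0 (sub3 w w0)).
    - eapply Rle_trans; [apply norm3_triangle|]. lra.
    - destruct w as [[x1 x2] x3], w0 as [[y1 y2] y3]; simpl. f_equal; [f_equal|]; ring. }
  assert (Hwh' : Cmod wh <= (norm3 w0 + 1) * norm3 h).
  { apply Cmod_pairing. intros i. eapply Rle_trans; [apply Cmod_coord|exact Hnw]. }
  set (n := norm3 h) in *.
  assert (Hd : Cmod d <= A * n).
  { unfold d. Ctriangle. rewrite Cmod_mult, Cmod_R, Rabs_pos_eq by lra.
    unfold A. nra. }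
  assert (Hg : Cmod (/ (c + c')) <= 2 / l).
  { rewrite Cmod_inv by exact N3. replace (2 / l) with (/ (l / 2)) by (field; lra).
    apply Rinv_le_contravar; lra. }
  assert (HA : 0 <= A) by (unfold A; pose proof (norm3_ge_0 w0); lra).
  assert (H2l : 0 <= 2 / l) by (apply Rlt_le, Rdiv_lt_0_compat; lra).
  assert (M2 : Cmod 2 = 2) by (rewrite Cmod_R, Rabs_pos_eq; lra).
  Ctriangle. rewrite Cmod_opp.
  unfold Cdiv. rewrite !Cmod_mult, (Cmod_inv 2), M2 by (intros E; apply RtoC_inj in E; lra).
  assert (X1 : Cmod (/ c + 2 * / c') <= 3 * B).
  { Ctriangle. rewrite Cmod_mult, M2. lra. }
  assert (Y : forall a b a' b', 0 <= a <= a' -> 0 <= b <= b' -> 0 <= a * b <= a' * b').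
  { intros a b a' b' Ha Hb. split; [apply Rmult_le_pos; lra|apply Rmult_le_compat; lra]. }
  assert (Z1 : 0 <= Cmod d * Cmod d * (Cmod (/ c) * Cmod (/ c) * Cmod (/ c + 2 * / c')) *
    (Cmod (/ (c + c')) * Cmod (/ (c + c'))) <= (A * n) * (A * n) * (B * B * (3 * B)) * (2 / l * (2 / l))).
  { repeat apply Y; split; try apply Cmod_ge_0; assumption. }
  assert (Z2 : 0 <= Cmod hh * (Cmod (/ c) * (Cmod (/ c) * Cmod (/ c))) <= (n * n) * (B * (B * B))).
  { repeat apply Y; split; try apply Cmod_ge_0; assumption. }
  apply Rle_trans with ((A * n) * (A * n) * (B * B * (3 * B)) * (2 / l * (2 / l)) * / 2 + (n * n) * (B * (B * B)) * / 2); lra.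
Qed.

Lemma C11_newton_grad i w0 : slit (quad w0) -> C11 (newton_grad i) (newton_hess i) w0.
Proof.
  intros H. pose proof (C11_newton w0 H) as HT.
  pose proof (C11_mult _ _ _ _ w0 (C11_const (- (1))%C w0)
    (C11_mult _ _ _ _ w0 (C11_coord i w0) (C11_mult _ _ _ _ w0 HT (C11_mult _ _ _ _ w0 HT HT)))) as HM.
  refine (C11_ext _ _ _ _ w0 _ _ HM).
  - intros w. unfold newton_grad. ring.
  - intros j w. unfold newton_grad, newton_hess. ring.
Qed.

End Kernel.

(** * Green's vector field of a harmonic function *)

Lemma scal_C_R (k : R) (z : C) : scal (V := C_R_ModuleSpace) k z = (RtoC k * z)%C.
Proof. apply injective_projections; simpl; unfold scal; simpl; unfold mult; simpl; ring. Qed.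

Lemma is_derive_C_iff (f : R -> C) (x : R) (l : C) :
  is_derive (K := R_AbsRing) (V := C_R_NormedModule) f x l <->
  forall eps, 0 < eps -> exists r, 0 < r /\ forall t, Rabs (t - x) < r ->
    Cmod (f t - f x - RtoC (t - x) * l) <= eps * Rabs (t - x).
Proof.
  assert (E : forall t, norm (V := C_R_NormedModule)
      (minus (minus (f t) (f x)) (scal (minus t x) l)) = Cmod (f t - f x - RtoC (t - x) * l)).
  { intros t. rewrite C_R_norm. rewrite <- (scal_C_R (t - x) l). reflexivity. }
  split.
  - intros [_ H] eps He.
    destruct (H x (fun P HP => HP) (mkposreal eps He)) as [r Hr].
    exists r; split; [apply cond_pos|]. intros t Ht. rewrite <- E. apply (Hr t Ht).
  - intros H. split; [apply is_linear_scal_l|].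
    intros x' Hx'. rewrite <- (is_filter_lim_locally_unique (V := R_NormedModule) x x' Hx'). clear x' Hx'. intros eps.
    destruct (H eps (cond_pos eps)) as [r [Hr H']]. exists (mkposreal r Hr).
    intros t Ht. eapply Rle_trans; [right; exact (E t)|]. exact (H' t Ht).
Qed.

Lemma move_0 i y : move i y 0 = y.
Proof. destruct y as [[y1 y2] y3], i; simpl; now rewrite Rplus_0_r. Qed.

Lemma move_move i y a b : move i (move i y a) b = move i y (a + b).
Proof. destruct y as [[y1 y2] y3], i; simpl; now rewrite Rplus_assoc. Qed.

Lemma is_partial_iff i (f : R3 -> C) y l :
  is_partial i f y l <->
  forall eps, 0 < eps -> exists r, 0 < r /\ forall t, Rabs t < r ->
    Cmod (f (move i y t) - f y - RtoC t * l) <= eps * Rabs t.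
Proof.
  unfold is_partial. rewrite is_derive_C_iff. rewrite move_0.
  split; intros H eps He; destruct (H eps He) as [r [Hr H']]; exists r; (split; [exact Hr|]);
  intros t Ht; specialize (H' t); rewrite Rminus_0_r in *; auto.
Qed.

Lemma is_partial_minus i f g y l m :
  is_partial i f y l -> is_partial i g y m -> is_partial i (fun p => f p - g p)%C y (l - m)%C.
Proof.
  rewrite !is_partial_iff. intros Hf Hg eps He. assert (He2 : 0 < eps / 2) by lra.
  destruct (Hf _ He2) as [r [Hr H]], (Hg _ He2) as [r' [Hr' H']].
  exists (Rmin r r'). split; [now apply Rmin_glb_lt|]. intros t Ht.
  pose proof (Rmin_l r r'). pose proof (Rmin_r r r').
  specialize (H t ltac:(lra)). specialize (H' t ltac:(lra)).
  replace (f (move i y t) - g (move i y t) - (f y - g y) - RtoC t * (l - m))%C with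
    ((f (move i y t) - f y - RtoC t * l) + - (g (move i y t) - g y - RtoC t * m))%C by ring.
  Ctriangle. rewrite Cmod_opp. lra.
Qed.

Lemma is_partial_mult i f g y l m :
  is_partial i f y l -> is_partial i g y m ->
  is_partial i (fun p => f p * g p)%C y (f y * m + l * g y)%C.
Proof.
  rewrite !is_partial_iff. intros Hf Hg eps He.
  (* Besides the four constants, [B] bounds the difference quotients of [f] and [g], thanks to the
     summand 1 and [e <= 1]. Each of the three error terms is then at most [eps / 4] times
     [Rabs t]. *)
  set (B := Cmod l + Cmod m + Cmod (f y) + Cmod (g y) + 1).
  pose proof (Cmod_ge_0 l); pose proof (Cmod_ge_0 m); pose proof (Cmod_ge_0 (f y)); pose proof (Cmod_ge_0 (g y)).
  assert (HB : 0 < B) by (unfold B; lra).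
  set (e := Rmin 1 (eps / (4 * B))).
  assert (He4 : 0 < eps / (4 * B)) by (apply Rdiv_lt_0_compat; lra).
  assert (He0 : 0 < e) by (apply Rmin_glb_lt; lra).
  assert (He1 : e <= 1) by apply Rmin_l.
  assert (HeB : e * B <= eps / 4).
  { apply Rle_trans with (eps / (4 * B) * B); [apply Rmult_le_compat_r; [lra|apply Rmin_r]|].
    right; field; lra. }
  destruct (Hf _ He0) as [r [Hr H3]], (Hg _ He0) as [r' [Hr' H4]].
  assert (Hq : 0 < eps / (4 * B * B)) by (apply Rdiv_lt_0_compat; [lra|]; apply Rmult_lt_0_compat; lra).
  set (rho := Rmin (Rmin r r') (eps / (4 * B * B))).
  assert (R1 : rho <= r) by (unfold rho; eapply Rle_trans; [apply Rmin_l|apply Rmin_l]).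
  assert (R2 : rho <= r') by (unfold rho; eapply Rle_trans; [apply Rmin_l|apply Rmin_r]).
  assert (R3 : rho <= eps / (4 * B * B)) by apply Rmin_r.
  exists rho. split; [unfold rho; repeat apply Rmin_glb_lt; assumption|]. intros t Ht.
  specialize (H3 t ltac:(lra)). specialize (H4 t ltac:(lra)).
  set (a := (f (move i y t) - f y - RtoC t * l)%C) in *.
  set (b := (g (move i y t) - g y - RtoC t * m)%C) in *.
  replace (f (move i y t) * g (move i y t) - f y * g y - RtoC t * (f y * m + l * g y))%C with
    (a * g y + f y * b + (a + RtoC t * l) * (b + RtoC t * m))%C by (unfold a, b; ring).
  pose proof (Rabs_pos t) as Htp. set (n := Rabs t) in *.
  assert (Ha : Cmod (a + RtoC t * l) <= B * n).
  { Ctriangle. rewrite Cmod_mult, Cmod_R. fold n. unfold B. nra. }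
  assert (Hb : Cmod (b + RtoC t * m) <= B * n).
  { Ctriangle. rewrite Cmod_mult, Cmod_R. fold n. unfold B. nra. }
  Ctriangle.
  eapply Rle_trans; [apply Rplus_le_compat_r, Cmod_triangle|]. rewrite !Cmod_mult.
  assert (X1 : Cmod a * Cmod (g y) <= (e * n) * B) by (apply Rmult_le_compat; try apply Cmod_ge_0; [exact H3|unfold B; lra]).
  assert (X2 : Cmod (f y) * Cmod b <= B * (e * n)) by (apply Rmult_le_compat; try apply Cmod_ge_0; [unfold B; lra|exact H4]).
  assert (X3 : Cmod (a + RtoC t * l) * Cmod (b + RtoC t * m) <= (B * n) * (B * n))
    by (apply Rmult_le_compat; try apply Cmod_ge_0; assumption).
  assert (X4 : (B * n) * (B * n) <= eps / 4 * n).
  { replace ((B * n) * (B * n)) with ((B * B * n) * n) by ring. apply Rmult_le_compat_r; [exact Htp|].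
    apply Rle_trans with (B * B * (eps / (4 * B * B))); [|right; field; lra].
    apply Rmult_le_compat_l; [nra|lra]. }
  assert (X5 : (e * n) * B <= eps / 4 * n).
  { replace ((e * n) * B) with ((e * B) * n) by ring. now apply Rmult_le_compat_r. }
  nra.
Qed.

Lemma Re_increment (g dg : R -> R) (tau L e : R) :
  (forall t, Rmin 0 tau <= t <= Rmax 0 tau -> is_derive g t (dg t)) ->
  (forall t, Rmin 0 tau <= t <= Rmax 0 tau -> Rabs (dg t - L) <= e) ->
  Rabs (g tau - g 0 - tau * L) <= e * Rabs tau.
Proof.
  intros Hd He. destruct (MVT_gen g 0 tau dg) as [c [Hc E]].
  - intros t Ht. apply Hd; lra.
  - intros t Ht. apply continuity_pt_filterlim. apply (ex_derive_continuous g). eexists; now apply Hd.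
  - rewrite E. replace (dg c * (tau - 0) - tau * L) with ((dg c - L) * tau) by ring.
    rewrite Rabs_mult. apply Rmult_le_compat_r; [apply Rabs_pos|now apply He].
Qed.

Lemma is_derive_proj (pr : C -> R) (g : R -> C) t l :
  (forall z, Rabs (pr z) <= Cmod z) ->
  (forall z w, pr (z - w)%C = pr z - pr w) -> (forall k z, pr (RtoC k * z)%C = k * pr z) ->
  is_derive (K := R_AbsRing) (V := C_R_NormedModule) g t l -> is_derive (fun t => pr (g t)) t (pr l).
Proof.
  intros Hpr Hm Hs Hg. apply is_derive_Reals. intros eps He. assert (He2 : 0 < eps / 2) by lra.
  destruct (proj1 (is_derive_C_iff g t l) Hg _ He2) as [r [Hr H]].
  exists (mkposreal r Hr). intros h Hh Hhr. simpl in Hhr.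
  specialize (H (t + h)). replace (t + h - t) with h in H by ring. specialize (H Hhr).
  pose proof (Hpr (g (t + h)%R - g t - RtoC h * l)%C) as Hp. rewrite !Hm, Hs in Hp.
  replace ((pr (g (t + h)) - pr (g t)) / h - pr l) with ((pr (g (t + h)) - pr (g t) - h * pr l) / h) by (field; exact Hh).
  unfold Rdiv. rewrite Rabs_mult, Rabs_inv.
  assert (Hh0 : 0 < Rabs h) by now apply Rabs_pos_lt.
  apply Rle_lt_trans with (eps / 2 * Rabs h * / Rabs h).
  - apply Rmult_le_compat_r; [apply Rlt_le; now apply Rinv_0_lt_compat|lra].
  - field_simplify; lra.
Qed.

(** The mean value theorem is applied to the real and imaginary parts separately, hence the factor
    2. *)
Lemma partial_increment i (f fi : R3 -> C) y tau (L : C) e :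
  (forall t, Rmin 0 tau <= t <= Rmax 0 tau -> is_partial i f (move i y t) (fi (move i y t))) ->
  (forall t, Rmin 0 tau <= t <= Rmax 0 tau -> Cmod (fi (move i y t) - L) <= e) ->
  Cmod (f (move i y tau) - f y - RtoC tau * L) <= 2 * e * Rabs tau.
Proof.
  intros Hd He. set (g := fun t => f (move i y t)).
  assert (Hg : forall t, Rmin 0 tau <= t <= Rmax 0 tau ->
    is_derive (K := R_AbsRing) (V := C_R_NormedModule) g t (fi (move i y t))).
  { intros t Ht. apply is_derive_C_iff. intros eps Heps.
    destruct (proj1 (is_partial_iff _ _ _ _) (Hd t Ht) eps Heps) as [r [Hr H]].
    exists r; split; [exact Hr|]. intros t' Ht'. specialize (H (t' - t) Ht').
    rewrite move_move in H. replace (t + (t' - t)) with t' in H by ring. exact H. }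
  replace (f y) with (g 0) by (unfold g; now rewrite move_0). change (f (move i y tau)) with (g tau).
  eapply Rle_trans; [apply Cmod_le_add|].
  assert (H1 : Rabs (fst (g tau) - fst (g 0) - tau * fst L) <= e * Rabs tau).
  { apply (Re_increment (fun t => fst (g t)) (fun t => fst (fi (move i y t)))).
    - intros t Ht. apply (is_derive_proj fst g t); auto using Rabs_fst_Cmod; intros; simpl; ring.
    - intros t Ht. eapply Rle_trans; [|now apply (He t)]. apply (Rabs_fst_Cmod (fi (move i y t) - L)%C). }
  assert (H2 : Rabs (snd (g tau) - snd (g 0) - tau * snd L) <= e * Rabs tau).
  { apply (Re_increment (fun t => snd (g t)) (fun t => snd (fi (move i y t)))).
    - intros t Ht. apply (is_derive_proj snd g t); auto using Rabs_snd_Cmod; intros; simpl; ring.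
    - intros t Ht. eapply Rle_trans; [|now apply (He t)]. apply (Rabs_snd_Cmod (fi (move i y t) - L)%C). }
  simpl.
  replace (fst (g tau) + - fst (g 0) + - (tau * fst L - 0 * snd L)) with (fst (g tau) - fst (g 0) - tau * fst L) by ring.
  replace (snd (g tau) + - snd (g 0) + - (tau * snd L + 0 * fst L)) with (snd (g tau) - snd (g 0) - tau * snd L) by ring.
  lra.
Qed.

(** * From continuous partial derivatives to vanishing divergence *)

Definition near3 (r : R) (p : R3) (x y z : R) : Prop :=
  let '(x', y', z') := p in Rabs (x' - x) < r /\ Rabs (y' - y) < r /\ Rabs (z' - z) < r.

Lemma between_near a t x r tau :
  Rabs (a - x) <= r -> Rabs (a + tau - x) <= r -> Rmin 0 tau <= t <= Rmax 0 tau -> Rabs (a + t - x) <= r.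
Proof.
  unfold Rmin, Rmax. intros H1 H2 Ht. apply Rabs_le. apply Rabs_le_between in H1, H2.
  destruct (Rle_dec 0 tau); lra.
Qed.

Lemma divergence_free_of_partials (V1 V2 V3 D1 D2 D3 : R3 -> C) x y z r0 :
  0 < r0 ->
  (forall p, near3 r0 p x y z ->
     is_partial axis1 V1 p (D1 p) /\ is_partial axis2 V2 p (D2 p) /\ is_partial axis3 V3 p (D3 p)) ->
  continuous3 D1 x y z -> continuous3 D2 x y z -> continuous3 D3 x y z ->
  (D1 (x, y, z) + D2 (x, y, z) + D3 (x, y, z))%C = 0%C ->
  divergence_free V1 V2 V3 x y z.
Proof.
  intros Hr0 Hp C1 C2 C3 E.
  exists (D1 (x, y, z)), (D2 (x, y, z)), (D3 (x, y, z)). split; [exact E|].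
  (* One factor 2 comes from [partial_increment], another from the increment, which joins two points
     at distance at most [r] from the centre and so has length up to [2 * r]. *)
  intros eps He. assert (He4 : 0 < eps / 4) by lra.
  destruct (proj1 (continuous3_iff _ _ _ _) C1 _ He4) as [r1 [R1 H1]].
  destruct (proj1 (continuous3_iff _ _ _ _) C2 _ He4) as [r2 [R2 H2]].
  destruct (proj1 (continuous3_iff _ _ _ _) C3 _ He4) as [r3 [R3 H3]].
  set (rho := Rmin (Rmin r0 r1) (Rmin r2 r3)).
  assert (Hrho : rho <= r0 /\ rho <= r1 /\ rho <= r2 /\ rho <= r3).
  { unfold rho, Rmin. repeat destruct (Rle_dec _ _); lra. }
  exists rho. split; [unfold rho; repeat apply Rmin_glb_lt; lra|].
  destruct Hrho as [U0 [U1 [U2 U3]]]. clearbody rho.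
  intros r Hr x' y' z' t Hx Hy Hz.
  assert (K : forall i V D q (tau p : R),
    Rabs (p - q) <= r -> Rabs (p + tau - q) <= r ->
    (forall a, Rabs (p + a - q) <= r -> is_partial i V (move i (x', y', z') a) (D (move i (x', y', z') a)) /\
       Cmod (D (move i (x', y', z') a) - D (x, y, z)) <= eps / 4) ->
    Cmod (V (move i (x', y', z') tau) - V (x', y', z') - RtoC tau * D (x, y, z)) <= eps * r).
  { intros i V D q tau p Hq Ht H.
    eapply Rle_trans; [apply (partial_increment i V D (x', y', z') tau (D (x, y, z)) (eps / 4))|].
    - intros a Ha. apply H. now apply (between_near p a q r tau).
    - intros a Ha. apply H. now apply (between_near p a q r tau).
    - assert (Rabs tau <= 2 * r); [|nra].
      replace tau with ((p + tau - q) + - (p - q)) by ring.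
      eapply Rle_trans; [apply Rabs_triang|]. rewrite Rabs_Ropp. lra. }
  assert (Hsub : forall a b : R, a + (b - a) = b) by (intros; ring).
  split; [|split]; intros Ht.
  - pose proof (K axis1 V1 D1 x (t - x') x') as K'. simpl in K'. rewrite Hsub in K'. apply K'; auto.
    intros a Ha. split; [apply Hp; simpl; lra|apply Rlt_le, H1; lra].
  - pose proof (K axis2 V2 D2 y (t - y') y') as K'. simpl in K'. rewrite Hsub in K'. apply K'; auto.
    intros a Ha. split; [apply Hp; simpl; lra|apply Rlt_le, H2; lra].
  - pose proof (K axis3 V3 D3 z (t - z') z') as K'. simpl in K'. rewrite Hsub in K'. apply K'; auto.
    intros a Ha. split; [apply Hp; simpl; lra|apply Rlt_le, H3; lra].
Qed.

Definition shift (z : C3) (y : R3) : C3 := sub3 (R3_to_C3 y) z.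

Lemma shift_near z x1 x2 x3 r p : near3 r p x1 x2 x3 ->
  norm3 (sub3 (shift z p) (shift z (x1, x2, x3))) < 3 * r.
Proof.
  destruct p as [[p1 p2] p3], z as [[z1 z2] z3]. intros [H1 [H2 H3]]. simpl.
  replace (RtoC p1 - z1 - (RtoC x1 - z1))%C with (RtoC (p1 - x1)) by (rewrite RtoC_minus; ring).
  replace (RtoC p2 - z2 - (RtoC x2 - z2))%C with (RtoC (p2 - x2)) by (rewrite RtoC_minus; ring).
  replace (RtoC p3 - z3 - (RtoC x3 - z3))%C with (RtoC (p3 - x3)) by (rewrite RtoC_minus; ring).
  rewrite !Cmod_R. lra.
Qed.

Lemma continuous3_shift f z x1 x2 x3 :
  continuousC3 f (shift z (x1, x2, x3)) ->
  continuous3 (fun y => f (shift z y)) x1 x2 x3.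
Proof.
  rewrite continuousC3_iff, continuous3_iff. intros H eps He.
  destruct (H eps He) as [r [Hr H']]. exists (r / 3). split; [lra|].
  intros y1 y2 y3 H1 H2 H3. apply H'. replace r with (3 * (r / 3)) by field.
  apply shift_near. repeat split; assumption.
Qed.

Lemma C11_partial f g z y i : C11 f g (shift z y) -> is_partial i (fun y => f (shift z y)) y (g i (shift z y)).
Proof.
  intros [_ [_ [r [Hr H]]]]. apply is_partial_iff. intros eps He.
  set (h := fun t : R => match i with axis1 => (RtoC t, RtoC 0, RtoC 0) | axis2 => (RtoC 0, RtoC t, RtoC 0)
     | axis3 => (RtoC 0, RtoC 0, RtoC t) end : C3).
  assert (E1 : forall t, shift z (move i y t) = add3 (shift z y) (h t)).
  { intros t. destruct y as [[y1 y2] y3], z as [[z1 z2] z3]. unfold h.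
    destruct i; unfold shift; simpl; rewrite RtoC_plus;
      (apply f_equal2; [apply f_equal2|]); ring. }
  assert (E2 : forall t, norm3 (h t) = Rabs t).
  { intros t. unfold h. destruct i; simpl; rewrite !Cmod_R, Rabs_R0; ring. }
  assert (E3 : forall t, pairing (fun i => g i (shift z y)) (h t) = (RtoC t * g i (shift z y))%C).
  { intros t. unfold pairing, h. destruct i; simpl; ring. }
  exists (Rmin r (eps * r)). split; [apply Rmin_glb_lt; [exact Hr|now apply Rmult_lt_0_compat]|].
  intros t Ht. pose proof (Rmin_l r (eps * r)). pose proof (Rmin_r r (eps * r)).
  specialize (H (shift z y) (h t)). rewrite E2, E3, <- E1 in H.
  eapply Rle_trans; [apply H|].
  - destruct (shift z y) as [[a b] c]. simpl.
    replace (a - a)%C with (RtoC 0) by ring. replace (b - b)%C with (RtoC 0) by ring.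
    replace (c - c)%C with (RtoC 0) by ring. rewrite Cmod_0. lra.
  - lra.
  - pose proof (Rabs_pos t). rewrite <- Rmult_assoc. apply Rmult_le_compat_r; [assumption|].
    apply (Rmult_le_reg_l r); [exact Hr|]. rewrite <- Rmult_assoc, Rinv_r by lra. lra.
Qed.

Section GreenField.
Variable s : R.
Hypothesis Hs : s * s = 1.
Variables (u : R3 -> C) (d : axis -> R3 -> C) (dd : axis -> axis -> R3 -> C) (z : C3).

Definition green (i : axis) (y : R3) : C :=
  (newton s (shift z y) * d i y - u y * newton_grad s i (shift z y))%C.

(** The matrix of [harmonic_on], with the derivatives [d] and [dd] as parameters: the fluxes below
    involve [d] itself, not just its existence. *)
Definition harmonic_data (U : R3 -> Prop) : Prop :=
  forall x : R3, U x ->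
      continuous u x /\
      (forall i, is_partial i u x (d i x) /\ continuous (d i) x) /\
      (forall i j, is_partial j (d i) x (dd i j x) /\ continuous (dd i j) x) /\
      (dd axis1 axis1 x + dd axis2 axis2 x + dd axis3 axis3 x)%C = RtoC 0.

Variable U : R3 -> Prop.
Hypothesis Hu : harmonic_data U.

Lemma green_continuous i x y w : U (x, y, w) -> slit s (quad (shift z (x, y, w))) ->
  continuous3 (green i) x y w.
Proof.
  intros HU Hsl. destruct (Hu _ HU) as [Cu [Cd _]].
  apply continuous3_minus; apply continuous3_mult.
  - apply continuous3_shift. now apply newton_continuous.
  - apply continuous3_intro, Cd.
  - apply continuous3_intro, Cu.
  - apply continuous3_shift. now apply newton_grad_continuous.
Qed.

Lemma newton_hess_continuous i j w : slit s (quad w) -> continuousC3 (newton_hess s i j) w.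
Proof.
  intros H. destruct (C11_newton_grad s Hs i w H) as [_ [HT _]]. apply HT.
Qed.

(** In each component the product of first derivatives of the kernel and of [u] cancels, leaving as
    divergence the kernel times the Laplacian of [u] minus [u] times the Laplacian of the kernel;
    both Laplacians vanish. *)
Lemma green_regular x y w r : 0 < r -> (forall p, near3 r p x y w -> U p) ->
  slit s (quad (shift z (x, y, w))) ->
  regular (green axis1) (green axis2) (green axis3) x y w.
Proof.
  intros Hr HU Hsl.
  assert (HUp : U (x, y, w)) by (apply HU; repeat split; rewrite Rminus_diag, Rabs_R0; exact Hr).
  split; [|split; [|split]]; try now apply green_continuous.
  destruct (slit_quad_open s Hs _ Hsl) as [r' [Hr' Ho]].
  set (D := fun i p => (newton s (shift z p) * dd i i p - u p * newton_hess s i i (shift z p))%C).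
  assert (HD : forall i, continuous3 (D i) x y w).
  { intros i. destruct (Hu _ HUp) as [Cu [_ [Cdd _]]].
    apply continuous3_minus; apply continuous3_mult.
    - apply continuous3_shift. now apply newton_continuous.
    - apply continuous3_intro, Cdd.
    - apply continuous3_intro, Cu.
    - apply continuous3_shift. now apply newton_hess_continuous. }
  apply (divergence_free_of_partials _ _ _ (D axis1) (D axis2) (D axis3) x y w (Rmin r (r' / 3))); auto.
  - apply Rmin_glb_lt; lra.
  - intros p Hp.
    assert (Hp1 : near3 r p x y w).
    { destruct p as [[a b] c]. destruct Hp as [A1 [A2 A3]]. pose proof (Rmin_l r (r' / 3)). repeat split; lra. }
    assert (Hp2 : slit s (quad (shift z p))).
    { apply Ho. replace r' with (3 * (r' / 3)) by field. apply shift_near.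
      destruct p as [[a b] c]. destruct Hp as [A1 [A2 A3]]. pose proof (Rmin_r r (r' / 3)). repeat split; lra. }
    assert (K : forall i, is_partial i (green i) p (D i p)).
    { intros i. destruct (Hu p (HU p Hp1)) as [_ [Pd [Pdd _]]].
      replace (D i p) with ((newton s (shift z p) * dd i i p + newton_grad s i (shift z p) * d i p)
        - (u p * newton_hess s i i (shift z p) + d i p * newton_grad s i (shift z p)))%C by (unfold D; ring).
      apply is_partial_minus.
      - apply (is_partial_mult i (fun p => newton s (shift z p)) (d i)); [|apply Pdd].
        apply (C11_partial (newton s) (newton_grad s)). now apply C11_newton.
      - apply (is_partial_mult i u (fun p => newton_grad s i (shift z p))); [apply Pd|].
        apply (C11_partial (newton_grad s i) (newton_hess s i)). now apply C11_newton_grad. }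
    repeat split; apply K.
  - destruct (Hu _ HUp) as [_ [_ [_ Hlap]]]. unfold D.
    match goal with |- ?L = _ => transitivity
      (newton s (shift z (x, y, w)) * (dd axis1 axis1 (x, y, w) + dd axis2 axis2 (x, y, w) + dd axis3 axis3 (x, y, w))
       - u (x, y, w) * (newton_hess s axis1 axis1 (shift z (x, y, w)) + newton_hess s axis2 axis2 (shift z (x, y, w)) + newton_hess s axis3 axis3 (shift z (x, y, w))))%C end.
    + ring.
    + rewrite Hlap, newton_hess_trace by assumption. ring.
Qed.

End GreenField.

(** * The holomorphic extension *)

Definition opp3 (h : C3) : C3 := let '(h1, h2, h3) := h in (- h1, - h2, - h3)%C.

Lemma norm3_opp3 h : norm3 (opp3 h) = norm3 h.
Proof. destruct h as [[h1 h2] h3]; simpl. now rewrite !Cmod_opp. Qed.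

Lemma pairing_opp3 g h : pairing g (opp3 h) = (- pairing g h)%C.
Proof. destruct h as [[h1 h2] h3]; unfold pairing; simpl. ring. Qed.

Lemma shift_add3 z h y : shift (add3 z h) y = add3 (shift z y) (opp3 h).
Proof.
  destruct y as [[y1 y2] y3], z as [[z1 z2] z3], h as [[h1 h2] h3]. unfold shift; simpl.
  triple_ring.
Qed.

Lemma add3_sub3_cancel z w : add3 z (sub3 w z) = w.
Proof.
  destruct w as [[w1 w2] w3], z as [[z1 z2] z3]; simpl. triple_ring.
Qed.

Lemma sub3_add3_cancel z h : sub3 (add3 z h) z = h.
Proof.
  destruct h as [[w1 w2] w3], z as [[z1 z2] z3]; simpl. triple_ring.
Qed.

Lemma sub3_diag z : sub3 z z = (RtoC 0, RtoC 0, RtoC 0).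
Proof. destruct z as [[z1 z2] z3]; simpl. triple_ring. Qed.

Lemma norm3_0 : norm3 (RtoC 0, RtoC 0, RtoC 0) = 0.
Proof. simpl. rewrite Cmod_0. ring. Qed.

(** A quadratic remainder is more than differentiability, but such a bound passes directly through
    an integral over a face once it is uniform in the integration variables. *)
Definition C3diff (F : C3 -> C) (z : C3) : Prop :=
  exists (l : axis -> C) (r M : R), 0 < r /\ forall h, norm3 h < r ->
    Cmod (F (add3 z h) - F z - pairing l h) <= M * (norm3 h * norm3 h).

Lemma C3diff_lin F G z (k : C) :
  C3diff F z -> C3diff G z -> C3diff (fun x => F x + k * G x)%C z.
Proof.
  intros [l [r [M [Hr H]]]] [l' [r' [M' [Hr' H']]]].
  exists (fun i => l i + k * l' i)%C, (Rmin r r'), (M + Cmod k * M'). split; [now apply Rmin_glb_lt|].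
  intros h Hh. pose proof (Rmin_l r r'). pose proof (Rmin_r r r').
  specialize (H h ltac:(lra)). specialize (H' h ltac:(lra)).
  match goal with |- Cmod ?X <= _ => replace X with
    ((F (add3 z h) - F z - pairing l h) + k * (G (add3 z h) - G z - pairing l' h))%C
    by (unfold pairing; ring) end.
  Ctriangle. rewrite Cmod_mult.
  apply (Rmult_le_compat_l (Cmod k)) in H'; [|apply Cmod_ge_0]. lra.
Qed.

Lemma C3diff_plus F G z :
  C3diff F z -> C3diff G z -> C3diff (fun x => F x + G x)%C z.
Proof.
  intros HF HG. destruct (C3diff_lin F G z 1%C HF HG) as [l [r [M [Hr H]]]].
  exists l, r, M. split; [exact Hr|]. intros h Hh. specialize (H h Hh). now rewrite !Cmult_1_l in H.
Qed.

Lemma C3diff_minus F G z :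
  C3diff F z -> C3diff G z -> C3diff (fun x => F x - G x)%C z.
Proof.
  intros HF HG. destruct (C3diff_lin F G z (- (1))%C HF HG) as [l [r [M [Hr H]]]].
  exists l, r, M. split; [exact Hr|]. intros h Hh. specialize (H h Hh).
  replace (F (add3 z h) - G (add3 z h) - (F z - G z))%C with
    (F (add3 z h) + - (1) * G (add3 z h) - (F z + - (1) * G z))%C by ring. exact H.
Qed.

Lemma C3diff_local F G z r :
  0 < r -> (forall x, norm3 (sub3 x z) < r -> F x = G x) -> C3diff F z -> C3diff G z.
Proof.
  intros Hr0 E [l [r' [M [Hr H]]]]. exists l, (Rmin r r'), M. split; [now apply Rmin_glb_lt|].
  intros h Hh. pose proof (Rmin_l r r'). pose proof (Rmin_r r r').
  rewrite <- !E.
  - apply H; lra.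
  - rewrite sub3_diag, norm3_0. exact Hr0.
  - rewrite sub3_add3_cancel. lra.
Qed.

Lemma continuous2_shift f z (phi : R -> R -> R3) a b :
  (forall r a' b', Rabs (a' - a) < r -> Rabs (b' - b) < r ->
     norm3 (sub3 (shift z (phi a' b')) (shift z (phi a b))) < 3 * r) ->
  continuousC3 f (shift z (phi a b)) -> continuous2 (fun a b => f (shift z (phi a b))) a b.
Proof.
  intros Hphi. rewrite continuousC3_iff, continuous2_iff. intros H eps He.
  destruct (H eps He) as [r [Hr H']]. exists (r / 3). split; [lra|]. intros a' b' Ha Hb.
  apply H'. replace r with (3 * (r / 3)) by field. now apply Hphi.
Qed.

Lemma continuous2_bounded f a b :
  continuous2 f a b -> exists r, 0 < r /\ forall a' b', Rabs (a' - a) < r -> Rabs (b' - b) < r ->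
    Cmod (f a' b') <= / r.
Proof.
  rewrite continuous2_iff. intros H. destruct (H 1 Rlt_0_1) as [r [Hr H']].
  pose proof (Cmod_ge_0 (f a b)) as H0.
  exists (Rmin r (/ (Cmod (f a b) + 1))).
  assert (Hi : 0 < / (Cmod (f a b) + 1)) by (apply Rinv_0_lt_compat; lra).
  split; [now apply Rmin_glb_lt|]. intros a' b' Ha Hb.
  pose proof (Rmin_l r (/ (Cmod (f a b) + 1))).
  apply Rle_trans with (Cmod (f a b) + 1).
  - specialize (H' a' b' ltac:(lra) ltac:(lra)).
    replace (f a' b') with ((f a' b' - f a b) + f a b)%C by ring.
    Ctriangle. lra.
  - rewrite <- (Rinv_inv (Cmod (f a b) + 1)) at 1. apply Rinv_le_contravar; [|apply Rmin_r].
    now apply Rmin_glb_lt.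
Qed.

(** * Differentiation under the integral over a face *)

Section Face.
Variable s : R.
Hypothesis Hs : s * s = 1.
Variables (u : R3 -> C) (d : axis -> R3 -> C) (i : axis) (z0 : C3) (phi : R -> R -> R3).
Variables a b c e : R.
Hypotheses (Hab : a <= b) (Hce : c <= e).
Hypothesis Hphi : forall z r x y x' y', Rabs (x' - x) < r -> Rabs (y' - y) < r ->
     norm3 (sub3 (shift z (phi x' y')) (shift z (phi x y))) < 3 * r.
Hypothesis Hslit : forall x y, a <= x <= b -> c <= y <= e -> slit s (quad (shift z0 (phi x y))).
Hypothesis Hcu : continuous2_on (fun x y => u (phi x y)) a b c e.
Hypothesis Hcd : continuous2_on (fun x y => d i (phi x y)) a b c e.

(** Compactness of the face makes the pointwise expansions of the kernel uniform. All bounds are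
    written as [/ r], because [rectangle_compact] supplies a single number. *)
Lemma face_uniform : exists r, 0 < r /\ forall x y, a <= x <= b -> c <= y <= e ->
  Cmod (u (phi x y)) <= / r /\ Cmod (d i (phi x y)) <= / r /\
  forall h, norm3 h < r ->
    slit s (quad (shift (add3 z0 h) (phi x y))) /\
    Cmod (newton s (add3 (shift z0 (phi x y)) h) - newton s (shift z0 (phi x y))
      - pairing (fun j => newton_grad s j (shift z0 (phi x y))) h) <= / r * (norm3 h * norm3 h) /\
    Cmod (newton_grad s i (add3 (shift z0 (phi x y)) h) - newton_grad s i (shift z0 (phi x y))
      - pairing (fun j => newton_hess s i j (shift z0 (phi x y))) h) <= / r * (norm3 h * norm3 h).
Proof.
  apply rectangle_compact.
  - intros r r' x y Hr [H1 [H2 H3]].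
    assert (Hi : / r <= / r') by (apply Rinv_le_contravar; lra).
    split; [lra|split; [lra|]]. intros h Hh. destruct (H3 h ltac:(lra)) as [K1 [K2 K3]].
    pose proof (norm3_ge_0 h). assert (/ r * (norm3 h * norm3 h) <= / r' * (norm3 h * norm3 h)).
    { apply Rmult_le_compat_r; [nra|exact Hi]. }
    split; [exact K1|split; lra].
  - intros x y Hx Hy. set (w := shift z0 (phi x y)).
    assert (Hw : slit s (quad w)) by now apply Hslit.
    destruct (C11_newton s Hs w Hw) as [_ [_ [r1 [R1 H1]]]].
    destruct (C11_newton_grad s Hs i w Hw) as [_ [_ [r2 [R2 H2]]]].
    destruct (slit_quad_open s Hs w Hw) as [r3 [R3 H3]].
    destruct (continuous2_bounded _ _ _ (Hcu x y Hx Hy)) as [r4 [R4 H4]].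
    destruct (continuous2_bounded _ _ _ (Hcd x y Hx Hy)) as [r5 [R5 H5]].
    (* Moving along the face displaces the argument by less than [3 * rho], and [h] adds less than
       [rho]; hence the quarters. *)
    set (rho := Rmin (Rmin (r1 / 4) (r2 / 4)) (Rmin (r3 / 4) (Rmin r4 r5))).
    assert (Hrho : rho <= r1 / 4 /\ rho <= r2 / 4 /\ rho <= r3 / 4 /\ rho <= r4 /\ rho <= r5).
    { unfold rho, Rmin. repeat destruct (Rle_dec _ _); lra. }
    assert (Hrho0 : 0 < rho) by (unfold rho; repeat apply Rmin_glb_lt; lra).
    destruct Hrho as [U1 [U2 [U3 [U4 U5]]]]. clearbody rho.
    exists rho. split; [exact Hrho0|]. intros x' y' Hx' Hy'.
    assert (I1 : / r1 <= / rho) by (apply Rinv_le_contravar; lra).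
    assert (I2' : / r2 <= / rho) by (apply Rinv_le_contravar; lra).
    assert (I4 : / r4 <= / rho) by (apply Rinv_le_contravar; lra).
    assert (I5 : / r5 <= / rho) by (apply Rinv_le_contravar; lra).
    pose proof (Hphi z0 rho x y x' y' Hx' Hy') as Hn. fold w in Hn.
    split; [|split].
    + specialize (H4 x' y' ltac:(lra) ltac:(lra)). lra.
    + specialize (H5 x' y' ltac:(lra) ltac:(lra)). lra.
    + intros h Hh. pose proof (norm3_ge_0 h).
      assert (0 <= norm3 h * norm3 h) by nra. split; [|split].
      * apply H3. rewrite shift_add3, add3_sub3. eapply Rle_lt_trans; [apply norm3_triangle|].
        rewrite norm3_opp3. lra.
      * eapply Rle_trans; [apply H1; lra|]. now apply Rmult_le_compat_r.
      * eapply Rle_trans; [apply H2; lra|]. now apply Rmult_le_compat_r.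
Qed.

Lemma green_face_continuous z x y :
  slit s (quad (shift z (phi x y))) -> a <= x <= b -> c <= y <= e ->
  continuous2 (fun x y => green s u d z i (phi x y)) x y.
Proof.
  intros Hsl Hx Hy. unfold green. apply continuous2_minus; apply continuous2_mult.
  - apply continuous2_shift; [intros; now apply Hphi|now apply newton_continuous].
  - now apply Hcd.
  - now apply Hcu.
  - apply continuous2_shift; [intros; now apply Hphi|now apply newton_grad_continuous].
Qed.

(** [L j] is the derivative of the integrand in the j-th coordinate of [z]; its signs are reversed
    because the kernel is evaluated at y - z. Subtracting the linear part under the integral leaves
    the uniformly quadratic error [E]. *)
Lemma green_face_differentiable :
  C3diff (fun z => I2 (fun x y => green s u d z i (phi x y)) a b c e) z0.
Proof.
  destruct face_uniform as [r [Hr H]].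
  set (L := fun j x y => (u (phi x y) * newton_hess s i j (shift z0 (phi x y)) - newton_grad s j (shift z0 (phi x y)) * d i (phi x y))%C).
  exists (fun j => I2 (L j) a b c e), r, ((b - a) * (e - c) * (2 * (/ r * / r))).
  split; [exact Hr|]. intros h Hh. set (n := norm3 h) in *.
  assert (Hn : 0 <= n) by apply norm3_ge_0.
  assert (HL : forall j, continuous2_on (L j) a b c e).
  { intros j x y Hx Hy. unfold L. apply continuous2_minus; apply continuous2_mult.
    - now apply Hcu.
    - apply (continuous2_shift (newton_hess s i j)); [intros; now apply Hphi|apply newton_hess_continuous; auto].
    - apply continuous2_shift; [intros; now apply Hphi|apply newton_grad_continuous; auto].
    - now apply Hcd. }
  assert (HA : continuous2_on (fun x y => green s u d z0 i (phi x y)) a b c e).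
  { intros x y Hx Hy. apply green_face_continuous; auto. }
  assert (HAh : continuous2_on (fun x y => green s u d (add3 z0 h) i (phi x y)) a b c e).
  { intros x y Hx Hy. apply green_face_continuous; auto. now apply H. }
  set (E := fun x y => (green s u d (add3 z0 h) i (phi x y) - green s u d z0 i (phi x y)
     - (coord axis1 h * L axis1 x y + coord axis2 h * L axis2 x y + coord axis3 h * L axis3 x y))%C).
  assert (Hl : continuous2_on (fun x y => coord axis1 h * L axis1 x y + coord axis2 h * L axis2 x y + coord axis3 h * L axis3 x y)%C a b c e).
  { repeat apply continuous2_on_plus; apply continuous2_on_Cmult; apply HL. }
  assert (Hdiff : continuous2_on (fun x y => green s u d (add3 z0 h) i (phi x y) - green s u d z0 i (phi x y))%C a b c e).
  { intros x y Hx Hy. apply continuous2_minus; [now apply HAh|now apply HA]. }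
  match goal with |- Cmod ?X <= _ => replace X with (I2 E a b c e) end.
  - rewrite Rmult_assoc. apply I2_norm; auto.
    + intros x y Hx Hy. apply continuous2_minus; [now apply Hdiff|now apply Hl].
    + intros x y Hx Hy. destruct (H x y Hx Hy) as [B1 [B2 B3]].
      (* Increasing [z] by [h] moves the argument y - z by the opposite of [h]. *)
      destruct (B3 (opp3 h)) as [_ [K1 K2]]; [rewrite norm3_opp3; exact Hh|].
      rewrite norm3_opp3, pairing_opp3, <- shift_add3 in K1, K2. fold n in K1, K2.
      set (w := shift z0 (phi x y)) in *. set (w' := shift (add3 z0 h) (phi x y)) in *.
      set (e1 := (newton s w' - newton s w - - pairing (fun j => newton_grad s j w) h)%C) in *.
      set (e2 := (newton_grad s i w' - newton_grad s i w - - pairing (fun j => newton_hess s i j w) h)%C) in *.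
      replace (E x y) with (e1 * d i (phi x y) + - (u (phi x y) * e2))%C.
      2: { unfold E, green, e1, e2, L, pairing. fold w. fold w'. ring. }
      Ctriangle. rewrite Cmod_opp, !Cmod_mult.
      assert (X1 : Cmod e1 * Cmod (d i (phi x y)) <= (/ r * (n * n)) * / r) by (apply Rmult_le_compat; auto using Cmod_ge_0).
      assert (X2 : Cmod (u (phi x y)) * Cmod e2 <= / r * (/ r * (n * n))) by (apply Rmult_le_compat; auto using Cmod_ge_0).
      lra.
  - unfold E. rewrite I2_minus, I2_minus by assumption.
    rewrite I2_plus, I2_plus by (try assumption; repeat apply continuous2_on_plus; apply continuous2_on_Cmult; apply HL).
    rewrite !I2_Cmult by (try assumption; apply HL). unfold pairing. ring.
Qed.

End Face.

(** * Fluxes through cubes around the origin *)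

Definition in_box (c : R) (y : R3) : Prop :=
  let '(y1, y2, y3) := y in Rabs y1 <= c /\ Rabs y2 <= c /\ Rabs y3 <= c.
Definition in_open_box (c : R) (y : R3) : Prop :=
  let '(y1, y2, y3) := y in Rabs y1 < c /\ Rabs y2 < c /\ Rabs y3 < c.
Definition punctured (x : R3) : Prop := x <> (0, 0, 0).

Lemma punctured_sqr x1 x2 x3 : punctured (x1, x2, x3) -> 0 < x1 * x1 + x2 * x2 + x3 * x3.
Proof.
  intros H. pose proof (Rle_0_sqr x1) as Q1. pose proof (Rle_0_sqr x2) as Q2. pose proof (Rle_0_sqr x3) as Q3.
  unfold Rsqr in *. apply Rnot_le_lt. intros Hle. apply H.
  assert (E1 : x1 = 0) by (apply Rsqr_0_uniq; unfold Rsqr; lra).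
  assert (E2 : x2 = 0) by (apply Rsqr_0_uniq; unfold Rsqr; lra).
  assert (E3 : x3 = 0) by (apply Rsqr_0_uniq; unfold Rsqr; lra).
  now rewrite E1, E2, E3.
Qed.

Lemma punctured_open x y w : punctured (x, y, w) ->
  exists r, 0 < r /\ forall p, near3 r p x y w -> punctured p.
Proof.
  intros H.
  assert (K : forall a b, Rabs (b - a) < Rabs a -> b <> 0).
  { intros a b Hb E. rewrite E, Rminus_0_l, Rabs_Ropp in Hb. lra. }
  destruct (Req_dec x 0) as [Ex|Nx]; [destruct (Req_dec y 0) as [Ey|Ny]; [destruct (Req_dec w 0) as [Ew|Nw]|]|].
  - exfalso. apply H. now rewrite Ex, Ey, Ew.
  - exists (Rabs w). split; [now apply Rabs_pos_lt|].
    intros [[a b] c] [H1 [H2 H3]] E. injection E. intros E3 _ _. now apply (K w c H3).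
  - exists (Rabs y). split; [now apply Rabs_pos_lt|].
    intros [[a b] c] [H1 [H2 H3]] E. injection E. intros _ E2 _. now apply (K y b H2).
  - exists (Rabs x). split; [now apply Rabs_pos_lt|].
    intros [[a b] c] [H1 [H2 H3]] E. injection E. intros _ _ E1. now apply (K x a H1).
Qed.

Lemma not_open_box_punctured c x y w : 0 < c -> ~ in_open_box c (x, y, w) -> punctured (x, y, w).
Proof.
  intros Hc H E. apply H. injection E. intros -> -> ->. simpl. rewrite Rabs_R0. tauto.
Qed.

Section Extension.
Variable s : R.
Hypothesis Hs : s * s = 1.
Variables (u : R3 -> C) (d : axis -> R3 -> C) (dd : axis -> axis -> R3 -> C).
Hypothesis Hu : harmonic_data u d dd punctured.

Definition green_flux (z : C3) : R -> R -> R -> R -> R -> R -> C :=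
  flux (green s u d z axis1) (green s u d z axis2) (green s u d z axis3).
Definition cube_flux (z : C3) (c : R) : C := green_flux z (- c) c (- c) c (- c) c.

(** The slit is avoided on the whole cube, respectively on everything outside the open cube, and not
    just on its surface: the shell between two admissible cubes of the same kind then lies where the
    field is regular, so they have equal flux. *)
Definition good_in (z : C3) (c : R) : Prop :=
  0 < c /\ forall y, in_box c y -> slit s (quad (shift z y)).
Definition good_out (z : C3) (c : R) : Prop :=
  0 < c /\ forall y, ~ in_open_box c y -> slit s (quad (shift z y)).

Lemma green_regular_punctured z x y w :
  punctured (x, y, w) -> slit s (quad (shift z (x, y, w))) ->
  regular (green s u d z axis1) (green s u d z axis2) (green s u d z axis3) x y w.
Proof.
  intros HU Hsl. destruct (punctured_open x y w HU) as [r [Hr H]].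
  now apply (green_regular s Hs u d dd z punctured Hu x y w r).
Qed.

Lemma cube_flux_shell z c c' :
  0 < c -> c <= c' ->
  (forall y, in_box c' y -> ~ in_open_box c y -> slit s (quad (shift z y))) ->
  cube_flux z c' = cube_flux z c.
Proof.
  intros Hc Hcc H. unfold cube_flux, green_flux. apply flux_shell; try lra.
  intros x y w Hx Hy Hw Hn.
  assert (Hn' : ~ in_open_box c (x, y, w)).
  { intros [H1 [H2 H3]]. apply Hn. apply Rabs_lt_between in H1, H2, H3. tauto. }
  apply green_regular_punctured.
  - now apply (not_open_box_punctured c).
  - apply H; [|exact Hn']. repeat split; apply Rabs_le; lra.
Qed.

Lemma cube_flux_in z c c' : good_in z c -> good_in z c' -> cube_flux z c = cube_flux z c'.
Proof.
  intros [Hc H] [Hc' H']. destruct (Rle_dec c c') as [Hl|Hl].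
  - symmetry. apply cube_flux_shell; auto.
  - apply cube_flux_shell; auto. lra.
Qed.

Lemma cube_flux_out z c c' : good_out z c -> good_out z c' -> cube_flux z c = cube_flux z c'.
Proof.
  intros [Hc H] [Hc' H']. destruct (Rle_dec c c') as [Hl|Hl].
  - symmetry. apply cube_flux_shell; auto.
  - apply cube_flux_shell; auto. lra.
Qed.

Definition flux_value (z : C3) (v : C) : Prop :=
  exists e c, good_in z e /\ good_out z c /\ v = (cube_flux z c - cube_flux z e)%C.

(** No pair of cubes serves all [z] at once, so the sizes are chosen point by point; by
    [flux_extension_eq] the value does not depend on them. *)
Definition flux_extension (z : C3) : C := epsilon (inhabits (RtoC 0)) (flux_value z).

Lemma flux_extension_eq z e c :
  good_in z e -> good_out z c -> flux_extension z = (cube_flux z c - cube_flux z e)%C.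
Proof.
  intros He Hc.
  assert (Hex : exists v, flux_value z v) by (eexists; exists e, c; split; [exact He|split; [exact Hc|reflexivity]]).
  destruct (epsilon_spec (inhabits (RtoC 0)) _ Hex) as [e' [c' [He' [Hc' E]]]].
  unfold flux_extension. rewrite E. now rewrite (cube_flux_in z e e'), (cube_flux_out z c c').
Qed.

Lemma slit_of_Re q : 0 < fst q -> slit s q.
Proof.
  intros H. unfold slit.
  assert (Hb : Rabs (snd q) < Cmod q).
  { unfold Cmod. rewrite <- sqrt_Rsqr_abs. apply sqrt_lt_1.
    - apply Rle_0_sqr.
    - apply Rplus_le_le_0_compat; apply pow2_ge_0.
    - unfold Rsqr. nra. }
  assert (Ha : Rabs (s * snd q) < Cmod q) by (rewrite Rabs_mult, (Rabs_s s Hs), Rmult_1_l; exact Hb).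
  apply Rabs_lt_between in Ha. lra.
Qed.

(** The sizes can be kept fixed near a point, where the extension is thus a difference of integrals
    over two fixed surfaces. *)
Lemma good_near z0 : slit s (quad z0) -> exists e c r, 0 < r /\
  forall z, norm3 (sub3 z z0) < r -> good_in z e /\ good_out z c.
Proof.
  intros H.
  assert (H' : slit s (quad (shift z0 (0, 0, 0)))).
  { replace (quad (shift z0 (0, 0, 0))) with (quad z0); [exact H|].
    destruct z0 as [[z1 z2] z3]. unfold quad, shift; simpl. ring. }
  destruct (slit_quad_open s Hs _ H') as [r [Hr Ho]].
  set (N := norm3 z0 + 1). pose proof (norm3_ge_0 z0) as Hn0.
  (* In the small cube [y] contributes at most [3 * (r / 6)] to the displacement and [z] less than
     [r / 2]. Outside the large one some coordinate of y - Re z has modulus at least [2 * N + 1];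
     its square exceeds [4 * (N * N)], while the imaginary parts contribute at most [3 * (N * N)],
     so the real part of q(y - z) is positive. *)
  exists (r / 6), (3 * N + 1), (Rmin 1 (r / 2)). split; [apply Rmin_glb_lt; lra|].
  intros z Hz. pose proof (Rmin_l 1 (r / 2)). pose proof (Rmin_r 1 (r / 2)).
  split; split; try (unfold N; lra).
  - intros y Hy. apply Ho.
    assert (E : norm3 (sub3 (shift z y) (shift z0 (0, 0, 0))) <= norm3 (R3_to_C3 y) + norm3 (sub3 z z0)).
    { replace (sub3 (shift z y) (shift z0 (0, 0, 0))) with (add3 (R3_to_C3 y) (opp3 (sub3 z z0))).
      - eapply Rle_trans; [apply norm3_triangle|]. rewrite norm3_opp3. lra.
      - destruct y as [[y1 y2] y3], z as [[z1 z2] z3], z0 as [[w1 w2] w3]. unfold shift; simpl.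
        triple_ring. }
    assert (E2 : norm3 (R3_to_C3 y) <= 3 * (r / 6)).
    { destruct y as [[y1 y2] y3]. simpl in *. rewrite !Cmod_R. lra. }
    lra.
  - intros y Hy. apply slit_of_Re.
    assert (HN : norm3 z <= N).
    { rewrite <- (add3_sub3_cancel z0 z). eapply Rle_trans; [apply norm3_triangle|]. unfold N; lra. }
    assert (HN0 : 1 <= N) by (unfold N; lra). clearbody N.
    destruct z as [[[x1 n1] [x2 n2]] [x3 n3]], y as [[y1 y2] y3].
    simpl in HN.
    pose proof (Rabs_fst_Cmod (x1, n1)); pose proof (Rabs_fst_Cmod (x2, n2)); pose proof (Rabs_fst_Cmod (x3, n3)).
    pose proof (Rabs_snd_Cmod (x1, n1)); pose proof (Rabs_snd_Cmod (x2, n2)); pose proof (Rabs_snd_Cmod (x3, n3)).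
    pose proof (Cmod_ge_0 (x1, n1)); pose proof (Cmod_ge_0 (x2, n2)); pose proof (Cmod_ge_0 (x3, n3)).
    simpl in *.
    assert (Hsq : forall n, Rabs n <= N -> n * n <= N * N).
    { intros n Hn. rewrite <- (Rabs_pos_eq N) in Hn by lra. apply Rsqr_le_abs_1 in Hn. exact Hn. }
    pose proof (Hsq n1 ltac:(lra)). pose proof (Hsq n2 ltac:(lra)). pose proof (Hsq n3 ltac:(lra)).
    assert (Hbig : forall y x, 3 * N + 1 <= Rabs y -> Rabs x <= N -> 4 * (N * N) < (y - x) * (y - x)).
    { intros y x Hy' Hx'.
      assert (Hyx : 2 * N + 1 <= Rabs (y - x)).
      { pose proof (Rabs_triang_inv y x). lra. }
      replace ((y - x) * (y - x)) with (Rabs (y - x) * Rabs (y - x)) by (rewrite <- Rabs_mult; apply Rabs_pos_eq, Rle_0_sqr).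
      nra. }
    assert (Hor : 3 * N + 1 <= Rabs y1 \/ 3 * N + 1 <= Rabs y2 \/ 3 * N + 1 <= Rabs y3).
    { destruct (Rle_lt_dec (3 * N + 1) (Rabs y1)); [now left|].
      destruct (Rle_lt_dec (3 * N + 1) (Rabs y2)); [now right; left|].
      destruct (Rle_lt_dec (3 * N + 1) (Rabs y3)); [now right; right|]. exfalso; tauto. }
    pose proof (Rle_0_sqr (y1 - x1)) as Q1. pose proof (Rle_0_sqr (y2 - x2)) as Q2. pose proof (Rle_0_sqr (y3 - x3)) as Q3.
    unfold Rsqr in Q1, Q2, Q3.
    match goal with |- 0 < ?X => replace X with ((y1 - x1) * (y1 - x1) + (y2 - x2) * (y2 - x2) + (y3 - x3) * (y3 - x3)
      - (n1 * n1 + n2 * n2 + n3 * n3)) by ring end.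
    destruct Hor as [Hy'|[Hy'|Hy']].
    + pose proof (Hbig y1 x1 Hy' ltac:(lra)). nra.
    + pose proof (Hbig y2 x2 Hy' ltac:(lra)). nra.
    + pose proof (Hbig y3 x3 Hy' ltac:(lra)). nra.
Qed.

Lemma cube_flux_differentiable z c :
  0 < c ->
  (forall y, in_box c y -> ~ in_open_box c y -> slit s (quad (shift z y))) ->
  C3diff (fun z => cube_flux z c) z.
Proof.
  intros Hc H.
  assert (HB : forall x y w, - c <= x <= c -> - c <= y <= c -> - c <= w <= c ->
     (x = c \/ x = - c \/ y = c \/ y = - c \/ w = c \/ w = - c) ->
     slit s (quad (shift z (x, y, w))) /\ punctured (x, y, w)).
  { intros x y w Hx Hy Hw Hor.
    assert (Hn : ~ in_open_box c (x, y, w)).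
    { intros [H1 [H2 H3]]. apply Rabs_lt_between in H1, H2, H3. lra. }
    split.
    - apply H; [|exact Hn]. repeat split; apply Rabs_le; lra.
    - now apply (not_open_box_punctured c). }
  assert (HC : forall x y w, punctured (x, y, w) -> continuous3 u x y w /\ forall i, continuous3 (d i) x y w).
  { intros x y w HU. destruct (Hu _ HU) as [Cu [Cd _]]. split; [now apply continuous3_intro|].
    intros i. apply continuous3_intro. apply Cd. }
  assert (Hsh : forall z x y w x' y' w' r, 0 < r -> Rabs (x' - x) < r -> Rabs (y' - y) < r -> Rabs (w' - w) < r ->
     norm3 (sub3 (shift z (x', y', w')) (shift z (x, y, w))) < 3 * r).
  { intros z' x y w x' y' w' r _ H1 H2 H3. apply shift_near. repeat split; assumption. }
  assert (Hpos : forall a r : R, Rabs a < r -> 0 < r).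
  { intros a r Ha. pose proof (Rabs_pos a). lra. }
  assert (Hz : forall a r : R, 0 < r -> Rabs (a - a) < r) by (intros; rewrite Rminus_diag, Rabs_R0; assumption).
  unfold cube_flux, green_flux, flux.
  assert (F1 : forall t, (t = c \/ t = - c) -> C3diff
    (fun z => I2 (fun x y => green s u d z axis1 (t, x, y)) (- c) c (- c) c) z).
  { intros t Ht. apply (green_face_differentiable s Hs u d axis1 z (fun x y => (t, x, y))); try lra.
    - intros z' r x y x' y' H1 H2. pose proof (Hpos _ _ H1). apply Hsh; auto.
    - intros x y Hx Hy. apply HB; lra.
    - intros x y Hx Hy. apply (continuous3_face1 u), HC, HB; lra.
    - intros x y Hx Hy. apply (continuous3_face1 (d axis1)), HC, HB; lra. }
  assert (F2 : forall t, (t = c \/ t = - c) -> C3diff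
    (fun z => I2 (fun x y => green s u d z axis2 (x, t, y)) (- c) c (- c) c) z).
  { intros t Ht. apply (green_face_differentiable s Hs u d axis2 z (fun x y => (x, t, y))); try lra.
    - intros z' r x y x' y' H1 H2. pose proof (Hpos _ _ H1). apply Hsh; auto.
    - intros x y Hx Hy. apply HB; lra.
    - intros x y Hx Hy. apply (continuous3_face2 u), HC, HB; lra.
    - intros x y Hx Hy. apply (continuous3_face2 (d axis2)), HC, HB; lra. }
  assert (F3 : forall t, (t = c \/ t = - c) -> C3diff
    (fun z => I2 (fun x y => green s u d z axis3 (x, y, t)) (- c) c (- c) c) z).
  { intros t Ht. apply (green_face_differentiable s Hs u d axis3 z (fun x y => (x, y, t))); try lra.
    - intros z' r x y x' y' H1 H2. pose proof (Hpos _ _ H1). apply Hsh; auto.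
    - intros x y Hx Hy. apply HB; lra.
    - intros x y Hx Hy. apply (continuous3_face3 u), HC, HB; lra.
    - intros x y Hx Hy. apply (continuous3_face3 (d axis3)), HC, HB; lra. }
  apply C3diff_plus; [apply C3diff_plus|];
    apply C3diff_minus; auto.
Qed.

Lemma flux_extension_differentiable z : slit s (quad z) -> C3diff flux_extension z.
Proof.
  intros H. destruct (good_near z H) as [e [c [r [Hr Hg]]]].
  apply (C3diff_local (fun z => cube_flux z c - cube_flux z e)%C _ z r Hr).
  - intros x Hx. symmetry. now apply flux_extension_eq; apply Hg.
  - destruct (Hg z) as [[He Hin] [Hc Hout]]; [now rewrite sub3_diag, norm3_0|].
    apply C3diff_minus; apply cube_flux_differentiable; auto.
Qed.

End Extension.

(** * The extension on real points *)

Notation C3_NM := (prod_NormedModule C_AbsRing (prod_NormedModule C_AbsRing C_NormedModule C_NormedModule) C_NormedModule).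

Lemma prod_norm_l (U V : NormedModule C_AbsRing) (p : prod_NormedModule C_AbsRing U V) : norm (fst p) <= norm p.
Proof.
  unfold norm at 2; simpl. unfold prod_norm.
  pose proof (sqrt_plus_sqr (norm (fst p)) (norm (snd p))) as [H _].
  eapply Rle_trans; [|exact H]. eapply Rle_trans; [|apply Rmax_l]. apply Rle_abs.
Qed.

Lemma prod_norm_r (U V : NormedModule C_AbsRing) (p : prod_NormedModule C_AbsRing U V) : norm (snd p) <= norm p.
Proof.
  unfold norm at 2; simpl. unfold prod_norm.
  pose proof (sqrt_plus_sqr (norm (fst p)) (norm (snd p))) as [H _].
  eapply Rle_trans; [|exact H]. eapply Rle_trans; [|apply Rmax_r]. apply Rle_abs.
Qed.

Lemma norm3_le_norm (h : C3) : norm3 h <= 3 * norm (V := C3_NM) h.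
Proof.
  destruct h as [[h1 h2] h3].
  pose proof (prod_norm_r _ _ ((h1, h2, h3) : C3_NM)) as N3.
  pose proof (prod_norm_l _ _ ((h1, h2, h3) : C3_NM)) as N12.
  pose proof (prod_norm_l _ _ ((h1, h2) : prod_NormedModule C_AbsRing C_NormedModule C_NormedModule)) as N1.
  pose proof (prod_norm_r _ _ ((h1, h2) : prod_NormedModule C_AbsRing C_NormedModule C_NormedModule)) as N2.
  simpl fst in *; simpl snd in *.
  change (norm (V := C_NormedModule) h1) with (Cmod h1) in N1.
  change (norm (V := C_NormedModule) h2) with (Cmod h2) in N2.
  change (norm (V := C_NormedModule) h3) with (Cmod h3) in N3.
  unfold norm3. lra.
Qed.

Lemma C3diff_filterdiff (F : C3 -> C) (z : C3) :
  C3diff F z -> ex_filterdiff (K := C_AbsRing) (U := C3_NM) (V := C_NormedModule) F (locally z).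
Proof.
  intros [l [r [M [Hr H]]]]. exists (pairing l). split.
  - split.
    + intros x y. destruct x as [[x1 x2] x3], y as [[y1 y2] y3]. unfold plus; simpl. unfold prod_plus, pairing; simpl.
      unfold plus; simpl. Cring.
    + intros k x. destruct x as [[x1 x2] x3]. unfold scal; simpl. unfold prod_scal, pairing; simpl.
      unfold scal; simpl. unfold mult; simpl. Cring.
    + set (B := Cmod (l axis1) + Cmod (l axis2) + Cmod (l axis3) + 1).
      pose proof (Cmod_ge_0 (l axis1)); pose proof (Cmod_ge_0 (l axis2)); pose proof (Cmod_ge_0 (l axis3)).
      exists (B * 3). split; [unfold B; lra|]. intros x.
      change (norm (V := C_NormedModule) (pairing l x)) with (Cmod (pairing l x)).
      eapply Rle_trans; [apply (Cmod_pairing l x B)|].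
      * intros i; unfold B; destruct i; lra.
      * rewrite Rmult_assoc. apply Rmult_le_compat_l; [unfold B; lra|apply norm3_le_norm].
  - intros x Hx. rewrite <- (is_filter_lim_locally_unique (V := C3_NM) z x Hx). clear x Hx.
    intros eps.
    set (M' := Rabs M + 1). assert (HM : 0 < M') by (unfold M'; pose proof (Rabs_pos M); lra).
    set (e := Rmin r (eps / (3 * M'))).
    assert (He1 : 0 < eps / (3 * M')) by (apply Rdiv_lt_0_compat; [apply cond_pos|lra]).
    (* Three coordinates, each of modulus less than twice the radius of the ball. *)
    assert (He : 0 < e / 6) by (unfold e; pose proof (Rmin_glb_lt _ _ _ Hr He1); lra).
    exists (mkposreal _ He). intros y Hy.
    destruct y as [[y1 y2] y3], z as [[z1 z2] z3].
    set (y := (y1, y2, y3) : C3) in *. set (z := (z1, z2, z3) : C3) in *.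
    set (h := sub3 y z).
    assert (Hh : norm3 h < e).
    { unfold h. destruct Hy as [[H1 H2] H3]. simpl in H1, H2, H3.
      apply ball_C_Cmod in H1, H2, H3. simpl. lra. }
    change (minus y z : C3) with h.
    change (Cmod (F y - F z - pairing l h) <= eps * norm (V := C3_NM) h).
    specialize (H h ltac:(eapply Rlt_le_trans; [exact Hh|apply Rmin_l])).
    unfold h in H at 1. rewrite add3_sub3_cancel in H.
    pose proof (norm3_ge_0 h) as Hn. pose proof (norm3_le_norm h) as Hle.
    assert (Hm : M * (norm3 h * norm3 h) <= M' * (norm3 h * norm3 h)).
    { apply Rmult_le_compat_r; [nra|]. unfold M'. pose proof (Rle_abs M). lra. }
    assert (Hm2 : M' * norm3 h <= eps / 3).
    { apply Rle_trans with (M' * (eps / (3 * M'))); [|right; field; lra].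
      apply Rmult_le_compat_l; [lra|]. apply Rlt_le. eapply Rlt_le_trans; [exact Hh|apply Rmin_r]. }
    assert (Hm3 : M' * norm3 h * norm3 h <= eps / 3 * norm3 h) by (apply Rmult_le_compat_r; assumption).
    assert (Hm4 : eps / 3 * norm3 h <= eps / 3 * (3 * norm (V := C3_NM) h)).
    { apply Rmult_le_compat_l; [|exact Hle]. pose proof (cond_pos eps). lra. }
    lra.
Qed.

(** * The solid angle of a face of a cube *)

Definition cube_weight (a b : R) : R := sqrt (1 + a * a + b * b).
(** The integrand is the normal component of w / |w|^3 at the point (1, a, b), so the value is the
    solid angle of a face of [-1, 1]^3 seen from the centre, one sixth of 4 pi. *)
Definition solid_angle_face : C :=
  I2 (fun a b => RtoC (/ (cube_weight a b * (cube_weight a b * cube_weight a b)))) (-1) 1 (-1) 1.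

Lemma cube_weight_ge_1 a b : 1 <= cube_weight a b.
Proof. unfold cube_weight. rewrite <- sqrt_1 at 1. apply sqrt_le_1_alt. nra. Qed.

Lemma cube_weight_sqr a b : cube_weight a b * cube_weight a b = 1 + a * a + b * b.
Proof. apply sqrt_sqrt. nra. Qed.

Lemma cube_weight_inv_bound a b :
  0 <= / (cube_weight a b * (cube_weight a b * cube_weight a b)) <= 1.
Proof.
  pose proof (cube_weight_ge_1 a b) as H.
  assert (H3 : 1 <= cube_weight a b * (cube_weight a b * cube_weight a b)).
  { assert (1 <= cube_weight a b * cube_weight a b) by nra. nra. }
  split; [apply Rlt_le, Rinv_0_lt_compat; lra|].
  rewrite <- Rinv_1. apply Rinv_le_contravar; lra.
Qed.

Lemma solid_angle_integrand_continuous :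
  continuous2_on (fun a b => RtoC (/ (cube_weight a b * (cube_weight a b * cube_weight a b)))) (-1) 1 (-1) 1.
Proof.
  intros a b _ _. apply continuous2_intro.
  apply (continuous_RtoC (T := R2_US)
    (fun p => / (cube_weight (fst p) (snd p) * (cube_weight (fst p) (snd p) * cube_weight (fst p) (snd p))))).
  apply (continuous_comp (U := R2_US) (V := R_UniformSpace) (W := R_UniformSpace)
    (fun p => 1 + fst p * fst p + snd p * snd p) (fun q => / (sqrt q * (sqrt q * sqrt q)))).
  - repeat apply (continuous_plus (U := R2_US) (V := R_NormedModule)).
    + apply continuous_const.
    + apply (continuous_mult (K := R_AbsRing) (U := R2_US)
        (fun p => fst p) (fun p => fst p)); apply continuous_fst.
    + apply (continuous_mult (K := R_AbsRing) (U := R2_US)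
        (fun p => snd p) (fun p => snd p)); apply continuous_snd.
  - simpl. apply (continuous_comp (fun q => sqrt q * (sqrt q * sqrt q)) Rinv).
    + apply (continuous_mult (fun q => sqrt q) (fun q => sqrt q * sqrt q)); [apply continuous_sqrt|].
      apply (continuous_mult (fun q => sqrt q) (fun q => sqrt q)); apply continuous_sqrt.
    + apply continuous_Rinv.
      assert (0 < sqrt (1 + a * a + b * b)) by (apply sqrt_lt_R0; nra).
      apply Rgt_not_eq. repeat apply Rmult_lt_0_compat; assumption.
Qed.

(** The integrand stays within 0.41 of 0.6: it is at most 1, and at least 1/5.22 because the cube of
    the weight is at most 3 times 1.74, where 1.74 exceeds the square root of 3. Over a square of
    area 4 this keeps the integral away from 0. *)
Lemma solid_angle_face_neq_0 : solid_angle_face <> 0%C.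
Proof.
  assert (H : Cmod (solid_angle_face - RtoC ((1 - -1) * (1 - -1)) * RtoC 0.6) <= (1 - -1) * (1 - -1) * 0.41).
  { apply I2_norm_const; try lra; [apply solid_angle_integrand_continuous|].
    intros a b Ha Hb. rewrite <- RtoC_minus, Cmod_R.
    pose proof (cube_weight_ge_1 a b) as H1. pose proof (cube_weight_sqr a b) as H2.
    pose proof (cube_weight_inv_bound a b) as H4.
    assert (Hm : cube_weight a b <= 1.74) by nra.
    assert (H5 : cube_weight a b * (cube_weight a b * cube_weight a b) <= 5.22).
    { rewrite H2. assert (1 + a * a + b * b <= 3) by nra. nra. }
    assert (H6 : / 5.22 <= / (cube_weight a b * (cube_weight a b * cube_weight a b))).
    { apply Rinv_le_contravar; [|exact H5]. repeat apply Rmult_lt_0_compat; lra. }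
    apply Rabs_le. lra. }
  intros E. rewrite E in H. rewrite <- RtoC_mult in H.
  replace (0 - RtoC ((1 - -1) * (1 - -1) * 0.6))%C with (- RtoC ((1 - -1) * (1 - -1) * 0.6))%C in H by ring.
  rewrite Cmod_opp, Cmod_R, Rabs_pos_eq in H; lra.
Qed.

(** * The flux around a real point *)

Section Representation.
Variable s : R.
Hypothesis Hs : s * s = 1.
Variables (u : R3 -> C) (d : axis -> R3 -> C) (dd : axis -> axis -> R3 -> C).
Hypothesis Hu : harmonic_data u d dd punctured.

Lemma newton_real w r : 0 < r -> quad w = RtoC (r * r) -> newton s w = (/ RtoC r)%C.
Proof.
  intros Hr E. unfold newton. rewrite E, RtoC_mult, (root_sqr s Hs); [reflexivity|].
  unfold half_plane; simpl. lra.
Qed.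

(** [psi] parametrizes the plane of a face at distance [delta] from the singularity, and [sg] is the
    sign of its outward normal. After rescaling by [delta], the area factor [delta * delta] leaves
    the term with [d i] of size [delta], and turns the term with the gradient of the kernel into [u]
    divided by the cube of the weight, with no power of [delta]. The 4 is the area of the square. *)
Lemma face_limit i (z : C3) (psi : R -> R -> R3) (p q sg delta D eta : R) (k : C) :
  0 < delta -> sg * sg = 1 ->
  (forall a b, quad (shift z (psi (delta * a + p) (delta * b + q))) = RtoC (delta * delta * (1 + a * a + b * b))) ->
  (forall a b, coord i (shift z (psi a b)) = RtoC (sg * delta)) ->
  (forall a b, Rabs (a - p) <= delta -> Rabs (b - q) <= delta ->
     Cmod (d i (psi a b)) <= D /\ Cmod (u (psi a b) - k) <= eta /\
     continuous2 (fun a b => green s u d z i (psi a b)) a b) ->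
  Cmod (RtoC sg * I2 (fun a b => green s u d z i (psi a b)) (p - delta) (p + delta) (q - delta) (q + delta)
    - solid_angle_face * k) <= 4 * (delta * D + eta).
Proof.
  intros Hd Hsg Hq0 Hc0 Hpsi.
  set (phi := fun a b => psi (delta * a + p) (delta * b + q)).
  assert (Hab : forall a v, -1 <= a <= 1 -> Rabs (delta * a + v - v) <= delta).
  { intros a v Ha. replace (delta * a + v - v) with (delta * a) by ring. apply Rabs_le. nra. }
  assert (Hb : forall a b, -1 <= a <= 1 -> -1 <= b <= 1 -> Cmod (d i (phi a b)) <= D /\ Cmod (u (phi a b) - k) <= eta).
  { intros a b Ha Hb. destruct (Hpsi (delta * a + p) (delta * b + q)) as [K1 [K2 _]]; auto. }
  assert (Hc : forall a b, coord i (shift z (phi a b)) = RtoC (sg * delta)) by (intros; apply Hc0).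
  assert (Hq : forall a b, quad (shift z (phi a b)) = RtoC (delta * delta * (1 + a * a + b * b))) by exact Hq0.
  assert (Hg : continuous2_on (fun a b => green s u d z i (phi a b)) (-1) 1 (-1) 1).
  { intros a b Ha Hb'. apply (continuous2_affine (fun a b => green s u d z i (psi a b))); [exact Hd|].
    apply Hpsi; auto. }
  rewrite (I2_scale (fun a b => green s u d z i (psi a b)) p q delta Hd).
  2: { intros a b Ha Hb'. apply Hpsi; apply Rabs_le; lra. }
  change (fun a b => green s u d z i (psi (delta * a + p) (delta * b + q))) with (fun a b => green s u d z i (phi a b)).
  set (W := fun a b => RtoC (/ (cube_weight a b * (cube_weight a b * cube_weight a b)))).
  assert (HW : continuous2_on W (-1) 1 (-1) 1) by apply solid_angle_integrand_continuous.
  rewrite <- I2_Cmult by (try exact Hg; lra).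
  rewrite <- I2_Cmult; try lra; [|now apply continuous2_on_Cmult; try lra].
  unfold solid_angle_face. fold W. rewrite (Cmult_comm _ k), <- I2_Cmult by (try exact HW; lra).
  rewrite <- I2_minus; try lra.
  3: now apply continuous2_on_Cmult; try lra.
  2: now apply continuous2_on_Cmult; try lra; apply continuous2_on_Cmult.
  eapply Rle_trans; [apply (I2_norm (-1) 1 (-1) 1 ltac:(lra) ltac:(lra) _ (delta * D + eta))|].
  - intros a b Ha Hb'. apply continuous2_minus.
    + now apply (continuous2_on_Cmult (-1) 1 (-1) 1); try lra; apply continuous2_on_Cmult.
    + now apply (continuous2_on_Cmult (-1) 1 (-1) 1); try lra.
  - intros a b Ha Hb'. destruct (Hb a b Ha Hb') as [B1 B2].
    pose proof (cube_weight_ge_1 a b) as Hm1. pose proof (cube_weight_inv_bound a b) as Hm3.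
    assert (HT : newton s (shift z (phi a b)) = (/ RtoC (delta * cube_weight a b))%C).
    { apply newton_real; [apply Rmult_lt_0_compat; lra|]. rewrite Hq. f_equal.
      rewrite <- cube_weight_sqr. ring. }
    set (m := cube_weight a b) in *.
    assert (Hm0 : RtoC m <> 0%C) by (intros E; apply RtoC_inj in E; lra).
    assert (Hd0 : RtoC delta <> 0%C) by (intros E; apply RtoC_inj in E; lra).
    unfold green, newton_grad. rewrite HT, Hc.
    match goal with |- Cmod ?X <= _ => replace X with
      (RtoC sg * (RtoC delta * (/ RtoC m * d i (phi a b))) + RtoC (/ (m * (m * m))) * (u (phi a b) - k))%C end.
    2: { unfold W. fold m. rewrite !RtoC_inv, !RtoC_mult by (try apply Rgt_not_eq; nra).
         transitivity (RtoC sg * (RtoC delta * (/ RtoC m * d i (phi a b))) + / (RtoC m * (RtoC m * RtoC m)) * (RtoC (sg * sg) * u (phi a b) - k))%C.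
         - rewrite Hsg. ring.
         - rewrite RtoC_mult. field. split; assumption. }
    Ctriangle. rewrite !Cmod_mult, !Cmod_R, Cmod_inv, Cmod_R by assumption.
    assert (Rabs sg = 1).
    { assert (Rabs sg * Rabs sg = 1) by (rewrite <- Rabs_mult, Hsg; apply Rabs_R1). pose proof (Rabs_pos sg). nra. }
    rewrite H, (Rabs_pos_eq delta), (Rabs_pos_eq m), (Rabs_pos_eq (/ _)) by lra.
    assert (Hmi : 0 <= / m <= 1).
    { split; [apply Rlt_le, Rinv_0_lt_compat; lra|]. rewrite <- Rinv_1. apply Rinv_le_contravar; lra. }
    pose proof (Cmod_ge_0 (d i (phi a b))). pose proof (Cmod_ge_0 (u (phi a b) - k)).
    assert (X1 : / m * Cmod (d i (phi a b)) <= 1 * D) by (apply Rmult_le_compat; lra).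
    assert (X2 : / (m * (m * m)) * Cmod (u (phi a b) - k) <= 1 * eta) by (apply Rmult_le_compat; lra).
    apply (Rmult_le_compat_l delta) in X1; lra.
  - lra.
Qed.

Lemma quad_shift_real x1 x2 x3 y1 y2 y3 :
  quad (shift (R3_to_C3 (x1, x2, x3)) (y1, y2, y3)) =
  RtoC ((y1 - x1) * (y1 - x1) + (y2 - x2) * (y2 - x2) + (y3 - x3) * (y3 - x3)).
Proof. unfold quad, shift; simpl. rewrite !RtoC_plus, !RtoC_mult, !RtoC_minus. ring. Qed.

Lemma slit_shift_real x y : x <> y -> slit s (quad (shift (R3_to_C3 x) y)).
Proof.
  intros H. destruct x as [[x1 x2] x3], y as [[y1 y2] y3]. rewrite quad_shift_real.
  apply slit_of_Re; [exact Hs|]. apply punctured_sqr.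
  intros E. injection E. intros E3 E2 E1. apply H.
  replace y1 with x1 by lra. replace y2 with x2 by lra. now replace y3 with x3 by lra.
Qed.

Lemma green_regular_real x y1 y2 y3 :
  punctured (y1, y2, y3) -> x <> (y1, y2, y3) ->
  regular (green s u d (R3_to_C3 x) axis1) (green s u d (R3_to_C3 x) axis2) (green s u d (R3_to_C3 x) axis3) y1 y2 y3.
Proof.
  intros HU Hx. apply (green_regular_punctured s Hs u d dd Hu); [exact HU|]. now apply slit_shift_real.
Qed.

(* Cutting the large cube by a plane separating [0] from [x] leaves two boxes,
   each of which shrinks onto its only singularity. *)
Lemma cube_flux_cut x1 x2 x3 : punctured (x1, x2, x3) ->
  exists e c r, 0 < r /\ good_in s (R3_to_C3 (x1, x2, x3)) e /\ good_out s (R3_to_C3 (x1, x2, x3)) c /\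
  forall delta, 0 < delta < r ->
    (cube_flux s u d (R3_to_C3 (x1, x2, x3)) c - cube_flux s u d (R3_to_C3 (x1, x2, x3)) e)%C =
    green_flux s u d (R3_to_C3 (x1, x2, x3)) (x1 - delta) (x1 + delta) (x2 - delta) (x2 + delta) (x3 - delta) (x3 + delta).
Proof.
  intros HU. set (x := (x1, x2, x3)) in *.
  pose proof (Rabs_pos x1) as P1. pose proof (Rabs_pos x2) as P2. pose proof (Rabs_pos x3) as P3.
  assert (Hex : exists m, 0 < m /\ (m = Rabs x1 \/ m = Rabs x2 \/ m = Rabs x3)).
  { destruct (Req_dec x1 0) as [E1|N1]; [|exists (Rabs x1); split; [now apply Rabs_pos_lt|tauto]].
    destruct (Req_dec x2 0) as [E2|N2]; [|exists (Rabs x2); split; [now apply Rabs_pos_lt|tauto]].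
    destruct (Req_dec x3 0) as [E3|N3]; [|exists (Rabs x3); split; [now apply Rabs_pos_lt|tauto]].
    exfalso. apply HU. unfold x. now rewrite E1, E2, E3. }
  destruct Hex as [m [Hm Hor]].
  set (c := Rabs x1 + Rabs x2 + Rabs x3 + 2).
  assert (B : forall y, Rabs y <= c - 2 -> - c + 2 <= y <= c - 2).
  { intros y Hy. pose proof (Rle_abs y). pose proof (Rabs_maj2 y). lra. }
  pose proof (B x1 ltac:(unfold c; lra)) as B1. pose proof (B x2 ltac:(unfold c; lra)) as B2.
  pose proof (B x3 ltac:(unfold c; lra)) as B3.
  assert (Hmc : m <= c - 2) by (unfold c; lra).
  (* The cut is made at half of a coordinate of [x] of modulus [m], so cubes of half side at most
     [m / 4] about 0 and about [x] stay on their own sides; [delta < 1] keeps the latter inside the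
     large cube. *)
  exists (m / 4), c, (Rmin 1 (m / 4)). split; [apply Rmin_glb_lt; lra|].
  split; [|split].
  - split; [lra|]. intros [[y1 y2] y3] [H1 [H2 H3]]. apply slit_shift_real. unfold x. intros E.
    injection E. intros -> -> ->. lra.
  - split; [lra|]. intros [[y1 y2] y3] Hy. apply slit_shift_real. unfold x. intros E.
    apply Hy. injection E. intros <- <- <-. simpl. unfold c. lra.
  - intros delta Hd. pose proof (Rmin_l 1 (m / 4)). pose proof (Rmin_r 1 (m / 4)).
    set (z := R3_to_C3 x).
    assert (Hreg : forall y1 y2 y3, ~ (y1 = 0 /\ y2 = 0 /\ y3 = 0) -> ~ (y1 = x1 /\ y2 = x2 /\ y3 = x3) ->
      regular (green s u d z axis1) (green s u d z axis2) (green s u d z axis3) y1 y2 y3).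
    { intros y1 y2 y3 N0 Nx. apply green_regular_real.
      - intros E. injection E. intros -> -> ->. apply N0; tauto.
      - unfold x. intros E. injection E. intros -> -> ->. apply Nx; tauto. }
    assert (Hcont : forall y1 y2 y3, ~ (y1 = 0 /\ y2 = 0 /\ y3 = 0) -> ~ (y1 = x1 /\ y2 = x2 /\ y3 = x3) ->
      continuous3 (green s u d z axis1) y1 y2 y3 /\ continuous3 (green s u d z axis2) y1 y2 y3 /\
      continuous3 (green s u d z axis3) y1 y2 y3).
    { intros y1 y2 y3 N0 Nx. destruct (Hreg y1 y2 y3 N0 Nx) as [R1 [R2 [R3 _]]]. tauto. }
    assert (Hshell0 : forall a1 b1 a2 b2 a3 b3,
      a1 <= - (m / 4) -> m / 4 <= b1 -> a2 <= - (m / 4) -> m / 4 <= b2 -> a3 <= - (m / 4) -> m / 4 <= b3 ->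
      ~ (a1 <= x1 <= b1 /\ a2 <= x2 <= b2 /\ a3 <= x3 <= b3) ->
      green_flux s u d z a1 b1 a2 b2 a3 b3 = cube_flux s u d z (m / 4)).
    { intros a1 b1 a2 b2 a3 b3 L1 L2 L3 L4 L5 L6 Hn. unfold cube_flux, green_flux. apply flux_shell; try lra.
      intros y1 y2 y3 Y1 Y2 Y3 Hny. apply Hreg.
      - intros [-> [-> ->]]. lra.
      - intros [-> [-> ->]]. apply Hn; tauto. }
    assert (Hshellx : forall a1 b1 a2 b2 a3 b3,
      a1 <= x1 - delta -> x1 + delta <= b1 -> a2 <= x2 - delta -> x2 + delta <= b2 -> a3 <= x3 - delta -> x3 + delta <= b3 ->
      ~ (a1 <= 0 <= b1 /\ a2 <= 0 <= b2 /\ a3 <= 0 <= b3) ->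
      green_flux s u d z a1 b1 a2 b2 a3 b3 =
      green_flux s u d z (x1 - delta) (x1 + delta) (x2 - delta) (x2 + delta) (x3 - delta) (x3 + delta)).
    { intros a1 b1 a2 b2 a3 b3 L1 L2 L3 L4 L5 L6 Hn. unfold green_flux. apply flux_shell; try lra.
      intros y1 y2 y3 Y1 Y2 Y3 Hny. apply Hreg.
      - intros [-> [-> ->]]. apply Hn; tauto.
      - intros [-> [-> ->]]. lra. }
    assert (Hsgn : forall y, m = Rabs y -> y = m \/ y = - m).
    { intros y ->. unfold Rabs. destruct (Rcase_abs y); lra. }
    unfold cube_flux at 1.
    destruct Hor as [E|[E|E]]; apply Hsgn in E.
    + assert (Hsplit : forall t, t = m / 2 \/ t = - (m / 2) -> x1 = 2 * t ->
        green_flux s u d z (- c) c (- c) c (- c) c =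
        (green_flux s u d z (- c) t (- c) c (- c) c + green_flux s u d z t c (- c) c (- c) c)%C).
      { intros t Ht Ex. apply flux_split_1; try lra; intros; split; apply Hcont; lra. }
      destruct E as [E|E].
      * rewrite (Hsplit (m / 2)), (Hshell0 (- c) (m / 2)), (Hshellx (m / 2) c) by lra. ring.
      * rewrite (Hsplit (- (m / 2))), (Hshell0 (- (m / 2)) c), (Hshellx (- c) (- (m / 2))) by lra. ring.
    + assert (Hsplit : forall t, t = m / 2 \/ t = - (m / 2) -> x2 = 2 * t ->
        green_flux s u d z (- c) c (- c) c (- c) c =
        (green_flux s u d z (- c) c (- c) t (- c) c + green_flux s u d z (- c) c t c (- c) c)%C).
      { intros t Ht Ex. apply flux_split_2; try lra; intros; split; apply Hcont; lra. }
      destruct E as [E|E].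
      * rewrite (Hsplit (m / 2)), (Hshell0 (- c) c (- c) (m / 2)), (Hshellx (- c) c (m / 2) c) by lra. ring.
      * rewrite (Hsplit (- (m / 2))), (Hshell0 (- c) c (- (m / 2)) c), (Hshellx (- c) c (- c) (- (m / 2))) by lra. ring.
    + assert (Hsplit : forall t, t = m / 2 \/ t = - (m / 2) -> x3 = 2 * t ->
        green_flux s u d z (- c) c (- c) c (- c) c =
        (green_flux s u d z (- c) c (- c) c (- c) t + green_flux s u d z (- c) c (- c) c t c)%C).
      { intros t Ht Ex. apply flux_split_3; try lra; intros; split; apply Hcont; lra. }
      destruct E as [E|E].
      * rewrite (Hsplit (m / 2)), (Hshell0 (- c) c (- c) c (- c) (m / 2)), (Hshellx (- c) c (- c) c (m / 2) c) by lra. ring.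
      * rewrite (Hsplit (- (m / 2))), (Hshell0 (- c) c (- c) c (- (m / 2)) c), (Hshellx (- c) c (- c) c (- c) (- (m / 2))) by lra. ring.
Qed.

Lemma green_flux_limit x1 x2 x3 : punctured (x1, x2, x3) ->
  forall eps, 0 < eps -> exists r, 0 < r /\ forall delta, 0 < delta < r ->
    Cmod (green_flux s u d (R3_to_C3 (x1, x2, x3)) (x1 - delta) (x1 + delta) (x2 - delta) (x2 + delta) (x3 - delta) (x3 + delta)
      - 6 * solid_angle_face * u (x1, x2, x3)) <= eps.
Proof.
  intros HU eps He.
  destruct (Hu _ HU) as [Cu [Cd _]].
  destruct (punctured_open x1 x2 x3 HU) as [r0 [R0 H0]].
  (* Six faces, each with the error [4 * (eps / 48 + eps / 48)] from [face_limit]. *)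
  assert (He48 : 0 < eps / 48) by lra.
  destruct (proj1 (continuous3_iff u x1 x2 x3) (continuous3_intro u _ _ _ Cu) _ He48) as [r1 [R1 H1]].
  assert (Hdi : forall i, exists r, 0 < r /\ forall y1 y2 y3,
    Rabs (y1 - x1) < r -> Rabs (y2 - x2) < r -> Rabs (y3 - x3) < r ->
    Cmod (d i (y1, y2, y3)) <= Cmod (d i (x1, x2, x3)) + 1).
  { intros i.
    destruct (proj1 (continuous3_iff (d i) x1 x2 x3) (continuous3_intro _ _ _ _ (proj2 (Cd i))) 1 Rlt_0_1) as [r [Hr H]].
    exists r; split; [exact Hr|]. intros y1 y2 y3 Y1 Y2 Y3. specialize (H y1 y2 y3 Y1 Y2 Y3).
    replace (d i (y1, y2, y3)) with ((d i (y1, y2, y3) - d i (x1, x2, x3)) + d i (x1, x2, x3))%C by ring.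
    Ctriangle. lra. }
  destruct (Hdi axis1) as [r2 [R2 H2]], (Hdi axis2) as [r3 [R3 H3]], (Hdi axis3) as [r4 [R4 H4]].
  set (D := Cmod (d axis1 (x1, x2, x3)) + Cmod (d axis2 (x1, x2, x3)) + Cmod (d axis3 (x1, x2, x3)) + 1).
  pose proof (Cmod_ge_0 (d axis1 (x1, x2, x3))). pose proof (Cmod_ge_0 (d axis2 (x1, x2, x3))). pose proof (Cmod_ge_0 (d axis3 (x1, x2, x3))).
  assert (HD : 0 < D) by (unfold D; lra).
  set (rho := Rmin (Rmin r0 (Rmin r1 r2)) (Rmin (Rmin r3 r4) (eps / (48 * D)))).
  assert (HeD : 0 < eps / (48 * D)) by (apply Rdiv_lt_0_compat; lra).
  assert (Hrho : rho <= r0 /\ rho <= r1 /\ rho <= r2 /\ rho <= r3 /\ rho <= r4 /\ rho <= eps / (48 * D)).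
  { unfold rho, Rmin. repeat destruct (Rle_dec _ _); lra. }
  exists rho. split; [unfold rho; repeat apply Rmin_glb_lt; lra|].
  destruct Hrho as [U0 [U1 [U2 [U3 [U4 U5]]]]]. clearbody rho.
  intros delta Hd.
  assert (HdD : delta * D <= eps / 48).
  { apply Rle_trans with (eps / (48 * D) * D); [apply Rmult_le_compat_r; lra|]. right; field; lra. }
  set (x := (x1, x2, x3)) in *. set (z := R3_to_C3 x).
  assert (Hnear : forall y1 y2 y3, Rabs (y1 - x1) <= delta -> Rabs (y2 - x2) <= delta -> Rabs (y3 - x3) <= delta ->
     (forall i, Cmod (d i (y1, y2, y3)) <= D) /\ Cmod (u (y1, y2, y3) - u x) <= eps / 48 /\ punctured (y1, y2, y3)).
  { intros y1 y2 y3 Y1 Y2 Y3. split; [|split].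
    - specialize (H2 y1 y2 y3 ltac:(lra) ltac:(lra) ltac:(lra)). specialize (H3 y1 y2 y3 ltac:(lra) ltac:(lra) ltac:(lra)).
      specialize (H4 y1 y2 y3 ltac:(lra) ltac:(lra) ltac:(lra)). fold x in H2, H3, H4.
      intros i; unfold D; destruct i; lra.
    - apply Rlt_le, H1; lra.
    - apply H0. repeat split; lra. }
  assert (Hpt : forall sg p, sg * sg = 1 -> Rabs (p + sg * delta - p) <= delta).
  { intros sg p Hsg. replace (p + sg * delta - p) with (sg * delta) by ring.
    rewrite Rabs_mult. assert (Rabs sg * Rabs sg = 1) by (rewrite <- Rabs_mult, Hsg; apply Rabs_R1).
    pose proof (Rabs_pos sg). rewrite (Rabs_pos_eq delta) by lra. nra. }
  assert (Hne : forall sg p, sg * sg = 1 -> p <> p + sg * delta).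
  { intros sg p Hsg E. assert (E5 : sg * delta = 0) by lra.
    apply Rmult_integral in E5. destruct E5 as [E5|E5]; [|lra]. rewrite E5 in Hsg. lra. }
  assert (Hcont : forall y1 y2 y3, Rabs (y1 - x1) <= delta -> Rabs (y2 - x2) <= delta -> Rabs (y3 - x3) <= delta ->
      x <> (y1, y2, y3) ->
      continuous3 (green s u d z axis1) y1 y2 y3 /\ continuous3 (green s u d z axis2) y1 y2 y3 /\
      continuous3 (green s u d z axis3) y1 y2 y3).
  { intros y1 y2 y3 Y1 Y2 Y3 Hx. destruct (green_regular_real x y1 y2 y3) as [K1 [K2 [K3 _]]]; [now apply Hnear|exact Hx|tauto]. }
  assert (Q : forall sg, sg * sg = 1 -> forall a b, (sg * delta) * (sg * delta) + (delta * a) * (delta * a) + (delta * b) * (delta * b)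
     = delta * delta * (1 + a * a + b * b)).
  { intros sg Hsg a b. replace (sg * delta * (sg * delta)) with ((sg * sg) * (delta * delta)) by ring. rewrite Hsg. ring. }
  assert (F1 : forall sg, sg * sg = 1 ->
    Cmod (RtoC sg * I2 (fun y w => green s u d z axis1 (x1 + sg * delta, y, w)) (x2 - delta) (x2 + delta) (x3 - delta) (x3 + delta)
      - solid_angle_face * u x) <= eps / 6).
  { intros sg Hsg. eapply Rle_trans; [apply (face_limit axis1 z (fun y w => (x1 + sg * delta, y, w)) x2 x3 sg delta D (eps / 48))|]; try lra.
    - intros a b. unfold z, x. rewrite quad_shift_real. f_equal. rewrite <- (Q sg Hsg). ring.
    - intros a b. unfold z, x, shift; simpl. rewrite RtoC_plus. ring.
    - intros y w Hy Hw. destruct (Hnear (x1 + sg * delta) (y) (w)) as [K1 [K2 _]]; auto.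
      split; [apply K1|split; [exact K2|]]. apply (continuous3_face1 (green s u d z axis1)). apply Hcont; auto.
      unfold x. intros E. injection E. intros E3 E2 E1. now apply (Hne sg x1). }
  assert (F2 : forall sg, sg * sg = 1 ->
    Cmod (RtoC sg * I2 (fun y w => green s u d z axis2 (y, x2 + sg * delta, w)) (x1 - delta) (x1 + delta) (x3 - delta) (x3 + delta)
      - solid_angle_face * u x) <= eps / 6).
  { intros sg Hsg. eapply Rle_trans; [apply (face_limit axis2 z (fun y w => (y, x2 + sg * delta, w)) x1 x3 sg delta D (eps / 48))|]; try lra.
    - intros a b. unfold z, x. rewrite quad_shift_real. f_equal. rewrite <- (Q sg Hsg). ring.
    - intros a b. unfold z, x, shift; simpl. rewrite RtoC_plus. ring.
    - intros y w Hy Hw. destruct (Hnear (y) (x2 + sg * delta) (w)) as [K1 [K2 _]]; auto.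
      split; [apply K1|split; [exact K2|]]. apply (continuous3_face2 (green s u d z axis2)). apply Hcont; auto.
      unfold x. intros E. injection E. intros E3 E2 E1. now apply (Hne sg x2). }
  assert (F3 : forall sg, sg * sg = 1 ->
    Cmod (RtoC sg * I2 (fun y w => green s u d z axis3 (y, w, x3 + sg * delta)) (x1 - delta) (x1 + delta) (x2 - delta) (x2 + delta)
      - solid_angle_face * u x) <= eps / 6).
  { intros sg Hsg. eapply Rle_trans; [apply (face_limit axis3 z (fun y w => (y, w, x3 + sg * delta)) x1 x2 sg delta D (eps / 48))|]; try lra.
    - intros a b. unfold z, x. rewrite quad_shift_real. f_equal. rewrite <- (Q sg Hsg). ring.
    - intros a b. unfold z, x, shift; simpl. rewrite RtoC_plus. ring.
    - intros y w Hy Hw. destruct (Hnear (y) (w) (x3 + sg * delta)) as [K1 [K2 _]]; auto.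
      split; [apply K1|split; [exact K2|]]. apply (continuous3_face3 (green s u d z axis3)). apply Hcont; auto.
      unfold x. intros E. injection E. intros E3 E2 E1. now apply (Hne sg x3). }
  assert (S1 : 1 * 1 = 1) by ring. assert (S2 : (-1) * (-1) = 1) by ring.
  pose proof (F1 1 S1) as G1. pose proof (F1 (-1) S2) as G2.
  pose proof (F2 1 S1) as G3. pose proof (F2 (-1) S2) as G4.
  pose proof (F3 1 S1) as G5. pose proof (F3 (-1) S2) as G6.
  clear F1 F2 F3 Hcont Hnear H0 H1 H2 H3 H4.
  assert (Ep : forall p, p + 1 * delta = p + delta) by (intros; ring).
  assert (Em : forall p, p + -1 * delta = p - delta) by (intros; ring).
  rewrite Ep in G1, G3, G5. rewrite Em in G2, G4, G6.
  unfold green_flux, flux.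
  set (A1 := I2 _ _ _ _ _) in G1 at 1. set (A2 := I2 _ _ _ _ _) in G2 at 1.
  set (A3 := I2 _ _ _ _ _) in G3 at 1. set (A4 := I2 _ _ _ _ _) in G4 at 1.
  set (A5 := I2 _ _ _ _ _) in G5 at 1. set (A6 := I2 _ _ _ _ _) in G6 at 1.
  fold A1 A2 A3 A4 A5 A6.
  match goal with |- Cmod ?X <= _ => replace X with
    ((RtoC 1 * A1 - solid_angle_face * u x) + (RtoC (-1) * A2 - solid_angle_face * u x) +
     (RtoC 1 * A3 - solid_angle_face * u x) + (RtoC (-1) * A4 - solid_angle_face * u x) +
     (RtoC 1 * A5 - solid_angle_face * u x) + (RtoC (-1) * A6 - solid_angle_face * u x))%C end.
  2: { replace (RtoC (-1)) with (- RtoC 1)%C by (apply injective_projections; simpl; ring). ring. }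
  assert (T6 : forall a b c d' e f, Cmod (a + b + c + d' + e + f) <= Cmod a + Cmod b + Cmod c + Cmod d' + Cmod e + Cmod f).
  { intros a b c d' e f.
    pose proof (Cmod_triangle (a + b + c + d' + e) f). pose proof (Cmod_triangle (a + b + c + d') e).
    pose proof (Cmod_triangle (a + b + c) d'). pose proof (Cmod_triangle (a + b) c). pose proof (Cmod_triangle a b). lra. }
  eapply Rle_trans; [apply T6|]. lra.
Qed.

(** The value equals the flux through every sufficiently small cube about [x], hence also the limit
    of these fluxes. *)
Lemma flux_extension_real x : punctured x ->
  flux_extension s u d (R3_to_C3 x) = (6 * solid_angle_face * u x)%C.
Proof.
  intros HU. destruct x as [[x1 x2] x3].
  destruct (cube_flux_cut x1 x2 x3 HU) as [e [c [r [Hr [He [Hc Hcut]]]]]].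
  rewrite (flux_extension_eq s Hs u d dd Hu _ e c He Hc).
  assert (E : Cmod (cube_flux s u d (R3_to_C3 (x1, x2, x3)) c - cube_flux s u d (R3_to_C3 (x1, x2, x3)) e
    - 6 * solid_angle_face * u (x1, x2, x3)) = 0).
  { apply Rle_antisym; [|apply Cmod_ge_0]. apply le_epsilon. intros eps Heps.
    destruct (green_flux_limit x1 x2 x3 HU eps Heps) as [r' [Hr' H]].
    pose proof (Rmin_l r r'). pose proof (Rmin_r r r'). pose proof (Rmin_glb_lt _ _ _ Hr Hr').
    rewrite (Hcut (Rmin r r' / 2)) by lra. rewrite Rplus_0_l. apply H. lra. }
  apply Cmod_eq_0 in E.
  match type of E with (?X - ?Y)%C = _ => transitivity (X - Y + Y)%C; [ring|rewrite E; ring] end.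
Qed.

End Representation.

Lemma harmonic_extension (s : R) (u : R3 -> C) :
  s * s = 1 -> harmonic_on punctured u ->
  exists F : C3 -> C, holomorphic_on (fun z => slit s (quad z)) F /\ forall x, punctured x -> F (R3_to_C3 x) = u x.
Proof.
  intros Hs [d [dd Hu]]. pose proof solid_angle_face_neq_0 as Hk.
  exists (fun z => / (6 * solid_angle_face) * flux_extension s u d z)%C. split.
  - intros z Hz. apply C3diff_filterdiff.
    pose proof (flux_extension_differentiable s Hs u d dd Hu z Hz) as HF.
    assert (H0 : C3diff (fun _ => 0%C) z).
    { exists (fun _ => 0%C), 1, 0. split; [lra|]. intros h _. unfold pairing.
      match goal with |- Cmod ?X <= _ => replace X with (RtoC 0) by ring end. rewrite Cmod_0. lra. }
    apply (C3diff_local _ _ z 1 Rlt_0_1) with (2 := C3diff_lin _ _ z (/ (6 * solid_angle_face))%C H0 HF).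
    intros x _. ring.
  - intros x Hx. rewrite (flux_extension_real s Hs u d dd Hu x Hx). field.
    exact Hk.
Qed.

(** * The slit domains and the harmonic hull *)

Definition joined (D : C3 -> Prop) (z w : C3) : Prop :=
  exists g1 g2 g3 : R -> C,
    (forall t, Rcontinuous g1 t /\ Rcontinuous g2 t /\ Rcontinuous g3 t) /\
    (forall t, 0 <= t <= 1 -> D (g1 t, g2 t, g3 t)) /\
    (g1 0, g2 0, g3 0) = z /\ (g1 1, g2 1, g3 1) = w.

Lemma path_preimage_open (A : C3 -> Prop) (g1 g2 g3 : R -> C) t :
  open (T := C3_US) A -> Rcontinuous g1 t -> Rcontinuous g2 t -> Rcontinuous g3 t ->
  A (g1 t, g2 t, g3 t) -> exists r, 0 < r /\ forall t', Rabs (t' - t) < r -> A (g1 t', g2 t', g3 t').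
Proof.
  intros HA H1 H2 H3 Ht. destruct (HA _ Ht) as [e He].
  destruct (proj1 (continuous_C_iff g1 t) H1 e (cond_pos e)) as [r1 K1].
  destruct (proj1 (continuous_C_iff g2 t) H2 e (cond_pos e)) as [r2 K2].
  destruct (proj1 (continuous_C_iff g3 t) H3 e (cond_pos e)) as [r3 K3].
  exists (Rmin r1 (Rmin r2 r3)). split; [repeat apply Rmin_glb_lt; apply cond_pos|].
  intros t' Ht'.
  pose proof (Rmin_l r1 (Rmin r2 r3)). pose proof (Rmin_r r1 (Rmin r2 r3)).
  pose proof (Rmin_l r2 r3). pose proof (Rmin_r r2 r3).
  apply He. split; [split|]; apply Cmod_ball_C; [apply K1|apply K2|apply K3]; rewrite ball_R; lra.
Qed.

(** Along the path the indicator of [A] is locally constant, since [A] and [B] are open and disjoint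
    on [D]. If the path left [A], the intermediate value theorem would force the indicator to take
    the value 1/2. *)
Lemma joined_transport (D A B : C3 -> Prop) z w :
  open (T := C3_US) A -> open (T := C3_US) B ->
  (forall x, D x -> A x \/ B x) -> ~ (exists x, D x /\ A x /\ B x) ->
  joined D z w -> A z -> A w.
Proof.
  intros HA HB Hcov Hno [g1 [g2 [g3 [Hg [HD [E0 E1]]]]]] Az.
  set (G := fun t => (g1 (clamp 0 1 t), g2 (clamp 0 1 t), g3 (clamp 0 1 t)) : C3).
  assert (HG : forall t, D (G t)) by (intros t; apply HD, clamp_in; lra).
  apply NNPP. intros Aw.
  set (f := fun t => if excluded_middle_informative (A (G t)) then 0 else 1).
  assert (Hloc : forall P, open (T := C3_US) P -> forall t, P (G t) -> exists r, 0 < r /\ forall t', Rabs (t' - t) < r -> P (G t')).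
  { intros P HP t Pt. destruct (Hg (clamp 0 1 t)) as [K1 [K2 K3]].
    destruct (path_preimage_open P g1 g2 g3 _ HP K1 K2 K3 Pt) as [r [Hr H]].
    exists r; split; [exact Hr|]. intros t' Ht'. apply H. eapply Rle_lt_trans; [apply clamp_lip|exact Ht']. }
  assert (Hf : forall t, exists r, 0 < r /\ forall t', Rabs (t' - t) < r -> f t' = f t).
  { intros t. unfold f at 2. destruct (excluded_middle_informative (A (G t))) as [HAt|HAt].
    - destruct (Hloc A HA t HAt) as [r [Hr H]]. exists r; split; [exact Hr|].
      intros t' Ht'. unfold f. destruct (excluded_middle_informative (A (G t'))) as [_|n]; [reflexivity|].
      exfalso; now apply n, H.
    - assert (HBt : B (G t)) by (destruct (Hcov _ (HG t)); tauto).
      destruct (Hloc B HB t HBt) as [r [Hr H]]. exists r; split; [exact Hr|].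
      intros t' Ht'. unfold f. destruct (excluded_middle_informative (A (G t'))) as [y|_]; [|reflexivity].
      exfalso. apply Hno. exists (G t'). split; [apply HG|split; [exact y|now apply H]]. }
  assert (Hc : Ranalysis1.continuity f).
  { intros t eps He. destruct (Hf t) as [r [Hr H]]. exists r; split; [exact Hr|].
    intros t' [_ Ht']. simpl in Ht'. unfold Rdist in Ht'. simpl. unfold Rdist.
    rewrite (H t' Ht'), Rminus_diag, Rabs_R0. exact He. }
  assert (F0 : f 0 = 0).
  { unfold f, G. rewrite clamp_id by lra. rewrite E0. destruct (excluded_middle_informative (A z)); tauto. }
  assert (F1 : f 1 = 1).
  { unfold f, G. rewrite clamp_id by lra. rewrite E1. destruct (excluded_middle_informative (A w)); tauto. }
  destruct (IVT_gen f 0 1 (1 / 2) Hc) as [t [_ Ht]].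
  { rewrite F0, F1, Rmin_left, Rmax_right; lra. }
  unfold f in Ht. destruct (excluded_middle_informative (A (G t))); lra.
Qed.

(** * The slit domains are connected extension domains *)

Section Domain.
Variable s : R.
Hypothesis Hs : s * s = 1.

Definition slit_domain (z : C3) : Prop := slit s (quad z).

Lemma slit_domain_open : open (T := C3_US) slit_domain.
Proof.
  intros z Hz. destruct (slit_quad_open s Hs z Hz) as [r [Hr H]].
  assert (Hr6 : 0 < r / 6) by lra. exists (mkposreal _ Hr6). intros x Hx. apply H.
  destruct z as [[w1 w2] w3], x as [[x1 x2] x3]. destruct Hx as [[H1 H2] H3]. simpl in H1, H2, H3.
  apply ball_C_Cmod in H1, H2, H3. simpl. lra.
Qed.

Lemma quad_real x1 x2 x3 : quad (R3_to_C3 (x1, x2, x3)) = RtoC (x1 * x1 + x2 * x2 + x3 * x3).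
Proof. unfold quad; simpl. rewrite !RtoC_plus, !RtoC_mult. reflexivity. Qed.

Lemma slit_domain_real x : punctured x -> slit_domain (R3_to_C3 x).
Proof.
  destruct x as [[x1 x2] x3]. intros H. unfold slit_domain. rewrite quad_real.
  apply (slit_of_Re s Hs). now apply punctured_sqr.
Qed.

Lemma Rcontinuous_affine (f : R -> R) (z w : C) t :
  continuous f t -> Rcontinuous (fun t => z + RtoC (f t) * w)%C t.
Proof.
  intros Hf. apply (continuous_Cplus (T := R_UniformSpace)); [apply continuous_const|].
  apply (continuous_Cmult (T := R_UniformSpace)); [|apply continuous_const].
  now apply (continuous_RtoC (T := R_UniformSpace)).
Qed.

(** Multiplying [z] by scalars running from 1 to 1/c, where c is the root of its quadratic form,
    moves that root along the segment from c to 1. The segment stays in a convex half plane, so its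
    squares avoid the slit. *)
Lemma joined_normalized z : slit_domain z -> exists w, quad w = 1%C /\ joined slit_domain z w.
Proof.
  intros Hz. destruct (root_spec s Hs _ Hz) as [E Hp]. set (c := root s (quad z)) in *.
  assert (Hc : c <> 0%C) by now apply (half_plane_neq_0 s).
  destruct z as [[z1 z2] z3].
  set (k := (/ c - 1)%C).
  set (g := fun zi t => (zi + RtoC t * (zi * k))%C).
  assert (Hq : forall t, quad (g z1 t, g z2 t, g z3 t) = ((RtoC (1 - t) * c + RtoC t) * (RtoC (1 - t) * c + RtoC t))%C).
  { intros t. transitivity ((1 + RtoC t * k) * (1 + RtoC t * k) * quad (z1, z2, z3))%C.
    - unfold quad, g; simpl. ring.
    - rewrite <- E. unfold k. rewrite RtoC_minus. field. exact Hc. }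
  exists (g z1 1, g z2 1, g z3 1). split.
  - rewrite Hq. replace (RtoC (1 - 1)) with (RtoC 0) by (f_equal; ring). ring.
  - exists (g z1), (g z2), (g z3). split; [|split; [|split; [|reflexivity]]].
    + intros t. repeat split; apply Rcontinuous_affine; apply continuous_id.
    + intros t Ht. unfold slit_domain. rewrite Hq. apply (slit_sqr s Hs).
      unfold half_plane in *. simpl. destruct (Req_dec t 1) as [->|Hn].
      * replace ((1 - 1) * fst c - 0 * snd c + 1 + s * ((1 - 1) * snd c + 0 * fst c + 0)) with 1 by ring. lra.
      * replace ((1 - t) * fst c - 0 * snd c + t + s * ((1 - t) * snd c + 0 * fst c + 0))
          with ((1 - t) * (fst c + s * snd c) + t) by ring.
        assert (0 < (1 - t) * (fst c + s * snd c)) by (apply Rmult_lt_0_compat; lra). lra.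
    + unfold g. triple_ring.
Qed.

(** Writing w = x + i y, the condition gives |x|^2 - |y|^2 = 1. Shrinking y to 0 keeps the real part
    of the quadratic form at least 1, and [x] is nonzero. *)
Lemma joined_real w : quad w = 1%C -> exists x, punctured x /\ joined slit_domain w (R3_to_C3 x).
Proof.
  intros E. destruct w as [[[x1 y1] [x2 y2]] [x3 y3]].
  assert (E' : x1 * x1 + x2 * x2 + x3 * x3 - (y1 * y1 + y2 * y2 + y3 * y3) = 1).
  { apply (f_equal fst) in E. unfold quad in E; simpl in E. lra. }
  exists (x1, x2, x3). split.
  - intros H. injection H. intros -> -> ->. nra.
  - set (g := fun (x y t : R) => (x, (1 - t) * y) : C).
    exists (g x1 y1), (g x2 y2), (g x3 y3). split; [|split; [|split]].
    + assert (K : forall x y t, Rcontinuous (g x y) t).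
      { intros x y t. apply (continuous_C_pair (T := R_UniformSpace)); simpl; [apply continuous_const|].
        apply (continuous_mult (fun t => 1 - t) (fun _ => y)); [|apply continuous_const].
        apply (continuous_minus (fun _ => 1) (fun t => t)); [apply continuous_const|apply continuous_id]. }
      intros t; repeat split; apply K.
    + intros t Ht. apply (slit_of_Re s Hs). unfold quad, g; simpl.
      assert (0 <= y1 * y1 + y2 * y2 + y3 * y3) by nra.
      assert ((1 - t) * (1 - t) <= 1) by nra.
      match goal with |- 0 < ?X => replace X with
        (x1 * x1 + x2 * x2 + x3 * x3 - (1 - t) * (1 - t) * (y1 * y1 + y2 * y2 + y3 * y3)) by ring end.
      nra.
    + unfold g. apply f_equal2; [apply f_equal2|]; apply f_equal2; ring.
    + unfold g. simpl. apply f_equal2; [apply f_equal2|]; (apply injective_projections; simpl; ring).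
Qed.

Lemma joined_segment x1 x2 x3 y1 y2 y3 :
  (forall t, 0 <= t <= 1 -> punctured (x1 + t * (y1 - x1), x2 + t * (y2 - x2), x3 + t * (y3 - x3))) ->
  joined slit_domain (R3_to_C3 (x1, x2, x3)) (R3_to_C3 (y1, y2, y3)).
Proof.
  intros H. set (g := fun x y t : R => RtoC (x + t * (y - x))).
  exists (g x1 y1), (g x2 y2), (g x3 y3). split; [|split; [|split]].
  - assert (K : forall x y t, Rcontinuous (g x y) t).
    { intros x y t. apply (continuous_RtoC (T := R_UniformSpace)).
      apply (continuous_plus (fun _ => x) (fun t => t * (y - x))); [apply continuous_const|].
      apply (continuous_mult (fun t => t) (fun _ => y - x)); [apply continuous_id|apply continuous_const]. }
    intros t; repeat split; apply K.
  - intros t Ht. apply (slit_domain_real _ (H t Ht)).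
  - unfold g. simpl. apply f_equal2; [apply f_equal2|]; f_equal; ring.
  - unfold g. simpl. apply f_equal2; [apply f_equal2|]; f_equal; ring.
Qed.

(** A segment from a point off the first axis meets that axis only at its end (1, 0, 0), hence
    misses 0. *)
Lemma joined_off_axis x1 x2 x3 : x2 <> 0 \/ x3 <> 0 ->
  joined slit_domain (R3_to_C3 (x1, x2, x3)) (R3_to_C3 (1, 0, 0)).
Proof.
  intros Hor. apply joined_segment. intros t Ht E. injection E. intros E3 E2 E1.
  assert (F3 : (1 - t) * x3 = 0) by lra. assert (F2 : (1 - t) * x2 = 0) by lra.
  assert (H1 : 1 - t = 0).
  { apply Rmult_integral in F3, F2. tauto. }
  replace t with 1 in E1 by lra. lra.
Qed.

Lemma joined_on_axis x1 : x1 <> 0 -> joined slit_domain (R3_to_C3 (x1, 0, 0)) (R3_to_C3 (0, 1, 0)).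
Proof.
  intros H. apply joined_segment. intros t Ht E. injection E. intros E3 E2 E1.
  assert (t = 0) by lra. subst t. lra.
Qed.

Lemma slit_domain_connected : connected (T := C3_US) slit_domain.
Proof.
  intros A B HA HB Hcov [a [Da Aa]] [b [Db Bb]]. apply NNPP. intros Hno.
  (* Any part of a separation that meets the domain contains the base point (1, 0, 0); used for both
     parts, this makes them overlap. *)
  assert (K : forall P Q : C3 -> Prop, open (T := C3_US) P -> open (T := C3_US) Q ->
    (forall x, slit_domain x -> P x \/ Q x) -> ~ (exists x, slit_domain x /\ P x /\ Q x) ->
    forall z, slit_domain z -> P z -> P (R3_to_C3 (1, 0, 0))).
  { intros P Q HP HQ HPQ HN z Dz Pz.
    pose proof (fun z w => joined_transport slit_domain P Q z w HP HQ HPQ HN) as T.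
    destruct (joined_normalized z Dz) as [w [Ew Jw]].
    destruct (joined_real w Ew) as [[[x1 x2] x3] [Hx Jx]].
    apply T in Jw; [|exact Pz]. apply T in Jx; [|exact Jw].
    destruct (classic (x2 <> 0 \/ x3 <> 0)) as [Hor|Hor].
    - exact (T _ _ (joined_off_axis x1 x2 x3 Hor) Jx).
    - assert (E2 : x2 = 0) by (apply NNPP; tauto). assert (E3 : x3 = 0) by (apply NNPP; tauto). subst x2 x3.
      assert (H1 : x1 <> 0) by (intros ->; now apply Hx).
      (* A point of the first axis may lie on the far side of 0, so the path makes a detour through
         (0, 1, 0). *)
      apply (T _ _ (joined_off_axis 0 1 0 (or_introl R1_neq_R0))).
      exact (T _ _ (joined_on_axis x1 H1) Jx). }
  apply Hno. exists (R3_to_C3 (1, 0, 0)). split; [|split].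
  - apply slit_domain_real. intros E. injection E. lra.
  - now apply (K A B HA HB Hcov Hno a).
  - apply (K B A HB HA) with (z := b); auto.
    + intros x Dx. destruct (Hcov x Dx); tauto.
    + intros [x Hx]. apply Hno. exists x. tauto.
Qed.

Lemma slit_domain_extension : harmonic_extension_domain punctured slit_domain.
Proof.
  split; [exact slit_domain_open|split; [exact slit_domain_connected|split]].
  - exact slit_domain_real.
  - intros u Hu. exact (harmonic_extension s u Hs Hu).
Qed.

(** On real points the kernel is 1/|x|, for either sign [s]; its derivatives and the vanishing trace
    of its Hessian are already at hand. *)
Lemma inverse_distance_harmonic : harmonic_on punctured (fun x => newton s (R3_to_C3 x)).
Proof.
  exists (fun i x => newton_grad s i (R3_to_C3 x)), (fun i j x => newton_hess s i j (R3_to_C3 x)).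
  assert (Esh : forall x, R3_to_C3 x = shift (RtoC 0, RtoC 0, RtoC 0) x).
  { intros [[x1 x2] x3]. unfold shift; simpl. triple_ring. }
  assert (Hcont : forall f x, continuousC3 f (R3_to_C3 x) ->
    continuous (T := R3_US) (U := C_UniformSpace) (fun x => f (R3_to_C3 x)) x).
  { intros f [[x1 x2] x3] Hf. apply continuous3_elim. rewrite Esh in Hf. apply continuous3_shift in Hf.
    apply continuous3_iff. intros eps He. destruct (proj1 (continuous3_iff _ _ _ _) Hf eps He) as [r [Hr H]].
    exists r; split; [exact Hr|]. intros. rewrite !Esh. now apply H. }
  assert (Hpar : forall f g i x, C11 f g (R3_to_C3 x) ->
    is_partial i (fun x => f (R3_to_C3 x)) x (g i (R3_to_C3 x))).
  { intros f g i x Hf. rewrite Esh in *. apply (C11_partial f g _ x i) in Hf.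
    rewrite is_partial_iff in *. intros eps He. destruct (Hf eps He) as [r [Hr H]].
    exists r; split; [exact Hr|]. intros. rewrite !Esh. now apply H. }
  intros x Hx. assert (Hsl : slit s (quad (R3_to_C3 x))) by now apply slit_domain_real.
  split; [|split; [|split]].
  - apply (Hcont (newton s)). now apply newton_continuous.
  - intros i. split.
    + apply (Hpar (newton s) (newton_grad s)). now apply C11_newton.
    + apply (Hcont (newton_grad s i)). now apply newton_grad_continuous.
  - intros i j. split.
    + apply (Hpar (newton_grad s i) (newton_hess s i)). now apply C11_newton_grad.
    + apply (Hcont (newton_hess s i j)). now apply newton_hess_continuous.
  - now apply newton_hess_trace.
Qed.

End Domain.

(** * The two slit domains exclude a hull *)

Lemma slit_cover (q : C) : q <> 0%C -> slit 1 q \/ slit (-1) q.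
Proof.
  intros H. apply Cmod_gt_0 in H. unfold slit.
  destruct (Rle_dec 0 (snd q)); [left|right]; lra.
Qed.

(** The derivative along the first axis is the value of the complex-linear differential at the first
    basis vector; on that axis the norm of the product space is the modulus of the one nonzero
    coordinate. *)
Lemma holomorphic_slice (W : C3 -> Prop) (F : C3 -> C) (w : C) :
  holomorphic_on W F -> W (w, RtoC 0, RtoC 0) -> Cdiff (fun x => F (x, RtoC 0, RtoC 0)) w.
Proof.
  intros HF HW. destruct (HF _ HW) as [l [Hl H]].
  specialize (H _ (fun P HP => HP)).
  apply (Cdiff_of_eps _ _ (l (RtoC 1, RtoC 0, RtoC 0))). intros eps He.
  destruct (H (mkposreal eps He)) as [r Hr]. exists r. split; [apply cond_pos|].
  intros x Hx.
  assert (Hb : ball (M := C3_US) (w, RtoC 0, RtoC 0) r (x, RtoC 0, RtoC 0)).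
  { split; [split|]; simpl; apply Cmod_ball_C; [exact Hx| |]; replace (RtoC 0 - RtoC 0)%C with (RtoC 0) by ring;
    rewrite Cmod_0; apply cond_pos. }
  specialize (Hr _ Hb). simpl in Hr.
  assert (Em : minus (G := C3_NM) (x, RtoC 0, RtoC 0) (w, RtoC 0, RtoC 0)
     = scal (V := C3_NM) (x - w)%C (RtoC 1, RtoC 0, RtoC 0)).
  { change ((x - w, RtoC 0 - RtoC 0, RtoC 0 - RtoC 0) = ((x - w) * RtoC 1, (x - w) * RtoC 0, (x - w) * RtoC 0))%C.
    triple_ring. }
  assert (En : norm (V := C3_NM) (minus (G := C3_NM) (x, RtoC 0, RtoC 0) (w, RtoC 0, RtoC 0)) = Cmod (x - w)).
  { change (minus (G := C3_NM) (x, RtoC 0, RtoC 0) (w, RtoC 0, RtoC 0)) with ((x - w, RtoC 0 - RtoC 0, RtoC 0 - RtoC 0)%C : C3).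
    change (sqrt (sqrt (Cmod (x - w) ^ 2 + Cmod (RtoC 0 - RtoC 0) ^ 2) ^ 2 + Cmod (RtoC 0 - RtoC 0) ^ 2) = Cmod (x - w)).
    replace (RtoC 0 - RtoC 0)%C with (RtoC 0) by ring. rewrite Cmod_0.
    pose proof (Cmod_ge_0 (x - w)).
    replace (Cmod (x - w) ^ 2 + 0 ^ 2) with (Cmod (x - w) ^ 2) by ring. rewrite sqrt_pow2 by assumption.
    replace (Cmod (x - w) ^ 2 + 0 ^ 2) with (Cmod (x - w) ^ 2) by ring. now rewrite sqrt_pow2. }
  rewrite En in Hr. rewrite Em, (linear_scal l Hl) in Hr.
  rewrite (Cmult_comm (l _)). exact Hr.
Qed.

Theorem mainTheorem2 :
  ~ exists W : C3 -> Prop,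
      is_harmonic_hull (fun x : R3 => x <> (0%R, 0%R, 0%R)) W.
Proof.
  intros [W [[_ [_ [_ Hext]]] Hmax]].
  assert (S1 : 1 * 1 = 1) by ring. assert (S2 : -1 * -1 = 1) by ring.
  destruct (Hext _ (inverse_distance_harmonic 1 S1)) as [F [HF HFu]].
  apply (no_holomorphic_inverse_abs (fun w => F (w, RtoC 0, RtoC 0))).
  - intros w Hw. apply (holomorphic_slice W); [exact HF|].
    assert (Hq : quad (w, RtoC 0, RtoC 0) <> 0%C).
    { replace (quad (w, RtoC 0, RtoC 0)) with (w * w)%C by (unfold quad; simpl; ring).
      now apply Cmult_neq_0. }
    destruct (slit_cover _ Hq) as [H|H].
    + exact (Hmax _ (slit_domain_extension 1 S1) _ H).
    + exact (Hmax _ (slit_domain_extension (-1) S2) _ H).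
  - intros t Ht.
    change (RtoC t, RtoC 0, RtoC 0) with (R3_to_C3 (t, 0, 0)). rewrite HFu.
    + rewrite (newton_real 1 S1 _ (Rabs t)).
      * symmetry; apply RtoC_inv. now apply Rabs_no_R0.
      * now apply Rabs_pos_lt.
      * rewrite quad_real. f_equal. rewrite <- Rabs_mult, Rabs_pos_eq by apply Rle_0_sqr. ring.
    + intros E. injection E. exact Ht.
Qed.
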